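(* Let $f$ be an orientation-preserving $C^2$ diffeomorphism of a (nondegenerate, compact) closed interval $L$, different from the identity, all of whose fixed points are parabolic. Then the sequence $\Gamma^n_+(f)/n^2$ converges to a finite limit as $n\to\infty$, and $$\lim_{n \to \infty} \frac{\Gamma^n_+ (f)}{n^2} = \sup_{I \in \mathcal{C} (f)} \left[ \frac{1}{2}\, |D^2 f (r_I)| \cdot \max_{y \in I} |X_{I} (y)| \right].$$
   Context: Notation: $Df$, $D^2f$ are the first and second derivatives, $f^n$ is the $n$-th iterate, and $\Gamma^n_+(f) := \sup_{x\in L} Df^n(x)$. A fixed point $p$ of $f$ is parabolic if $Df(p)=1$. A component of $f$ is a nondegenerate closed subinterval $I\subset L$ with $f(I)=I$ (so its endpoints are fixed points) containing no fixed point of $f$ in its interior $I^{\mathrm{o}}$; $\mathcal{C}(f)$ is the family of all components. For $I\in\mathcal{C}(f)$, exactly one endpoint of $I$ is topologically repelling for $f|_I$, i.e. $f^{-n}(x)$ converges to it for every $x\in I^{\mathrm{o}}$; it is denoted $r_I$. By classical work of Szekeres and Kopell, on the half-closed interval $I^+:=I^{\mathrm{o}}\cup\{r_I\}$ there is a unique $C^1$ vector field $X_I$ (a $C^1$ real function) whose time-1 map coincides with $f|_{I^+}$. It extends continuously to all of $I$ by the value $0$ at the endpoint other than $r_I$; this extension is used in $\max_{y\in I}|X_I(y)|$. *)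

(* Defs.v *)
From mathcomp Require Export all_boot all_order all_algebra.
From mathcomp Require Export all_classical all_reals all_analysis.

Set Implicit Arguments.
Unset Strict Implicit.
Unset Printing Implicit Defensive.

Import Order.TTheory GRing.Theory Num.Theory.
Import numFieldNormedType.Exports.

Local Open Scope classical_set_scope.
Local Open Scope ring_scope.

(* A map of an interval A is represented by a total function R -> R whose values
   outside A are irrelevant.  All derivatives are therefore taken relative to A,
   which makes them one-sided at the endpoints of A that belong to A. *)
Section DerivativeWithin.
Context {R : realType}.
Implicit Types (A : set R) (f : R -> R).

Definition diff_quotient f (x y : R) : R := (f y - f x) / (y - x).

Definition has_derivative_within A f (x l : R) : Prop :=
  diff_quotient f x y @[y --> within A x^'] --> l.

Definition derivable_within A f (x : R) : Prop :=
  exists l, has_derivative_within A f x l.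

Definition derive_within A f (x : R) : R :=
  lim (diff_quotient f x y @[y --> within A x^']).

Fixpoint C_within (k : nat) A f : Prop :=
  if k is k'.+1 then
    (forall x, A x -> derivable_within A f x) /\ C_within k' A (derive_within A f)
  else {within A, continuous f}.

End DerivativeWithin.

Section IntervalDynamics.
Context {R : realType}.
Implicit Types (L I J : set R) (f X : R -> R).

(* [pinv L f] is the inverse of f : L -> L; it is junk outside f @` L. *)
Definition Ck_diffeomorphism (k : nat) L f : Prop :=
  [/\ set_bij L L f, C_within k L f & C_within k L (pinv L f)].

Definition orientation_preserving L f : Prop :=
  forall x y, L x -> L y -> x < y -> f x < f y.

Definition parabolic L f (p : R) : Prop := f p = p /\ derive_within L f p = 1.

Definition Gamma_plus L f (n : nat) : R :=
  sup [set derive_within L (iter n f) x | x in L].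

Definition components L f : set (set R) :=
  [set I | (exists c d : R, c < d /\ I = `[c, d]%classic) /\
           [/\ I `<=` L, f @` I = I & forall x : R, I° x -> f x <> x]].

Definition endpoints I : set R := I `\` I°.

Definition topologically_repelling L f I (r : R) : Prop :=
  forall x : R, I° x -> iter n (pinv L f) x @[n --> \oo] --> r.

(* The endpoint r_I; such a point is unique when I is a component of f. *)
Definition repelling_endpoint L f I : R :=
  xget 0 [set r | endpoints I r /\ topologically_repelling L f I r].

Definition Iplus L f I : set R := I° `|` [set repelling_endpoint L f I].

(* f is the time-1 map on J of the vector field X: the integral curve of X
   issued from any x in J stays in J on [0, 1] and is at f x at time 1. *)
Definition time_one_map J X f : Prop :=
  forall x, J x -> exists gamma : R -> R,
    [/\ gamma 0 = x, gamma 1 = f x &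
        forall t : R, `[0, 1]%classic t ->
          J (gamma t) /\ has_derivative_within `[0, 1] gamma t (X (gamma t))].

(* The C^1 vector field of Szekeres and Kopell.  Only its restriction to I^+
   is determined, so [szekeres_field] cuts the chosen total function off to 0
   outside I^+, which gives the continuous extension of X_I to I. *)
Definition is_szekeres_field L f I X : Prop :=
  C_within 1 (Iplus L f I) X /\ time_one_map (Iplus L f I) X f.

Definition szekeres_field L f I : R -> R :=
  patch (fun=> 0) (Iplus L f I) (xget (fun=> 0) [set X | is_szekeres_field L f I X]).

(* (1/2) |D^2 f(r_I)| max_{y in I} |X_I(y)|.  The supremum is a maximum, X_I being
   continuous on the compact interval I. *)
Definition component_growth L f I : R :=
  2^-1 * `|derive_within L (derive_within L f) (repelling_endpoint L f I)| *
  sup [set `|szekeres_field L f I y| | y in I].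

End IntervalDynamics.

(* Main.v *)
(* On a component I with repelling endpoint r, put v = |u - r|, so that f becomes an expansion F
   of [0, l] with inverse G, and write D(v) = v - G(v).  The mean value theorem makes
   D(G^n v) / (G^n)'(v) a sequence whose successive ratios are 1 + O(D(G^n v)); the errors
   telescope, so the sequence converges, and its limit is the Szekeres field X, with
   exp(-C v) D(v) <= X(v) <= exp(C v) D(v) for a constant C depending on f only.  Conversely
   any C^1 field with time-1 map F satisfies X(F v) = F'(v) X(v) and X ~ D at 0, which forces
   it to be this limit.

   Since (F^n)'(v) = X(F^n v) / X(v), everything is governed by beta = X^(-1/2):
   sqrt((F^n)'(v)) = sqrt(X(F^n v)) beta(v), and beta(v) is estimated by summing
   beta(u) - beta(F u) along the orbit.  From (F' - 1)^2 <= 2 sup|F''| (F - id) each increment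
   is bounded by a constant depending on f only, and near 0 the increment tends to
   sqrt(F''(0) / 2).  An orbit ending in a compact part of ]0, l[ spends a bounded number of
   steps away from 0, whence sqrt((F^n)') <= sqrt(max X) (sqrt(F''(0) / 2) + o(1)) n; orbits
   ending where X is small, in particular all those in short components, contribute o(n). *)

(* The derivative of F^n grows like n^2, so its square root is what can be estimated step by step.
   In the model F v = v + A v^2 one has X ~ A v^2, hence beta ~ 1 / (sqrt A v); as 1 / v drops by
   about A under F, beta drops by about sqrt A at each step, which is where A = F''(0) / 2 comes
   from. Since X is only C^1, increments of beta are read off X (F u) = F'(u) X(u) and not off a
   derivative of beta; this needs F' - 1 to be at most a multiple of sqrt X. The bound on (F' - 1)^2
   gives it: it is the classical h'^2 <= 2 sup|h''| h for a nonnegative h, and holds whatever F''(0)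
   is, so flat contact with the identity needs no separate case. The obstacle is uniformity: f may
   have infinitely many components, yet one rank must serve all of them in the upper bound. Hence K
   and m are taken once on the whole of [a, b], and only the finitely many long components get the
   sharp constant. Derivatives at end points are one-sided; clamping makes every map continuous on
   the line, so that two-sided derivatives are required in open intervals only. *)
Require Import Defs.
From mathcomp Require Import ring lra.
Import Order.TTheory GRing.Theory Num.Theory.
Import numFieldNormedType.Exports.
Local Open Scope classical_set_scope.
Local Open Scope ring_scope.
Set Implicit Arguments.
Unset Strict Implicit.
Unset Printing Implicit Defensive.

(** * Derivatives and continuity in epsilon-delta form *)

Section Basics.
Context {R : realType}.
Implicit Types (f g h : R -> R) (A : set R).

Lemma cvg_within_dnbhsP A (h : R -> R) (x l : R) :
  (h y @[y --> within A x^'] --> l) <->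
  (forall e : R, 0 < e -> exists d : R, 0 < d /\ forall y, A y -> y != x -> `|y - x| < d ->
     `|h y - l| < e).
Proof.
split.
- move=> /cvgrPdist_lt H e e0; have := H e e0.
  rewrite !near_withinE => /nbhs_ballP[d d0 Hd].
  exists d; split => // y Ay yx yd; rewrite distrC; apply: (Hd y) => //.
  by rewrite /ball /= distrC.
- move=> H; apply/cvgrPdist_lt => e e0; have [d [d0 Hd]] := H e e0.
  rewrite !near_withinE; apply/nbhs_ballP; exists d => // y.
  rewrite /ball /= distrC => yd yx Ay; rewrite distrC; exact: Hd.
Qed.

Lemma has_derivative_withinP A f (x l : R) :
  has_derivative_within A f x l <->
  (forall e : R, 0 < e -> exists d : R, 0 < d /\ forall y, A y -> y != x -> `|y - x| < d ->
     `|diff_quotient f x y - l| < e).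
Proof. exact: cvg_within_dnbhsP. Qed.

Lemma is_deriveP f (x l : R) :
  is_derive x 1 f l <->
  (forall e : R, 0 < e -> exists d : R, 0 < d /\ forall y, y != x -> `|y - x| < d ->
     `|diff_quotient f x y - l| < e).
Proof.
split.
- move=> df; have /cvg_ex[] := @ex_derive _ _ _ _ _ _ _ df.
  move=> l' Hl'; have El : l' = l.
    by rewrite -(@derive_val _ _ _ _ _ _ _ df) /derive; apply/esym/cvg_lim.
  move: Hl'; rewrite El => /cvgrPdist_lt H e e0; have := H e e0.
  rewrite ?near_simpl => /nbhs_ballP[d d0 Hd].
  exists d; split => // y yx yd; rewrite distrC /diff_quotient.
  have := Hd (y - x); rewrite /= [_ *: 1]mulr1 subrK mulrC; apply.
    by rewrite /ball /= sub0r normrN.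
  by rewrite subr_eq0.
- move=> H; apply: DeriveDef; last first.
    apply/cvg_lim => //.
    apply/cvgrPdist_lt => e e0; have [d [d0 Hd]] := H e e0.
    rewrite ?near_simpl; apply/nbhs_ballP; exists d => // y /=.
    rewrite /ball /= sub0r normrN => yd y0.
    have := Hd (y + x); rewrite /diff_quotient addrK distrC => /(_ _ yd).
    rewrite [_ *: 1]mulr1 [_ *: _]mulrC; apply.
    by rewrite -subr_eq0 addrK.
  apply/cvg_ex; exists l.
  apply/cvgrPdist_lt => e e0; have [d [d0 Hd]] := H e e0.
  rewrite ?near_simpl; apply/nbhs_ballP; exists d => // y /=.
  rewrite /ball /= sub0r normrN => yd y0.
  have := Hd (y + x); rewrite /diff_quotient addrK distrC => /(_ _ yd).
  rewrite [_ *: 1]mulr1 [_ *: _]mulrC; apply.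
  by rewrite -subr_eq0 addrK.
Qed.

Lemma is_derive_within A f (x l : R) : is_derive x 1 f l -> has_derivative_within A f x l.
Proof.
move=> /is_deriveP H; apply/has_derivative_withinP => e /H[d [d0 Hd]].
by exists d; split => // y _; exact: Hd.
Qed.

Lemma within_is_derive f (p q x l : R) : p < x < q ->
  has_derivative_within `[p, q] f x l -> is_derive x 1 f l.
Proof.
move=> /andP[px xq] /has_derivative_withinP H; apply/is_deriveP => e /H[d [d0 Hd]].
exists (Num.min d (Num.min (x - p) (q - x))); split.
  by rewrite !lt_min d0 !subr_gt0 px xq.
move=> y yx; rewrite !lt_min => /and3P[yd yp yq]; apply: Hd => //=.
rewrite in_itv /=; move: yp yq; rewrite !ltr_norml => /andP[? ?] /andP[? ?].
by apply/andP; split; lra.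
Qed.

Lemma derive_continuous f (x l : R) : is_derive x 1 f l -> {for x, continuous f}.
Proof.
move=> df; apply: differentiable_continuous; apply/derivable1_diffP.
exact: (@ex_derive _ _ _ _ _ _ _ df).
Qed.

Lemma continuousP_eps f (x : R) :
  {for x, continuous f} <->
  (forall e : R, 0 < e -> exists d : R, 0 < d /\ forall y, `|y - x| < d -> `|f y - f x| < e).
Proof.
split.
- move=> /cvgrPdist_lt H e /H; rewrite ?near_simpl => /nbhs_ballP[d d0 Hd].
  exists d; split => // y yd; rewrite distrC; apply: Hd.
  by rewrite /ball /= distrC.
- move=> H; apply/cvgrPdist_lt => e /H[d [d0 Hd]]; rewrite ?near_simpl.
  apply/nbhs_ballP; exists d => // y; rewrite /ball /= distrC => /Hd.
  by rewrite distrC.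
Qed.

Lemma within_continuousP_eps A f :
  {within A, continuous f} <->
  (forall x, A x -> forall e : R, 0 < e -> exists d : R, 0 < d /\
     forall y, A y -> `|y - x| < d -> `|f y - f x| < e).
Proof.
split.
- move=> /subspace_continuousP H x Ax e e0.
  have /cvgrPdist_lt /(_ e e0) := H x Ax.
  rewrite !near_withinE => /nbhs_ballP[d d0 Hd].
  exists d; split => // y Ay yd; rewrite distrC; apply: Hd => //.
  by rewrite /ball /= distrC.
- move=> H; apply/subspace_continuousP => x Ax; apply/cvgrPdist_lt => e e0.
  have [d [d0 Hd]] := H x Ax e e0.
  rewrite !near_withinE; apply/nbhs_ballP; exists d => // y.
  by rewrite /ball /= distrC => yd Ay; rewrite distrC; exact: Hd.
Qed.

Lemma continuous_withinT A f : (forall x, A x -> {for x, continuous f}) ->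
  {within A, continuous f}.
Proof.
move=> H; apply/within_continuousP_eps => x /H/continuousP_eps C e /C[d [d0 Hd]].
by exists d; split => // y _; exact: Hd.
Qed.

(** Two-sided continuity at [a] and [b] costs nothing for clamped maps; differentiability is asked
    only inside, so that end points of components are allowed. *)
Lemma mean_value f (df : R -> R) (a b : R) : a < b ->
  (forall x : R, a < x < b -> is_derive x 1 f (df x)) ->
  (forall x : R, a <= x <= b -> {for x, continuous f}) ->
  exists c, a < c < b /\ f b - f a = df c * (b - a).
Proof.
move=> ab dfx cf.
have Hd : forall x : R, x \in `]a, b[ -> is_derive x 1 f (df x).
  by move=> x; rewrite in_itv /=; exact: dfx.
have Hc : {within `[a, b], continuous f}.
  by apply: continuous_withinT => x /=; rewrite in_itv /=; exact: cf.
by have [c] := MVT ab Hd Hc; rewrite in_itv /= => ? ?; exists c.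
Qed.

Lemma mean_value_derive f (df : R -> R) (a b : R) : a < b ->
  (forall x : R, a <= x <= b -> is_derive x 1 f (df x)) ->
  exists c, a < c < b /\ f b - f a = df c * (b - a).
Proof.
move=> ab H; apply: mean_value => // x xab.
- by apply: H; move: xab => /andP[? ?]; rewrite !ltW.
- exact: derive_continuous (H x xab).
Qed.

Lemma ge0_derive_nondecreasing f (df : R -> R) (a b : R) : a <= b ->
  (forall x : R, a < x < b -> is_derive x 1 f (df x)) ->
  (forall x : R, a <= x <= b -> {for x, continuous f}) ->
  (forall x : R, a < x < b -> 0 <= df x) -> f a <= f b.
Proof.
rewrite le_eqVlt => /predU1P[->//|ab] dfx cf df0.
have [c [cab E]] := mean_value ab dfx cf.
by rewrite -subr_ge0 E mulr_ge0 ?df0 // subr_ge0 ltW.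
Qed.

Lemma gt0_derive_increasing f (df : R -> R) (a b : R) : a < b ->
  (forall x : R, a < x < b -> is_derive x 1 f (df x)) ->
  (forall x : R, a <= x <= b -> {for x, continuous f}) ->
  (forall x : R, a < x < b -> 0 < df x) -> f a < f b.
Proof.
move=> ab dfx cf df0; have [c [cab E]] := mean_value ab dfx cf.
by rewrite -subr_gt0 E mulr_gt0 ?df0 // subr_gt0.
Qed.

Lemma is_derive_unique f (x l l' : R) :
  is_derive x 1 f l -> is_derive x 1 f l' -> l = l'.
Proof.
by move=> H H'; rewrite -(@derive_val _ _ _ _ _ _ _ H) -(@derive_val _ _ _ _ _ _ _ H').
Qed.

Lemma eq_is_derive f g (x l d : R) : 0 < d ->
  (forall y, `|y - x| < d -> f y = g y) -> is_derive x 1 f l -> is_derive x 1 g l.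
Proof.
move=> d0 fg /is_deriveP H; apply/is_deriveP => e /H[r [r0 Hr]].
exists (Num.min d r); split; first by rewrite lt_min d0.
move=> y yx; rewrite lt_min => /andP[yd yr].
rewrite /diff_quotient -fg // -fg ?subrr ?normr0 //; exact: Hr.
Qed.

Lemma cvg_nearP (u : nat -> R) (l : R) :
  (u n @[n --> \oo] --> l) <->
  (forall e : R, 0 < e -> exists N, forall n, (N <= n)%N -> `|u n - l| < e).
Proof.
split.
- move=> /cvgrPdist_lt H e /H [N _ HN]; exists N => n Nn; rewrite distrC; exact: HN.
- move=> H; apply/cvgrPdist_lt => e /H[N HN]; exists N => // n /= Nn.
  rewrite distrC; exact: HN.
Qed.

End Basics.

(** * Limits, antiderivatives and inverses *)

Section Calculus.
Context {R : realType}.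
Implicit Types (f g h : R -> R).

Lemma itv_oo_convex (p q x y z : R) :
  p < x < q -> p < y < q -> x <= z <= y -> p < z < q.
Proof.
move=> /andP[px _] /andP[_ yq] /andP[xz zy].
by rewrite (lt_le_trans px xz) (le_lt_trans zy yq).
Qed.

(** Both [w] and [u - w] are monotone and bounded, so [u] converges as their sum; letting m tend to
    infinity in |u m - u n| <= w n - w m gives the rate. *)
Lemma telescoping_cvg (u w : nat -> R) :
  (forall n, `|u n.+1 - u n| <= w n - w n.+1) -> (forall n, 0 <= w n) ->
  exists l : R, (u n @[n --> \oo] --> l) /\ forall n, `|l - u n| <= w n.
Proof.
move=> H w0.
have tel n m : (n <= m)%N -> `|u m - u n| <= w n - w m.
  elim: m => [|m IH]; first by rewrite leqn0 => /eqP ->; rewrite !subrr normr0.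
  rewrite leq_eqVlt => /predU1P[->|]; first by rewrite !subrr normr0.
  rewrite ltnS => /IH nm; rewrite -(subrKA (u m)).
  by apply: (le_trans (ler_normD _ _)); have := H m; lra.
have cw : cvgn w.
  apply: nonincreasing_is_cvgn => [n m /tel nm|].
    by have := le_trans (normr_ge0 _) nm; rewrite subr_ge0.
  by exists 0 => _ [n _ <-].
have cv : cvgn (fun n => u n - w n).
  apply: nondecreasing_is_cvgn => [n m /tel|].
    by rewrite ler_norml => /andP[? ?]; lra.
  exists (u 0%N + w 0%N) => _ [n _ <-].
  by have := tel 0%N n (leq0n _); rewrite ler_norml => /andP[? ?]; have := w0 n; lra.
have cu : (u n @[n --> \oo] --> limn (fun n => u n - w n) + limn w).
  have E : u = (fun n => u n - w n) \+ w by apply/funext => n /=; rewrite subrK.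
  by rewrite [X in X @ _ --> _]E; exact: cvgD.
set l := _ + _ in cu; exists l; split => // n.
have cn : (`|u m - u n| @[m --> \oo] --> `|l - u n|).
  by apply: cvg_norm; apply: cvgB => //; exact: cvg_cst.
apply: (cvgr_to_le cn); exists n => // m /= nm.
by apply: (le_trans (tel _ _ nm)); rewrite gerBl.
Qed.

(** The uniform bound [e n] makes [d] continuous. The quotient of [h] is the limit of those of
    [hn n], each equal to [dn n c] for some c between x and y; and [dn n c] is near [d c], hence
    near [d x]. *)
Lemma is_derive_limit (hn dn : nat -> R -> R) h d (e : nat -> R) (p q : R) :
  (forall n x, p < x < q -> is_derive x 1 (hn n) (dn n x)) ->
  (forall n x, p < x < q -> {for x, continuous (dn n)}) ->
  (forall n x, p < x < q -> `|dn n x - d x| <= e n) ->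
  (e n @[n --> \oo] --> 0) ->
  (forall x : R, p < x < q -> hn n x @[n --> \oo] --> h x) ->
  forall x : R, p < x < q -> is_derive x 1 h (d x) /\ {for x, continuous d}.
Proof.
move=> dh cd de e0 hh x xpq.
have cont : {for x, continuous d}.
  apply/continuousP_eps => r r0.
  have r30 : 0 < r / 3 by rewrite divr_gt0.
  have /cvg_nearP /(_ _ r30) [N /(_ N (leqnn _))] := e0.
  rewrite subr0 => eN.
  have /continuousP_eps /(_ _ r30) [s [s0 Hs]] := cd N x xpq.
  exists (Num.min s (Num.min (x - p) (q - x))); move/andP: (xpq) => [px xq]; split.
    by rewrite !lt_min s0 !subr_gt0 px xq.
  move=> y; rewrite !lt_min => /and3P[/Hs ys yp yq].
  have ypq : p < y < q.
    by move: yp yq; rewrite !ltr_norml => /andP[? ?] /andP[? ?]; apply/andP; split; lra.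
  have := de N y ypq; have := de N x xpq; move: eN ys.
  rewrite !ltr_norml !ler_norml => /andP[? ?] /andP[? ?] /andP[? ?] /andP[? ?].
  by apply/andP; split; lra.
split => //; apply/is_deriveP => r r0.
have r30 : 0 < r / 3 by rewrite divr_gt0.
have /continuousP_eps /(_ _ r30) [s [s0 Hs]] := cont.
exists (Num.min s (Num.min (x - p) (q - x))); move/andP: (xpq) => [px xq]; split.
  by rewrite !lt_min s0 !subr_gt0 px xq.
move=> y yx; rewrite !lt_min => /and3P[ys yp yq].
have ypq : p < y < q.
  by move: yp yq; rewrite !ltr_norml => /andP[? ?] /andP[? ?]; apply/andP; split; lra.
have yx0 : y - x != 0 by rewrite subr_eq0.
have cq : (diff_quotient (hn n) x y @[n --> \oo] --> diff_quotient h x y).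
  by apply: cvgMl; apply: cvgB; exact: hh.
suff Q : `|diff_quotient h x y - d x| <= r / 3 + r / 3.
  by apply: (le_lt_trans Q); lra.
have cn : (`|diff_quotient (hn n) x y - d x| @[n --> \oo] --> `|diff_quotient h x y - d x|).
  by apply: cvg_norm; apply: cvgB => //; exact: cvg_cst.
apply: (cvgr_to_le cn).
have /cvg_nearP /(_ _ r30) [N HN] := e0; exists N => // n /= /HN; rewrite subr0 => en.
have [c [cpq cs Ec]] : exists c, [/\ p < c < q, `|c - x| < s &
    diff_quotient (hn n) x y = dn n c].
  case: (ltgtP x y) => xy; last by rewrite xy eqxx in yx.
    have [|c [/andP[xc cy] E]] := @mean_value_derive _ (hn n) (dn n) x y xy.
      by move=> z zxy; apply: dh; exact: itv_oo_convex xpq ypq zxy.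
    exists c; split; first by apply: itv_oo_convex xpq ypq _; rewrite !ltW.
      by move: ys; rewrite !gtr0_norm ?subr_gt0 //; apply: lt_trans; rewrite ltrD2r.
    by rewrite /diff_quotient E mulfK.
  have [|c [/andP[xc cy] E]] := @mean_value_derive _ (hn n) (dn n) y x xy.
    by move=> z zxy; apply: dh; exact: itv_oo_convex ypq xpq zxy.
  exists c; split; first by apply: itv_oo_convex ypq xpq _; rewrite !ltW.
    by move: ys; rewrite !ltr0_norm ?subr_lt0 //; apply: lt_trans; rewrite ltrN2 ltrD2r.
  by rewrite /diff_quotient -opprB E -mulrN opprB mulfK.
rewrite Ec -(subrKA (d c)); apply: (le_trans (ler_normD _ _)).
by rewrite lerD ?ltW ?Hs // (le_lt_trans (le_trans (de n c cpq) (ler_norm _))).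
Qed.

Lemma antiderivative h (p q : R) : p < q ->
  (forall x : R, p <= x <= q -> {for x, continuous h}) ->
  exists psi : R -> R, forall x : R, p < x < q -> is_derive x 1 psi (h x).
Proof.
move=> pq ch.
exists (fun x => \int[lebesgue_measure]_(t in `[p, x]) h t)%R => x /andP[px xq].
have ih : (@lebesgue_measure R).-integrable `[p, q] (EFin \o h).
  apply: continuous_compact_integrable; first exact: segment_compact.
  by apply: continuous_withinT => z /=; rewrite in_itv /=; exact: ch.
have [|dF EF] := continuous_FTC1_closed xq ih px.
  by apply: ch; rewrite !ltW.
by rewrite derive1E in EF; exact: DeriveDef dF EF.
Qed.

Lemma continuous_segment_max h (p q : R) : p <= q ->
  (forall x : R, p <= x <= q -> {for x, continuous h}) ->
  exists c : R, p <= c <= q /\ forall x : R, p <= x <= q -> h x <= h c.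
Proof.
move=> pq ch.
have Hc : {within `[p, q], continuous h}.
  by apply: continuous_withinT => z /=; rewrite in_itv /=; exact: ch.
have [c] := EVT_max pq Hc; rewrite in_itv /= => cpq H.
by exists c; split => // x xpq; apply: H; rewrite in_itv.
Qed.

Lemma continuous_segment_min h (p q : R) : p <= q ->
  (forall x : R, p <= x <= q -> {for x, continuous h}) ->
  exists c : R, p <= c <= q /\ forall x : R, p <= x <= q -> h c <= h x.
Proof.
move=> pq ch.
have Hc : {within `[p, q], continuous h}.
  by apply: continuous_withinT => z /=; rewrite in_itv /=; exact: ch.
have [c] := EVT_min pq Hc; rewrite in_itv /= => cpq H.
by exists c; split => // x xpq; apply: H; rewrite in_itv.
Qed.

Lemma intermediate_value h (p q v : R) : p <= q ->
  (forall x : R, p <= x <= q -> {for x, continuous h}) ->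
  h p <= v <= h q -> exists c : R, p <= c <= q /\ h c = v.
Proof.
move=> pq ch /andP[pv vq].
have Hc : {within `[p, q], continuous h}.
  by apply: continuous_withinT => z /=; rewrite in_itv /=; exact: ch.
have [|c] := @IVT _ h p q v pq Hc; last by rewrite in_itv /= => ? ?; exists c.
by rewrite ge_min pv le_max vq orbT.
Qed.

End Calculus.

Lemma continuous_seq (R : realType) (f : R -> R) (u : nat -> R) (l : R) :
  {for l, continuous f} -> (u n @[n --> \oo] --> l) -> f (u n) @[n --> \oo] --> f l.
Proof.
move=> /continuousP_eps cf /cvg_nearP cu; apply/cvg_nearP => e /cf[d [d0 Hd]].
by have [N HN] := cu d d0; exists N => n /HN/Hd.
Qed.

Lemma cauchy_mean_value (R : realType) (f df g dg : R -> R) (a b : R) : a < b ->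
  (forall x : R, a <= x <= b -> is_derive x 1 f (df x)) ->
  (forall x : R, a <= x <= b -> is_derive x 1 g (dg x)) ->
  (forall x : R, a < x < b -> dg x != 0) ->
  exists c : R, a < c < b /\ df c / dg c = (f b - f a) / (g b - g a).
Proof.
move=> ab Hf Hg g0.
have sub (x : R) : x \in `]a, b[ -> a <= x <= b.
  by rewrite in_itv /= => /andP[/ltW -> /ltW ->].
have cf : {within `[a, b], continuous f}.
  by apply: continuous_withinT => x /=; rewrite in_itv /= => /Hf/derive_continuous.
have cg : {within `[a, b], continuous g}.
  by apply: continuous_withinT => x /=; rewrite in_itv /= => /Hg/derive_continuous.
have df' (x : R) : x \in `]a, b[ -> is_derive x 1 f (df x) by move=> /sub/Hf.
have dg' (x : R) : x \in `]a, b[ -> is_derive x 1 g (dg x) by move=> /sub/Hg.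
have g0' (x : R) : x \in `]a, b[ -> dg x != 0 by rewrite in_itv /=; exact: g0.
by have [c] := cauchy_MVT ab cf cg df' dg' g0'; rewrite in_itv /= => ? ?; exists c.
Qed.

(** Turns a time function [psi], a primitive of the inverse of a field, into an integral curve. *)
Lemma derivable_inverse (R : realType) (psi h : R -> R) (p q : R) :
  (forall x : R, p < x < q -> is_derive x 1 psi (h x)) ->
  (forall x : R, p < x < q -> 0 < h x) ->
  exists g : R -> R, forall x : R, p < x < q ->
    g (psi x) = x /\ is_derive (psi x) 1 g (h x)^-1.
Proof.
move=> dpsi h0.
have incr (x y : R) : p < x < q -> p < y < q -> x < y -> psi x < psi y.
  move=> xpq ypq xy.
  have sub z : x <= z <= y -> p < z < q by exact: itv_oo_convex.
  have sub' z : x < z < y -> p < z < q by move=> /andP[xz zy]; apply: sub; rewrite !ltW.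
  apply: (@gt0_derive_increasing _ psi h x y xy) => z.
  - by move=> /sub'; exact: dpsi.
  - by move=> /sub/dpsi; exact: derive_continuous.
  - by move=> /sub'; exact: h0.
have inj : {in `]p, q[%classic &, injective psi}.
  move=> x y; rewrite !inE /= !in_itv /= => xpq ypq e.
  case: (ltgtP x y) => // xy.
    by have := incr x y xpq ypq xy; rewrite e ltxx.
  by have := incr y x ypq xpq xy; rewrite e ltxx.
exists (pinv `]p, q[%classic psi) => x xpq.
have can z : p < z < q -> pinv `]p, q[%classic psi (psi z) = z.
  by move=> zpq; apply: pinvKV => //; rewrite inE /= in_itv.
have ne : \forall z \near x, p < z < q.
  by have := @near_in_itvoo R p q x; rewrite in_itv /= => /(_ xpq); apply: filterS => z; rewrite in_itv.
split; first exact: can.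
apply: is_derive_inverse (dpsi x xpq) _; last by rewrite gt_eqF // h0.
- by apply: filterS ne.
- by apply: filterS ne => z /dpsi/derive_continuous.
Qed.

Lemma is_derive_affine (R : realType) (c k x : R) : is_derive x 1 (fun t : R => c + k * t) k.
Proof.
apply/is_deriveP => e e0; exists 1; split => // y yx _.
have yx0 : y - x != 0 by rewrite subr_eq0.
rewrite /diff_quotient (_ : _ - (c + k * x) = k * (y - x)); last by ring.
by rewrite mulfK // subrr normr0.
Qed.

Lemma is_derive_mul (R : realType) (f g : R -> R) (x df dg : R) :
  is_derive x 1 f df -> is_derive x 1 g dg ->
  is_derive x 1 (fun t : R => f t * g t) (df * g x + f x * dg).
Proof.
move=> Df Dg; have := is_deriveM Df Dg.
by rewrite addrC [g x *: df]mulrC.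
Qed.

(** * The Szekeres field of a parabolic contraction *)

(* Only the values on [0, l] matter, but the maps are assumed continuous on the whole line: they
   will be obtained by clamping, which is why differentiability is assumed on ]0, l[ only. *)
Record parabolic_contraction (R : realType) (l K m : R) (G G1 G2 : R -> R) : Prop := {
  pc_l : 0 < l;
  pc_K : 0 <= K;
  pc_m : 0 < m;
  pc_range : forall x : R, 0 < x < l -> 0 < G x < x;
  pc_cont : forall x : R, {for x, continuous G};
  pc_cont1 : forall x : R, {for x, continuous G1};
  pc_cont2 : forall x : R, {for x, continuous G2};
  pc_derive : forall x : R, 0 < x < l -> is_derive x 1 G (G1 x);
  pc_derive1 : forall x : R, 0 < x < l -> is_derive x 1 G1 (G2 x);
  pc_fix : G 0 = 0;
  pc_parabolic : G1 0 = 1;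
  pc_lower1 : forall x : R, 0 < x < l -> m <= G1 x;
  pc_upper2 : forall x : R, 0 < x < l -> `|G2 x| <= K
}.

Arguments pc_cont {R l K m G G1 G2} _ x.
Arguments pc_cont1 {R l K m G G1 G2} _ x.
Arguments pc_cont2 {R l K m G G1 G2} _ x.

Section Szekeres.
Context {R : realType} {l K m : R} {G G1 G2 : R -> R}.
Hypothesis H : parabolic_contraction l K m G G1 G2.

Implicit Types x y z u v : R.

Local Notation C := (K / m).

Lemma pc_C_ge0 : 0 <= K / m.
Proof. by rewrite divr_ge0 ?(pc_K H) // ltW // (pc_m H). Qed.

Lemma pc_G1_gt0 x : 0 < x < l -> 0 < G1 x.
Proof. by move=> /(pc_lower1 H); apply: lt_le_trans; exact: pc_m H. Qed.

Lemma pc_iter_range n x : 0 < x < l -> 0 < iter n G x < l /\ iter n G x <= x.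
Proof.
move=> xl; elim: n => [|n [IH IH']]; first by rewrite /= lexx.
have /andP[gp gn] := pc_range H IH; have /andP[_ nl] := IH.
rewrite /= gp (lt_trans gn nl); split => //; exact: le_trans (ltW gn) IH'.
Qed.

Lemma pc_iter_in n x : 0 < x < l -> 0 < iter n G x < l.
Proof. by move=> /(pc_iter_range n)[]. Qed.

Definition displacement (g : R -> R) (x : R) : R := x - g x.

Local Notation D := (displacement G).

Lemma displacement_gt0 x : 0 < x < l -> 0 < D x.
Proof. by move=> /(pc_range H)/andP[_]; rewrite /displacement subr_gt0. Qed.

Lemma displacement_lt x : 0 < x < l -> D x < x.
Proof. by move=> /(pc_range H)/andP[? _]; rewrite /displacement; lra. Qed.

Lemma pc_increasing x y : 0 < x -> x < y -> y < l -> G x < G y.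
Proof.
move=> x0 xy yl.
apply: (@gt0_derive_increasing _ G G1 x y xy).
- move=> z /andP[xz zy]; apply: (pc_derive H).
  by rewrite (lt_trans x0 xz) (lt_trans zy yl).
- by move=> z _; exact: pc_cont H z.
- by move=> z /andP[xz zy]; apply: pc_G1_gt0; rewrite (lt_trans x0 xz) (lt_trans zy yl).
Qed.

Lemma pc_iter_increasing n x y : 0 < x -> x < y -> y < l -> iter n G x < iter n G y.
Proof.
move=> x0 xy yl; elim: n => [//|n IH] /=.
have xl : 0 < x < l by rewrite x0 (lt_trans xy yl).
have yl' : 0 < y < l by rewrite (lt_trans x0 xy) yl.
have /andP[? _] := pc_iter_in n xl; have /andP[_ ?] := pc_iter_in n yl'.
exact: pc_increasing.
Qed.

Lemma pc_iter_le n x y : 0 < x -> x <= y -> y < l -> iter n G x <= iter n G y.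
Proof.
by move=> x0; rewrite le_eqVlt => /predU1P[->//|xy yl]; rewrite ltW // pc_iter_increasing.
Qed.

Lemma pc_iter_nonincreasing n k x : 0 < x < l -> (n <= k)%N -> iter k G x <= iter n G x.
Proof.
move=> xl /subnK <-; rewrite iterD.
by have [] := pc_iter_range (k - n) (pc_iter_in n xl).
Qed.

(** The orbit decreases and its limit is a fixed point of [G] in [0, l[, where [G x < x] leaves only
    0. *)
Lemma pc_iter_cvg0 x : 0 < x < l -> iter n G x @[n --> \oo] --> 0.
Proof.
move=> xl.
have cv : cvgn (fun n => iter n G x).
  apply: nonincreasing_is_cvgn => [n k|]; first exact: pc_iter_nonincreasing.
  by exists 0 => _ [n _ <-]; have /andP[/ltW] := pc_iter_in n xl.
set p := limn (fun n => iter n G x) in cv.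
have p0 : 0 <= p.
  apply: limr_ge => //; apply: nearW => n.
  by have /andP[/ltW] := pc_iter_in n xl.
have pl : p < l.
  have /andP[_ xl'] := xl; apply: le_lt_trans xl'.
  apply: limr_le => //; apply: nearW => n.
  by have [] := pc_iter_range n xl.
have cS : (iter n.+1 G x @[n --> \oo] --> p).
  apply/cvg_nearP => e e0; have /cvg_nearP /(_ e e0)[N HN] := cv.
  by exists N => n Nn; exact: HN (leqW Nn).
have cG : (iter n.+1 G x @[n --> \oo] --> G p).
  exact: continuous_seq (pc_cont H p) cv.
have E : G p = p by exact: cvg_unique cG cS.
move: p0; rewrite le_eqVlt => /predU1P[p0|p0]; first by rewrite p0.
by have /andP[_] := pc_range H (introT andP (conj p0 pl)); rewrite E ltxx.
Qed.

(** The chain-rule product of (G^n)'. It depends on [G] and [G1] only, and serves later for the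
    expansion [F] and for [f] itself. *)
Definition iter_derivative (n : nat) (x : R) : R := \prod_(k < n) G1 (iter k G x).

Lemma iter_derivativeS n x :
  iter_derivative n.+1 x = iter_derivative n x * G1 (iter n G x).
Proof. by rewrite /iter_derivative big_ord_recr. Qed.

Lemma iter_derivative_gt0 n x : 0 < x < l -> 0 < iter_derivative n x.
Proof.
by move=> xl; rewrite /iter_derivative prodr_gt0 // => k _; exact/pc_G1_gt0/pc_iter_in.
Qed.

Lemma is_derive_iter n x : 0 < x < l -> is_derive x 1 (iter n G) (iter_derivative n x).
Proof.
move=> xl; elim: n => [|n IH].
  by rewrite /iter_derivative big_ord0; exact: is_derive_id.
rewrite iter_derivativeS mulrC.
have -> : iter n.+1 G = G \o iter n G by apply/funext.
by apply: is_derive1_comp; apply: (pc_derive H); exact: pc_iter_in.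
Qed.

Lemma continuous_iter n x : 0 < x < l -> {for x, continuous (iter n G)}.
Proof. by move=> /(is_derive_iter n)/derive_continuous. Qed.

Lemma is_derive_ln_G1 x : 0 < x < l -> is_derive x 1 (fun x => ln (G1 x)) (G2 x / G1 x).
Proof.
move=> xl; rewrite mulrC; apply: (@is_derive1_comp _ (@ln R) G1).
  exact/is_derive1_ln/pc_G1_gt0.
exact: (pc_derive1 H).
Qed.

Lemma pc_ratio_le x : 0 < x < l -> `|G2 x / G1 x| <= C.
Proof.
move=> xl; have g0 := pc_G1_gt0 xl; rewrite normrM normfV (gtr0_norm g0).
apply: ler_pM; [exact: normr_ge0|by rewrite invr_ge0 ltW|exact: (pc_upper2 H)|].
by rewrite lef_pV2 ?posrE ?(pc_m H) // (pc_lower1 H).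
Qed.

Lemma ln_G1_lipschitz u v : 0 < u -> u <= v -> v < l ->
  `|ln (G1 u) - ln (G1 v)| <= C * (v - u).
Proof.
move=> u0; rewrite le_eqVlt => /predU1P[->|uv vl]; first by rewrite !subrr normr0 mulr0.
have [|c [/andP[uc cv] E]] := @mean_value_derive _ (fun x => ln (G1 x)) (fun x => G2 x / G1 x) u v uv.
  by move=> z /andP[uz zv]; apply: is_derive_ln_G1; rewrite (lt_le_trans u0 uz) (le_lt_trans zv vl).
rewrite distrC E normrM (gtr0_norm (_ : 0 < v - u)) ?subr_gt0 //.
rewrite ler_wpM2r ?subr_ge0 ?(ltW uv) // pc_ratio_le //.
by rewrite (lt_trans u0 uc) (lt_trans cv vl).
Qed.

(* The logarithm of D(G^n x) / (G^n)'(x), the pullback of the field D by G^n. *)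
Definition log_approx (n : nat) (x : R) : R :=
  ln (displacement G (iter n G x)) - \sum_(k < n) ln (G1 (iter k G x)).

Local Notation lam := log_approx.

(** With y = G^n x, D (G y) = G1 z * D y for some z in ]G y, y[, so the step is ln (G1 z) - ln (G1
    y): at most C times the gap between consecutive points of the orbit, which telescopes. *)
Lemma log_approx_step n x : 0 < x < l ->
  `|lam n.+1 x - lam n x| <= C * iter n G x - C * iter n.+1 G x.
Proof.
move=> xl; rewrite /log_approx big_ord_recr /=.
set y := iter n G x; have yl : 0 < y < l by exact: pc_iter_in.
have /andP[gy0 gyy] := pc_range H yl; have /andP[y0 yl'] := yl.
have gyl : 0 < G y < l by rewrite gy0 (lt_trans gyy yl').
have [|z [/andP[z1 z2] E]] := @mean_value_derive _ G G1 (G y) y gyy.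
  by move=> z /andP[z1 z2]; apply: (pc_derive H); rewrite (lt_le_trans gy0 z1) (le_lt_trans z2 yl').
have zl : 0 < z < l by rewrite (lt_trans gy0 z1) (lt_trans z2 yl').
have E' : displacement G (G y) = G1 z * D y by rewrite /displacement E.
rewrite E' lnM ?posrE ?pc_G1_gt0 ?displacement_gt0 //.
rewrite (_ : _ - _ = ln (G1 z) - ln (G1 y)); last by rewrite -/y; ring.
rewrite -mulrBr; apply: (le_trans (ln_G1_lipschitz _ _ yl')).
- exact: lt_trans gy0 z1.
- exact: ltW.
- by rewrite ler_wpM2l ?pc_C_ge0 // lerD2l lerN2 ltW.
Qed.

(** The condition on x stands under the existential quantifier so that choice yields a total
    function. *)
Lemma log_field_ex x : exists a : R, 0 < x < l ->
  (lam n x @[n --> \oo] --> a) /\ forall n, `|a - lam n x| <= C * iter n G x.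
Proof.
have [xl|nxl] := boolP (0 < x < l); last by exists 0.
have [|n|a Ha] := @telescoping_cvg _ (lam^~ x) (fun n => C * iter n G x).
- by move=> n; exact: log_approx_step.
- by rewrite mulr_ge0 ?pc_C_ge0 //; have /andP[/ltW] := pc_iter_in n xl.
by exists a.
Qed.

Definition log_field x : R := projT1 (cid (log_field_ex x)).

Lemma log_field_cvg x : 0 < x < l -> lam n x @[n --> \oo] --> log_field x.
Proof. by move=> xl; rewrite /log_field; case: cid => a /= /(_ xl)[]. Qed.

Lemma log_field_dist n x : 0 < x < l -> `|log_field x - lam n x| <= C * iter n G x.
Proof. by move=> xl; rewrite /log_field; case: cid => a /= /(_ xl)[]. Qed.

Lemma log_field_ln x : 0 < x < l -> `|log_field x - ln (D x)| <= C * x.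
Proof.
move=> xl; have := log_field_dist 0 xl.
by rewrite /log_approx big_ord0 subr0.
Qed.

(** Starting at G x drops the factor of index 0 from the product:
    [lam n (G x) = lam n.+1 x + ln (G1 x)]. *)
Lemma log_field_shift x : 0 < x < l -> log_field (G x) = log_field x + ln (G1 x).
Proof.
move=> xl; have gl := pc_iter_in 1 xl.
have c1 : (lam n.+1 x + ln (G1 x) @[n --> \oo] --> log_field x + ln (G1 x)).
  apply: cvgD; last exact: cvg_cst.
  apply/cvg_nearP => e e0; have /cvg_nearP /(_ e e0)[N HN] := log_field_cvg xl.
  by exists N => n Nn; exact: HN (leqW Nn).
apply: cvg_unique (log_field_cvg gl) _ => //.
suff -> : (fun n => lam n (G x)) = (fun n => lam n.+1 x + ln (G1 x)) by [].
apply/funext => n; rewrite /log_approx big_ord_recl /= -iterSr /=.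
under [in RHS]eq_bigr => i _ do rewrite -iterS iterSr.
by rewrite opprD [- ln _ + _]addrC !addrA subrK.
Qed.

(** The value 0 is that of the field at the fixed point 0. *)
Definition szekeres x : R := if 0 < x < l then expR (log_field x) else 0.

Lemma szekeresE x : 0 < x < l -> szekeres x = expR (log_field x).
Proof. by rewrite /szekeres => ->. Qed.

Lemma szekeres_gt0 x : 0 < x < l -> 0 < szekeres x.
Proof. by move=> /szekeresE ->; rewrite expR_gt0. Qed.

Lemma szekeres_shift x : 0 < x < l -> szekeres (G x) = G1 x * szekeres x.
Proof.
move=> xl; rewrite !szekeresE ?(pc_iter_in 1) // log_field_shift // expRD mulrC.
by rewrite lnK // posrE pc_G1_gt0.
Qed.

Lemma szekeres_iter n x : 0 < x < l ->
  szekeres (iter n G x) = iter_derivative n x * szekeres x.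
Proof.
move=> xl; elim: n => [|n IH]; first by rewrite /iter_derivative big_ord0 mul1r.
by rewrite iterS szekeres_shift ?pc_iter_in // IH iter_derivativeS; ring.
Qed.

Lemma szekeres_le x : 0 < x < l -> szekeres x <= expR (C * x) * D x.
Proof.
move=> xl; rewrite szekeresE // -[X in _ * X](@lnK _ (D x)) ?posrE ?displacement_gt0 //.
rewrite -expRD ler_expR; have := log_field_ln xl; rewrite ler_norml => /andP[_].
by rewrite lerBlDr.
Qed.

Lemma szekeres_ge x : 0 < x < l -> expR (- (C * x)) * D x <= szekeres x.
Proof.
move=> xl; rewrite szekeresE // -[X in _ * X](@lnK _ (D x)) ?posrE ?displacement_gt0 //.
rewrite -expRD ler_expR; have := log_field_ln xl; rewrite ler_norml => /andP[+ _].
by rewrite lerBrDr.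
Qed.

(** * Continuous differentiability of the field *)

Definition iter_log_slope (n : nat) x : R :=
  \sum_(k < n) G2 (iter k G x) / G1 (iter k G x) * iter_derivative k x.

Lemma is_derive_sum_ln n x : 0 < x < l ->
  is_derive x 1 (fun z => \sum_(k < n) ln (G1 (iter k G z))) (iter_log_slope n x).
Proof.
move=> xl; elim: n => [|n IH].
  rewrite /iter_log_slope big_ord0.
  by under eq_fun do rewrite big_ord0; exact: is_derive_cst.
rewrite /iter_log_slope big_ord_recr /=.
under eq_fun do rewrite big_ord_recr /=.
apply: (is_deriveD IH).
apply: (@is_derive1_comp _ (fun z => ln (G1 z)) (iter n G)).
  exact/is_derive_ln_G1/pc_iter_in.
exact: is_derive_iter.
Qed.

Lemma expR_log_approx n x : 0 < x < l ->
  expR (lam n x) * iter_derivative n x = D (iter n G x).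
Proof.
move=> xl; have -> : iter_derivative n x = expR (\sum_(k < n) ln (G1 (iter k G x))).
  elim: n => [|n IH]; first by rewrite /iter_derivative !big_ord0 expR0.
  by rewrite iter_derivativeS IH big_ord_recr /= expRD lnK // posrE pc_G1_gt0 // pc_iter_in.
by rewrite -expRD subrK lnK // posrE displacement_gt0 // pc_iter_in.
Qed.

Local Notation E := (expR (C * l + C * l)).

Lemma pc_bound x : 0 < x < l -> C * x <= C * l.
Proof. by move=> /andP[_ /ltW]; apply: ler_wpM2l; exact: pc_C_ge0. Qed.

Lemma expR_log_approx_ge n x : 0 < x < l -> D x / E <= expR (lam n x).
Proof.
move=> xl; rewrite -[X in X / _](@lnK _ (D x)) ?posrE ?displacement_gt0 //.
rewrite -expRN -expRD ler_expR.
have := log_field_dist n xl; have := log_field_ln xl.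
have := pc_bound xl; have := pc_bound (pc_iter_in n xl).
by rewrite !ler_norml => ? ? /andP[? ?] /andP[? ?]; lra.
Qed.

(** Distortion bound. [log_approx n] and [log_approx 0] are both within C * l of [log_field], whence
    the exponent of [E]. The derivatives (G^n)'(x) are thus dominated by the displacements D (G^n
    x), whose sum telescopes. *)
Lemma iter_derivative_le n x : 0 < x < l ->
  iter_derivative n x <= E / D x * D (iter n G x).
Proof.
move=> xl; have d0 := displacement_gt0 xl.
rewrite -expR_log_approx // mulrA ler_peMl ?(ltW (iter_derivative_gt0 n xl)) //.
rewrite -(@ler_pM2l _ (D x / E)) ?divr_gt0 ?expR_gt0 // mulr1.
rewrite mulrA (_ : _ * (E / D x) = 1) ?mul1r ?expR_log_approx_ge //.
by field; rewrite !gt_eqF ?expR_gt0.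
Qed.

Lemma iter_log_slope_step n x : 0 < x < l ->
  `|iter_log_slope n.+1 x - iter_log_slope n x| <=
  C * E / D x * iter n G x - C * E / D x * iter n.+1 G x.
Proof.
move=> xl; rewrite /iter_log_slope big_ord_recr /= addrAC subrr add0r -mulrBr.
rewrite normrM (gtr0_norm (iter_derivative_gt0 n xl)).
apply: (@le_trans _ _ (C * (E / D x * D (iter n G x)))); last by rewrite !mulrA.
apply: ler_pM; [exact: normr_ge0|exact/ltW/iter_derivative_gt0| |exact: iter_derivative_le].
exact/pc_ratio_le/pc_iter_in.
Qed.

Lemma log_slope_ex x : exists a : R, 0 < x < l ->
  forall n, `|a - iter_log_slope n x| <= C * E / D x * iter n G x.
Proof.
have [xl|nxl] := boolP (0 < x < l); last by exists 0.
have [|n|a [_ Ha]] := @telescoping_cvg _ (iter_log_slope^~ x)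
    (fun n => C * E / D x * iter n G x).
- by move=> n; exact: iter_log_slope_step.
- have /andP[/ltW y0 _] := pc_iter_in n xl.
  have d0 := displacement_gt0 xl.
  by rewrite mulr_ge0 // divr_ge0 ?(ltW d0) // mulr_ge0 ?expR_ge0 // pc_C_ge0.
by exists a.
Qed.

(** The limit of the logarithmic derivatives of (G^n)'. Up to sign it will be the derivative of
    [log_field], since the other term of [log_approx], the logarithm of D (G^n x), has a derivative
    tending to 0. *)
Definition log_slope x : R := projT1 (cid (log_slope_ex x)).

Lemma log_slope_dist n x : 0 < x < l ->
  `|log_slope x - iter_log_slope n x| <= C * E / D x * iter n G x.
Proof. by move=> xl; rewrite /log_slope; case: cid => a /= /(_ xl). Qed.

Lemma one_sub_G1_le x : 0 < x < l -> `|1 - G1 x| <= K * x.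
Proof.
move=> /andP[x0 xl].
have [|z _|c [/andP[c0 cx] e]] := @mean_value _ G1 G2 0 x x0.
- by move=> z /andP[z0 zx]; apply: (pc_derive1 H); rewrite z0 (lt_trans zx xl).
- exact: pc_cont1 H z.
move: e; rewrite subr0 (pc_parabolic H) distrC => ->.
rewrite normrM (gtr0_norm x0) ler_wpM2r ?(ltW x0) // (pc_upper2 H) //.
by rewrite c0 (lt_trans cx xl).
Qed.

Definition log_approx_slope (n : nat) x : R :=
  (1 - G1 (iter n G x)) * iter_derivative n x / D (iter n G x) - iter_log_slope n x.

Lemma is_derive_displacement x : 0 < x < l -> is_derive x 1 D (1 - G1 x).
Proof.
by move=> xl; exact: (is_deriveB (is_derive_id x 1) (pc_derive H xl)).
Qed.

Lemma is_derive_log_approx n x : 0 < x < l -> is_derive x 1 (lam n) (log_approx_slope n x).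
Proof.
move=> xl; apply: is_deriveB; last exact: is_derive_sum_ln.
rewrite mulrC; apply: (@is_derive1_comp _ (@ln R) (fun z => D (iter n G z))).
  exact/is_derive1_ln/displacement_gt0/pc_iter_in.
apply: (@is_derive1_comp _ D (iter n G)); last exact: is_derive_iter.
exact/is_derive_displacement/pc_iter_in.
Qed.

Lemma continuous_iter_derivative n x : 0 < x < l -> {for x, continuous (iter_derivative n)}.
Proof.
move=> xl; elim: n => [|n IH].
  rewrite (_ : iter_derivative 0 = cst 1); first exact: cst_continuous.
  by apply/funext => z; rewrite /iter_derivative big_ord0.
rewrite (_ : iter_derivative n.+1 = fun z => iter_derivative n z * G1 (iter n G z)).
  apply: continuousM => //; apply: continuous_comp; first exact: continuous_iter.
  exact: (pc_cont1 H).
by apply/funext => z; rewrite iter_derivativeS.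
Qed.

Lemma continuous_G1_iter n x : 0 < x < l -> {for x, continuous (fun z => G1 (iter n G z))}.
Proof.
by move=> xl; apply: continuous_comp; [exact: continuous_iter|exact: (pc_cont1 H)].
Qed.

Lemma continuous_iter_log_slope n x : 0 < x < l -> {for x, continuous (iter_log_slope n)}.
Proof.
move=> xl; elim: n => [|n IH].
  rewrite (_ : iter_log_slope 0 = cst 0); first exact: cst_continuous.
  by apply/funext => z; rewrite /iter_log_slope big_ord0.
rewrite (_ : iter_log_slope n.+1 = fun z => iter_log_slope n z +
  G2 (iter n G z) * (G1 (iter n G z))^-1 * iter_derivative n z).
  apply: continuousD => //; apply: continuousM; last exact: continuous_iter_derivative.
  apply: continuousM.
    by apply: continuous_comp; [exact: continuous_iter|exact: (pc_cont2 H)].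
  apply: continuousV; last exact: continuous_G1_iter.
  by rewrite gt_eqF // pc_G1_gt0 // pc_iter_in.
by apply/funext => z; rewrite /iter_log_slope big_ord_recr.
Qed.

Lemma continuous_log_approx_slope n x : 0 < x < l ->
  {for x, continuous (log_approx_slope n)}.
Proof.
move=> xl; apply: continuousB; last exact: continuous_iter_log_slope.
apply: continuousM.
  apply: continuousM; last exact: continuous_iter_derivative.
  by apply: continuousB; [exact: cst_continuous|exact: continuous_G1_iter].
apply: continuousV; first by rewrite gt_eqF // displacement_gt0 // pc_iter_in.
apply: (@derive_continuous _ (fun z => D (iter n G z))).
apply: (@is_derive1_comp _ D (iter n G)); last exact: is_derive_iter.
exact/is_derive_displacement/pc_iter_in.
Qed.

(** The distortion bound cancels the division by D (G^n x) and leaves |1 - G1 (G^n x)| <= K * G^n x,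
    which tends to 0. *)
Lemma log_approx_slope_dist n x : 0 < x < l ->
  `|log_approx_slope n x - - log_slope x| <= (K + C) * E / D x * iter n G x.
Proof.
move=> xl; have yl := pc_iter_in n xl; have d0 := displacement_gt0 xl.
have dy := displacement_gt0 yl; have /andP[y0 _] := yl.
rewrite opprK /log_approx_slope -addrA; apply: (le_trans (ler_normD _ _)).
have -> : (K + C) * E / D x * iter n G x =
  K * iter n G x * (E / D x) + C * E / D x * iter n G x by ring.
apply: lerD; last by rewrite addrC; exact: log_slope_dist.
rewrite -mulrA normrM.
apply: ler_pM; rewrite ?normr_ge0 ?one_sub_G1_le //.
rewrite gtr0_norm ?divr_gt0 ?iter_derivative_gt0 // ler_pdivrMr //.
exact: iter_derivative_le.
Qed.

(** The error carries 1 / D z, unbounded near 0. On a segment [p, q] around x it is at most 1 / D c,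
    with c a minimum of D, and G^n z is at most G^n q: the convergence of the slopes is uniform
    there. *)
Lemma is_derive_log_field x : 0 < x < l ->
  is_derive x 1 log_field (- log_slope x) /\ {for x, continuous (fun z => - log_slope z)}.
Proof.
move=> /andP[x0 xl].
have p0 : 0 < x / 2 by rewrite divr_gt0.
have px : x / 2 < x by rewrite ltr_pdivrMr // ltr_pMr // ltr1n.
have xq : x < (x + l) / 2 by rewrite midf_lt.
have ql : (x + l) / 2 < l by rewrite midf_lt.
set p := x / 2 in p0 px; set q := (x + l) / 2 in xq ql.
have pq z : p < z < q -> 0 < z < l.
  by move=> /andP[pz zq]; rewrite (lt_trans p0 pz) (lt_trans zq ql).
have pq' z : p <= z <= q -> 0 < z < l.
  by move=> /andP[pz zq]; rewrite (lt_le_trans p0 pz) (le_lt_trans zq ql).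
have [|c [cpq Hc]] := @continuous_segment_min _ D p q (ltW (lt_trans px xq)).
  by move=> z /pq'/is_derive_displacement/derive_continuous.
have dc := displacement_gt0 (pq' _ cpq).
have ql' : 0 < q < l by rewrite ql (lt_trans x0 xq).
apply: (@is_derive_limit _ lam log_approx_slope _ _
  (fun n => (K + C) * E / D c * iter n G q) p q); last by rewrite px xq.
- by move=> n z /pq; exact: is_derive_log_approx.
- by move=> n z /pq; exact: continuous_log_approx_slope.
- move=> n z zpq; have zl := pq z zpq; apply: (le_trans (log_approx_slope_dist n zl)).
  have KC : 0 <= (K + C) * E by rewrite mulr_ge0 ?expR_ge0 // addr_ge0 ?(pc_K H) ?pc_C_ge0.
  have /andP[pz zq] := zpq; have /andP[/ltW y0 _] := pc_iter_in n zl.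
  apply: ler_pM => //; first exact: (divr_ge0 KC (ltW (displacement_gt0 zl))).
    rewrite ler_wpM2l // lef_pV2 ?posrE ?(displacement_gt0 zl) //.
    by rewrite Hc // (ltW pz) (ltW zq).
  by rewrite pc_iter_le ?(ltW zq) //; case/andP: zl.
- rewrite -[X in _ --> X](mulr0 ((K + C) * E / D c)); apply: cvgMr.
  exact: pc_iter_cvg0.
- by move=> z /pq; exact: log_field_cvg.
Qed.

Definition szekeres_slope x : R := szekeres x * - log_slope x.

Lemma is_derive_szekeres x : 0 < x < l -> is_derive x 1 szekeres (szekeres_slope x).
Proof.
move=> xl; have /andP[x0 xl'] := xl.
apply: (@eq_is_derive _ (expR \o log_field) _ _ _ (Num.min x (l - x))).
- by rewrite lt_min x0 subr_gt0.
- move=> y; rewrite lt_min !ltr_norml => /andP[/andP[? ?] /andP[? ?]].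
  by rewrite szekeresE //; apply/andP; split; lra.
- rewrite /szekeres_slope szekeresE //; apply: is_derive1_comp.
  by have [] := is_derive_log_field xl.
Qed.

Lemma continuous_szekeres_slope x : 0 < x < l -> {for x, continuous szekeres_slope}.
Proof.
move=> xl; apply: continuousM; first exact: derive_continuous (is_derive_szekeres xl).
by have [] := is_derive_log_field xl.
Qed.

(** The factor 1 / D x in the bound on [log_slope] is cancelled by X <= exp(C * l) D, so the slope
    tends to 0 at the fixed point and the field is C^1 up to it. *)
Lemma szekeres_slope_le : exists B : R, 0 <= B /\
  forall x, 0 < x < l -> `|szekeres_slope x| <= B * x.
Proof.
exists (expR (C * l) * (C * E)); split; first by rewrite mulr_ge0 ?expR_ge0 // mulr_ge0 ?expR_ge0 // pc_C_ge0.
move=> x xl; have d0 := displacement_gt0 xl.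
rewrite /szekeres_slope normrM (gtr0_norm (szekeres_gt0 xl)) normrN.
have := log_slope_dist 0 xl; rewrite /iter_log_slope big_ord0 subr0 /= => s.
have e : szekeres x <= expR (C * l) * D x.
  by apply: (le_trans (szekeres_le xl)); rewrite ler_wpM2r ?(ltW d0) // ler_expR pc_bound.
apply: (le_trans (ler_pM (ltW (szekeres_gt0 xl)) (normr_ge0 _) e s)).
rewrite [leLHS](_ : _ = expR (C * l) * (C * E) * x) //.
by field; rewrite !gt_eqF ?(pc_m H).
Qed.

End Szekeres.

Arguments iter_derivative {R} G G1 n x.

(** * Its flow at time one *)

(** Both directions are kept: the field is built from the contraction [G], while the iterates whose
    derivatives grow are those of [F]. [pm_end] makes the displacement vanish at [l], so that the
    field tends to 0 there. *)
Record parabolic_model (R : realType) (l K m : R) (F F1 F2 G G1 G2 : R -> R) : Prop := {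
  pm_contraction : parabolic_contraction l K m G G1 G2;
  pm_range : forall x : R, 0 < x < l -> 0 < F x < l;
  pm_GK : forall x : R, 0 < x < l -> G (F x) = x;
  pm_FK : forall x : R, 0 < x < l -> F (G x) = x;
  pm_cont : forall x : R, {for x, continuous F};
  pm_cont1 : forall x : R, {for x, continuous F1};
  pm_cont2 : forall x : R, {for x, continuous F2};
  pm_derive : forall x : R, 0 < x < l -> is_derive x 1 F (F1 x);
  pm_derive1 : forall x : R, 0 < x < l -> is_derive x 1 F1 (F2 x);
  pm_fix : F 0 = 0;
  pm_parabolic : F1 0 = 1;
  pm_end : G l = l;
  pm_upper2 : forall x : R, 0 < x < l -> `|F2 x| <= K
}.

Arguments pm_cont {R l K m F F1 F2 G G1 G2} _ x.
Arguments pm_cont1 {R l K m F F1 F2 G G1 G2} _ x.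
Arguments pm_cont2 {R l K m F F1 F2 G G1 G2} _ x.

Section Flow.
Context {R : realType} {l K m : R} {F F1 F2 G G1 G2 : R -> R}.
Hypothesis M : parabolic_model l K m F F1 F2 G G1 G2.
Implicit Types x y z u v w : R.

Local Notation H := (pm_contraction M).
Local Notation X := (szekeres H).

Lemma pm_gt x : 0 < x < l -> x < F x.
Proof.
by move=> xl; have /(pc_range H)/andP[_] := pm_range M xl; rewrite (pm_GK M).
Qed.

Lemma pm_chain x : 0 < x < l -> G1 (F x) * F1 x = 1.
Proof.
move=> xl; have /andP[x0 xl'] := xl.
have d1 : is_derive x 1 (G \o F) (G1 (F x) * F1 x).
  by apply: is_derive1_comp; [apply: (pc_derive H); exact: (pm_range M)|exact: (pm_derive M)].
apply: is_derive_unique d1 _.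
apply: (@eq_is_derive _ id _ _ _ (Num.min x (l - x))).
  by rewrite lt_min x0 subr_gt0.
move=> y; rewrite lt_min !ltr_norml => /andP[/andP[? ?] /andP[? ?]] /=.
by rewrite (pm_GK M) //; apply/andP; split; lra.
Qed.

Lemma pm_F1_gt0 x : 0 < x < l -> 0 < F1 x.
Proof.
move=> xl; have := pc_G1_gt0 H (pm_range M xl).
by move=> g0; rewrite -(pmulr_rgt0 _ g0) pm_chain.
Qed.

Lemma szekeres_expand x : 0 < x < l -> X (F x) = F1 x * X x.
Proof.
move=> xl; have fl := pm_range M xl.
have := szekeres_shift H fl; rewrite (pm_GK M) // => ->.
by rewrite mulrA [F1 x * _]mulrC pm_chain // mul1r.
Qed.

(** On the fundamental domain [G w, w] the displacement is constant up to a relative error K * w: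
    its slope is at most K * w, and the domain has length D w. *)
Lemma displacement_mean_value w u : 0 < w < l -> G w <= u <= w ->
  `|displacement G u - displacement G w| <= K * w * displacement G w.
Proof.
move=> wl /andP[gu]; have /andP[w0 wl'] := wl; have /andP[g0 gw] := pc_range H wl.
have dw := displacement_gt0 H wl.
rewrite le_eqVlt => /predU1P[->|uw].
  by rewrite subrr normr0 mulr_ge0 ?(ltW dw) // mulr_ge0 ?(ltW w0) // (pc_K H).
have u0 : 0 < u by exact: lt_le_trans g0 gu.
have [|c [/andP[uc cw] e]] := @mean_value_derive _ (displacement G) (fun x => 1 - G1 x) u w uw.
  move=> z /andP[uz zw]; apply: (is_derive_displacement H).
  by rewrite (lt_le_trans u0 uz) (le_lt_trans zw wl').
have cl : 0 < c < l by rewrite (lt_trans u0 uc) (lt_trans cw wl').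
rewrite distrC e normrM; apply: ler_pM; rewrite ?normr_ge0 //.
  by apply: (le_trans (one_sub_G1_le H cl)); rewrite ler_wpM2l ?(pc_K H) // ltW.
by rewrite gtr0_norm ?subr_gt0 // /displacement lerD2l lerN2.
Qed.

(* Cauchy's mean value theorem for psi against G^n gives T X(u) = D(G^n (F x)) with u between
   G^(n+1) (F x) and G^n (F x), and X ~ D near 0. *)
Lemma szekeres_time x (psi : R -> R) : 0 < x < l ->
  (forall u, x <= u <= F x -> is_derive u 1 psi (X u)^-1) ->
  psi (F x) - psi x = 1.
Proof.
move=> xl dpsi; have xF := pm_gt xl; have fl := pm_range M xl.
have seg u : x <= u <= F x -> 0 < u < l.
  move/andP: xl fl => [x0 _] /andP[_ fl] /andP[xu uf].
  by rewrite (lt_le_trans x0 xu) (le_lt_trans uf fl).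
set T := psi (F x) - psi x; pose w n := iter n G (F x).
have key n : exists u, G (w n) <= u <= w n /\ T * X u = displacement G (w n).
  have dI z : x <= z <= F x -> is_derive z 1 (iter n G) (iter_derivative G G1 n z).
    by move=> xz; exact/(is_derive_iter H)/seg.
  have I0 z : x < z < F x -> iter_derivative G G1 n z != 0.
    move=> /andP[xz zF]; rewrite gt_eqF // (iter_derivative_gt0 H) //.
    by apply: seg; rewrite !ltW.
  have [c [/andP[xc cF] e]] := cauchy_mean_value xF dpsi dI I0.
  have cl : 0 < c < l by apply: seg; rewrite !ltW.
  have Gw : G (w n) = iter n G x by rewrite -iterS iterSr (pm_GK M).
  exists (iter n G c); split.
    rewrite Gw /w; have /andP[x0 _] := xl; have /andP[_ Fl] := fl; have /andP[c0 cl'] := cl.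
    by rewrite !(pc_iter_le H) ?ltW.
  rewrite szekeres_iter // /displacement Gw.
  have X0 := szekeres_gt0 H cl; have DG0 := iter_derivative_gt0 H n cl.
  have /andP[x0 _] := xl; have /andP[_ Fl] := fl.
  have d0 : 0 < iter n G (F x) - iter n G x by rewrite subr_gt0 (pc_iter_increasing H).
  move: e; rewrite -/T => /(congr1 (fun a => a * (iter n G (F x) - iter n G x))).
  rewrite divfK ?gt_eqF // => <-.
  by rewrite /w; field; rewrite !gt_eqF.
have w0 : (w n @[n --> \oo] --> 0) by exact: (pc_iter_cvg0 H fl).
pose C := K / m.
have T0 : 0 < T.
  have [u [/andP[gu uw] e]] := key 0%N.
  have ul : 0 < u < l.
    by apply: seg; move: gu uw; rewrite /w /= (pm_GK M) // => -> ->.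
  by rewrite -(pmulr_lgt0 _ (szekeres_gt0 H ul)) e (displacement_gt0 H).
(* Two errors separate X u from D (w n): a factor exp(C * w n) or its inverse from X to D, and a
   factor within K * w n of 1 from u to w n. Both tend to 1. *)
have bnd n : expR (- (C * w n)) * (1 - K * w n) <= T^-1 <= expR (C * w n) * (1 + K * w n).
  have wl : 0 < w n < l by exact: (pc_iter_in H).
  have [u [gu e]] := key n; have dw := displacement_gt0 H wl.
  have /andP[g0 _] := pc_range H wl.
  have ul : 0 < u < l.
    by move/andP: gu wl => [gu uw] /andP[_ wl]; rewrite (lt_le_trans g0 gu) (le_lt_trans uw wl).
  have -> : T^-1 = X u / displacement G (w n).
    by rewrite -e; field; rewrite !gt_eqF // szekeres_gt0.
  have := displacement_mean_value wl gu; rewrite ler_norml => /andP[lo hi].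
  have Cw : C * u <= C * w n by apply: ler_wpM2l; [exact: pc_C_ge0 H|case/andP: gu].
  have du := displacement_gt0 H ul.
  rewrite ler_pdivlMr // ler_pdivrMr //; apply/andP; split.
    rewrite -mulrA; apply: le_trans (szekeres_ge H ul).
    apply: (@le_trans _ _ (expR (- (C * w n)) * displacement G u)).
      by rewrite ler_wpM2l ?expR_ge0 //; move: lo; lra.
    by rewrite ler_wpM2r ?(ltW du) // ler_expR lerN2.
  rewrite -mulrA; apply: (le_trans (szekeres_le H ul)).
  apply: (@le_trans _ _ (expR (C * w n) * displacement G u)).
    by rewrite ler_wpM2r ?(ltW du) // ler_expR.
  by rewrite ler_wpM2l ?expR_ge0 //; move: hi; lra.
have cKw : (K * w n @[n --> \oo] --> K * 0) by exact: cvgMr.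
have cCw : (C * w n @[n --> \oo] --> C * 0) by exact: cvgMr.
have cE : (expR (C * w n) @[n --> \oo] --> (1 : R)).
  by rewrite -expR0 -[X in expR X](mulr0 C); exact: continuous_seq (@continuous_expR _ _) cCw.
have cE' : (expR (- (C * w n)) @[n --> \oo] --> (1 : R)).
  rewrite -expR0 -[X in expR X]oppr0 -[X in expR (- X)](mulr0 C).
  by apply: continuous_seq (@continuous_expR _ _) _; exact: cvgN.
have lim1 : (expR (C * w n) * (1 + K * w n) @[n --> \oo] --> (1 : R)).
  rewrite -[X in _ --> X]mulr1; apply: cvgM => //.
  by rewrite -[X in _ --> X]addr0 -[X in 1 + X](mulr0 K); apply: cvgD => //; exact: cvg_cst.
have lim2 : (expR (- (C * w n)) * (1 - K * w n) @[n --> \oo] --> (1 : R)).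
  rewrite -[X in _ --> X]mulr1; apply: cvgM => //.
  by rewrite -[X in _ --> X]subr0 -[X in 1 - X](mulr0 K); apply: cvgB => //; exact: cvg_cst.
have T1 : T^-1 = 1.
  apply/le_anti/andP; split.
    by apply: (cvgr_to_ge lim1); apply: nearW => n; case/andP: (bnd n).
  by apply: (cvgr_to_le lim2); apply: nearW => n; case/andP: (bnd n).
by rewrite -[T]invrK T1 invr1.
Qed.

End Flow.

Section FlowExistence.
Context {R : realType} {l K m : R} {F F1 F2 G G1 G2 : R -> R}.
Hypothesis M : parabolic_model l K m F F1 F2 G G1 G2.
Implicit Types x y z u v w : R.

Local Notation H := (pm_contraction M).
Local Notation X := (szekeres H).

Lemma pm_increasing x y : 0 < x < l -> 0 < y < l -> x < y -> F x < F y.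
Proof.
move=> xl yl xy; rewrite ltNge; apply/negP => FF.
have fx := pm_range M xl; have fy := pm_range M yl.
have : G (F y) <= G (F x).
  move: FF; rewrite le_eqVlt => /predU1P[->//|FF].
  by apply/ltW/(pc_increasing H) => //; [case/andP: fy|case/andP: fx].
by rewrite !(pm_GK M) // leNgt xy.
Qed.

Lemma szekeres_inv_antiderivative p q : 0 < p -> p < q -> q < l ->
  exists psi : R -> R, forall u, p < u < q -> is_derive u 1 psi (X u)^-1.
Proof.
move=> p0 pq ql; apply: antiderivative => // u /andP[pu uq].
have ul : 0 < u < l by rewrite (lt_le_trans p0 pu) (le_lt_trans uq ql).
apply: continuousV; first by rewrite gt_eqF // szekeres_gt0.
exact: derive_continuous (is_derive_szekeres H ul).
Qed.

(** Separation of variables: with [psi] a primitive of 1 / X, the curve sends t to the inverse image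
    of psi x + t, and [szekeres_time] makes it reach F x at time 1. Taking [psi] on ]G x, F (F x)[
    puts x and F x in the interior, so the derivative is two-sided even at times 0 and 1. *)
Lemma szekeres_flow x : 0 < x < l -> exists gamma : R -> R,
  [/\ gamma 0 = x, gamma 1 = F x & forall t : R, 0 <= t <= 1 ->
    0 < gamma t < l /\ is_derive t 1 gamma (X (gamma t))].
Proof.
move=> xl; have fl := pm_range M xl; have ffl := pm_range M fl.
have gl := pc_iter_in H 1 xl; have /andP[gx0 gx] := pc_range H xl.
have xF := pm_gt M xl; have FF := pm_gt M fl.
have /andP[_ ffl'] := ffl; have /andP[x0 _] := xl; have /andP[_ fl'] := fl.
have gF := lt_trans gx (lt_trans xF FF).
have [psi dpsi] := szekeres_inv_antiderivative gx0 gF ffl'.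
have pos u : G x < u < F (F x) -> 0 < (X u)^-1.
  move=> /andP[gu uf]; rewrite invr_gt0; apply: szekeres_gt0.
  by rewrite (lt_trans gx0 gu) (lt_trans uf ffl').
have [g Hg] := derivable_inverse dpsi pos.
have sub u : x <= u <= F x -> G x < u < F (F x).
  by move=> /andP[xu uf]; rewrite (lt_le_trans gx xu) (le_lt_trans uf FF).
have xx : x <= x <= F x by rewrite lexx ltW.
have xFx : x <= F x <= F x by rewrite lexx ltW.
have time : psi (F x) - psi x = 1.
  by apply: (szekeres_time (M := M) xl) => u /sub; exact: dpsi.
exists (fun t => g (psi x + t)); split.
- by rewrite addr0; case: (Hg x (sub _ xx)).
- by rewrite -time addrC subrK; case: (Hg _ (sub _ xFx)).
move=> t /andP[t0 t1].
have [||u [xu e]] := @intermediate_value _ psi x (F x) (psi x + t) (ltW xF).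
- by move=> z /sub/dpsi; exact: derive_continuous.
- by rewrite lerDl t0 /= -(subrK (psi x) (psi (F x))) time addrC lerD2r.
have [gu dg] := Hg _ (sub _ xu).
rewrite -e gu; split.
  by move/andP: xu => [xu uf]; rewrite (lt_le_trans x0 xu) (le_lt_trans uf fl').
rewrite -[X u]invrK -[_^-1]mulr1; apply: (@is_derive1_comp _ g (fun t => psi x + t)).
  by rewrite -e.
by rewrite -[X in is_derive _ _ _ X]add0r; apply: is_deriveD.
Qed.

End FlowExistence.

(** * Uniqueness of the field *)

Section Uniqueness.
Context {R : realType} {l K m : R} {F F1 F2 G G1 G2 : R -> R}.
Hypothesis M : parabolic_model l K m F F1 F2 G G1 G2.
Implicit Types x y z u v w p d t : R.

Local Notation H := (pm_contraction M).

(** A competing field read on [0, l[. It will be continued by a constant to negative numbers, whence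
    the continuity at all v < l; nothing is assumed at [l]. *)
Variables Y Y1 : R -> R.
Hypothesis cY : forall v, v < l -> {for v, continuous Y}.
Hypothesis cY1 : forall v, v < l -> {for v, continuous Y1}.
Hypothesis dY : forall v, 0 < v < l -> is_derive v 1 Y (Y1 v).
Hypothesis timeY : forall x, 0 <= x < l -> exists gamma : R -> R,
  [/\ gamma 0 = x, gamma 1 = F x, forall t : R, {for t, continuous gamma},
      forall t : R, 0 <= t <= 1 -> 0 <= gamma t < l &
      forall t : R, 0 < t < 1 -> is_derive t 1 gamma (Y (gamma t))].

Lemma field_lipschitz d : 0 < d < l -> exists L : R, 0 < L /\
  forall u v, 0 <= u <= d -> 0 <= v <= d -> `|Y u - Y v| <= L * `|u - v|.
Proof.
move=> /andP[d0 dl].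
have [|c [cd Hc]] := @continuous_segment_max _ (fun v => `|Y1 v|) 0 d (ltW d0).
  move=> z /andP[_ zd]; apply: continuous_comp; last exact: norm_continuous.
  exact/cY1/(le_lt_trans zd dl).
exists (`|Y1 c| + 1); split; first by rewrite ltr_wpDl.
suff W u v : 0 <= u <= d -> 0 <= v <= d -> u < v -> `|Y v - Y u| <= (`|Y1 c| + 1) * `|v - u|.
  move=> u v ud vd; case: (ltgtP u v) => uv; last by rewrite uv !subrr !normr0 mulr0.
    by rewrite distrC [X in _ * X]distrC; exact: W.
  exact: W.
move=> /andP[u0 ud] /andP[v0 vd] uv.
have [z /andP[uz zv]|z /andP[_ zv]|z [/andP[uz zv] ->]] := @mean_value _ Y Y1 u v uv.
- by apply: dY; rewrite (le_lt_trans u0 uz) (lt_trans zv (le_lt_trans vd dl)).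
- exact/cY/(le_lt_trans zv (le_lt_trans vd dl)).
rewrite normrM ler_wpM2r // ler_wpDr // Hc //.
by rewrite (le_trans u0 (ltW uz)) (le_trans (ltW zv) vd).
Qed.

(* Gronwall: a zero of a Lipschitz field is a stationary point of its flow. *)
Lemma field_neq0 p : 0 < p < l -> Y p != 0.
Proof.
move=> pl; apply/negP => /eqP Yp; have /andP[p0 pl'] := pl.
have [|gamma [g0 g1 cg rg dg]] := timeY (x := p); first by rewrite ltW.
have [|c [c01 Hc]] := @continuous_segment_max _ gamma 0 1 ler01.
  by move=> z _; exact: cg.
have pd : p <= gamma c by rewrite -g0; apply: Hc; rewrite lexx ler01.
have dl : 0 < gamma c < l.
  by rewrite (lt_le_trans p0 pd) /=; case/andP: (rg _ c01).
have [L [L0 HL]] := field_lipschitz dl.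
(* [L] is a Lipschitz constant on [0, gamma c], which contains p and the whole orbit, so [phi] does
   not increase. As phi 0 = 0, this would give F p = gamma 1 = p. *)
pose phi t := expR (- (2 * L * t)) * (gamma t - p) ^+ 2.
pose dphi t := expR (- (2 * L * t)) *
  (2 * (gamma t - p) * Y (gamma t) - 2 * L * (gamma t - p) ^+ 2).
have dlin (t : R) : is_derive t 1 (fun t => - (2 * L * t)) (- (2 * L)).
  rewrite (_ : (fun t => _) = (fun t => 0 + - (2 * L) * t)).
    exact: is_derive_affine.
  by apply/funext => s; rewrite add0r mulNr.
have dphiP (t : R) : 0 < t < 1 -> is_derive t 1 phi (dphi t).
  move=> t01; have dgt := dg t t01; have d1 := dlin t.
  have d2 := @is_derive1_comp _ expR _ t _ _ (is_derive_expR _) d1.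
  have d3 : is_derive t 1 (fun t => gamma t - p) (Y (gamma t)).
    by rewrite -[X in is_derive _ _ _ X]subr0; apply: is_deriveB.
  have d4 := is_derive_mul d2 (is_derive_mul d3 d3).
  rewrite (_ : dphi t = expR (- (2 * L * t)) * - (2 * L) * ((gamma t - p) * (gamma t - p)) +
    expR (- (2 * L * t)) * (Y (gamma t) * (gamma t - p) + (gamma t - p) * Y (gamma t))) //.
  by rewrite /dphi; ring.
have phi1 : phi 1 <= phi 0.
  rewrite -lerN2; apply: (@ge0_derive_nondecreasing _ (fun t => - phi t) (fun t => - dphi t) 0 1 ler01).
  - by move=> t t01; apply: is_deriveN; exact: dphiP.
  - move=> t _; apply: continuousN; apply: continuousM.
      apply: continuous_comp; last exact: continuous_expR.
      exact: derive_continuous (dlin t).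
    have cB : {for t, continuous (fun s => gamma s - p)}.
      by apply: continuousB; [exact: cg|exact: cst_continuous].
    exact: (continuousM cB cB).
  - move=> t t01; rewrite oppr_ge0 /dphi pmulr_rle0 ?expR_gt0 // subr_le0.
    have t01' : 0 <= t <= 1 by case/andP: t01 => /ltW -> /ltW ->.
    have Hb : `|Y (gamma t)| <= L * `|gamma t - p|.
      rewrite -[Y (gamma t)]subr0 -Yp; apply: HL.
        by rewrite (Hc t t01'); case/andP: (rg t t01') => ->.
      by rewrite (ltW p0) pd.
    rewrite -!mulrA ler_pM2l //; apply: (le_trans (ler_norm _)).
    rewrite normrM -[_ ^+ 2]real_normK ?num_real // expr2 mulrCA.
    by rewrite ler_wpM2l.
move: phi1; rewrite /phi g0 g1 subrr expr0n /= mulr0 pmulr_rle0 ?expR_gt0 //.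
by rewrite leNgt exprn_gt0 // subr_gt0 (pm_gt M pl).
Qed.

Lemma field_ge0 : (forall x, 0 < x < l -> 0 < Y x) -> 0 <= Y 0.
Proof.
move=> pos; have l0 := pc_l H; rewrite leNgt; apply/negP => Y0.
have /continuousP_eps /(_ (- Y 0)) [|d [d0 Hd]] := cY l0; first by rewrite oppr_gt0.
pose s := Num.min d l / 2; have s0 : 0 < s by rewrite divr_gt0 // lt_min d0.
have sl : s < Num.min d l by rewrite ltr_pdivrMr // ltr_pMr ?ltr1n // lt_min d0.
move: sl; rewrite lt_min => /andP[sd sl].
have := Hd s; rewrite subr0 gtr0_norm // => /(_ sd).
rewrite ltr_norml ltrBlDr addNr => /andP[_ Ys].
by have := pos s; rewrite s0 sl => /(_ isT); rewrite ltNge (ltW Ys).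
Qed.

(** Without zeros in ]0, l[ the sign is constant, so one positive value suffices; the orbit from l /
    2 to F (l / 2) > l / 2 provides it by the mean value theorem. *)
Lemma field_gt0 x : 0 < x < l -> 0 < Y x.
Proof.
have l0 := pc_l H.
have [p pl Yp] : exists2 p, 0 < p < l & 0 < Y p.
  have hl : 0 < l / 2 < l by rewrite divr_gt0 //= ltr_pdivrMr // ltr_pMr ?ltr1n.
  have [|gamma [g0 g1 cg rg dg]] := timeY (x := l / 2).
    by case/andP: hl => /ltW -> ->.
  have [|c [c01]] := mean_value ltr01 dg; first by move=> t _; exact: cg.
  rewrite subr0 mulr1 g0 g1 => e.
  have Yc : 0 < Y (gamma c) by rewrite -e subr_gt0 (pm_gt M hl).
  have [|] := andP (rg c _); first by case/andP: c01 => /ltW -> /ltW ->.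
  rewrite le_eqVlt => /predU1P[gc0|gc0] gcl; last by exists (gamma c) => //; rewrite gc0.
  (* The positive value may be found at 0; continuity then moves it inside ]0, l[. *)
  move: Yc; rewrite -gc0 => Y0.
  have /continuousP_eps /(_ _ Y0) [d [d0 Hd]] := cY l0.
  pose s := Num.min d l / 2; have s0 : 0 < s by rewrite divr_gt0 // lt_min d0.
  have sl : s < Num.min d l by rewrite ltr_pdivrMr // ltr_pMr ?ltr1n // lt_min d0.
  move: sl; rewrite lt_min => /andP[sd sl].
  have := Hd s; rewrite subr0 gtr0_norm // => /(_ sd).
  rewrite ltr_norml => /andP[Ys _].
  by exists s; rewrite ?s0 //; move: Ys; rewrite ltrBrDr addNr.
move=> xl; rewrite ltNge; apply/negP => Yx.
have [c cl Yc] : exists2 c, 0 < c < l & Y c = 0.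
  have cont z : 0 < z < l -> {for z, continuous Y} by move=> /andP[_]; exact: cY.
  case: (ltgtP p x) => px; last by move: Yx; rewrite -px leNgt Yp.
    have [||c [pcx e]] := @intermediate_value _ (fun v => - Y v) p x 0 (ltW px).
    - by move=> z zpx; apply/continuousN/cont; exact: itv_oo_convex pl xl zpx.
    - by rewrite oppr_le0 oppr_ge0 (ltW Yp).
    exists c; first exact: itv_oo_convex pl xl pcx.
    by apply/eqP; rewrite -oppr_eq0 e.
  have [||c [pcx e]] := @intermediate_value _ Y x p 0 (ltW px).
  - by move=> z zpx; apply: cont; exact: itv_oo_convex xl pl zpx.
  - by rewrite Yx (ltW Yp).
  by exists c => //; exact: itv_oo_convex xl pl pcx.
by have := field_neq0 cl; rewrite Yc eqxx.
Qed.

Lemma field_antiderivative p q : 0 < p -> p < q -> q < l ->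
  exists psi : R -> R, forall u, p < u < q -> is_derive u 1 psi (Y u)^-1.
Proof.
move=> p0 pq ql; apply: antiderivative => // u /andP[pu uq].
have ul : 0 < u < l by rewrite (lt_le_trans p0 pu) (le_lt_trans uq ql).
apply: continuousV; first by rewrite gt_eqF // field_gt0.
by apply: cY; case/andP: ul.
Qed.

(** As Y >= 0 the orbit is monotone, hence stays in [x, F x], where [psi] is differentiable; along
    the orbit [psi] has derivative 1. *)
Lemma field_time x (psi : R -> R) : 0 < x < l ->
  (forall u, x <= u <= F x -> is_derive u 1 psi (Y u)^-1) -> psi (F x) - psi x = 1.
Proof.
move=> xl dpsi; have /andP[x0 xl'] := xl.
have [|gamma [g0 g1 cg rg dg]] := timeY (x := x); first by rewrite ltW.
have Yg (t : R) : 0 <= t <= 1 -> 0 <= Y (gamma t).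
  move=> /rg/andP[]; rewrite le_eqVlt => /predU1P[<- _|g gl].
    exact/field_ge0/field_gt0.
  by rewrite ltW // field_gt0 // g.
have mono (s t : R) : 0 <= s -> s <= t -> t <= 1 -> gamma s <= gamma t.
  move=> s0 st t1; apply: (@ge0_derive_nondecreasing _ gamma (Y \o gamma) s t st) => z.
  - by move=> /andP[sz zt]; apply: dg; rewrite (le_lt_trans s0 sz) (lt_le_trans zt t1).
  - by move=> _; exact: cg.
  - by move=> /andP[sz zt]; apply: Yg; rewrite (le_trans s0 (ltW sz)) (le_trans (ltW zt) t1).
have gx (t : R) : 0 <= t <= 1 -> x <= gamma t <= F x.
  by move=> /andP[t0 t1]; rewrite -{1}g0 -g1 !mono.
have [|t t01|c [c01]] := @mean_value _ (psi \o gamma) (cst 1) 0 1 ltr01.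
- move=> t t01; have t01' : 0 <= t <= 1 by case/andP: t01 => /ltW -> /ltW ->.
  have gt0 : 0 < Y (gamma t).
    apply: field_gt0; case/andP: (gx t t01') => /(lt_le_trans x0) -> _ /=.
    by case/andP: (rg t t01').
  have -> : cst 1 t = (Y (gamma t))^-1 * Y (gamma t) :> R by rewrite mulVf // gt_eqF.
  by apply: is_derive1_comp; [exact/dpsi/gx|exact: dg].
- apply: continuous_comp; first exact: cg.
  exact: derive_continuous (dpsi _ (gx t t01)).
by rewrite /= g0 g1 subr0 mulr1.
Qed.

(** The relation psi (F u) - psi u = 1 holds on a neighbourhood of x; differentiating it at x gives
    F1 x / Y (F x) = 1 / Y x. *)
Lemma field_expand x : 0 < x < l -> Y (F x) = F1 x * Y x.
Proof.
move=> xl; have fl := pm_range M xl; have ffl := pm_range M fl.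
have /andP[gx0 gx] := pc_range H xl; have /andP[_ ffl'] := ffl.
have xF := pm_gt M xl; have FF := pm_gt M fl; have /andP[_ fl'] := fl.
have gl : 0 < G x < l by rewrite gx0 (lt_trans gx (lt_trans xF fl')).
have [psi dpsi] := field_antiderivative gx0 (lt_trans gx (lt_trans xF FF)) ffl'.
have inl u : G x < u < F x -> 0 < u < l.
  by move=> /andP[gu uF]; rewrite (lt_trans gx0 gu) (lt_trans uF fl').
have const u : G x < u < F x -> psi (F u) - psi u = 1.
  move=> ux; have ul := inl u ux; move/andP: (ux) => [gu uF].
  apply: field_time => // z /andP[uz zF]; apply: dpsi.
  rewrite (lt_le_trans gu uz) (le_lt_trans zF) //.
  exact: (pm_increasing M).
have gxf : G x < x < F x by rewrite gx xF.
have d1 : is_derive x 1 (psi \o F) ((Y (F x))^-1 * F1 x).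
  apply: is_derive1_comp; last exact: (pm_derive M).
  by apply: dpsi; rewrite (lt_trans gx xF) FF.
have d2 : is_derive x 1 psi (Y x)^-1 by apply: dpsi; rewrite gx (lt_trans xF FF).
have d3 := is_deriveB d1 d2.
have d4 : is_derive x 1 (psi \o F - psi) 0.
  apply: (@eq_is_derive _ (cst 1) _ _ _ (Num.min (x - G x) (F x - x))).
  - by rewrite lt_min !subr_gt0 gx xF.
  - move=> y; rewrite lt_min !ltr_norml => /andP[/andP[y1 _] /andP[_ y2]].
    rewrite /cst -[LHS](const y) //; apply/andP; split.
      by move: y1; rewrite opprB ltrD2r.
    by move: y2; rewrite ltrD2r.
have e := is_derive_unique d3 d4.
have Yx := field_gt0 xl; have YF := field_gt0 fl.
move/eqP: e; rewrite subr_eq0 => /eqP e.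
have -> : F1 x = Y (F x) * ((Y (F x))^-1 * F1 x) by rewrite mulVKf // gt_eqF.
by rewrite e mulfVK // gt_eqF.
Qed.

(** The mean value theorem for [psi], whose increment is 1. It ties Y to the displacement without
    any knowledge of the orbit, and drives the study of Y near 0. *)
Lemma field_mean_value x : 0 < x < l -> exists z, x < z < F x /\ Y z = F x - x.
Proof.
move=> xl; have fl := pm_range M xl; have ffl := pm_range M fl.
have /andP[gx0 gx] := pc_range H xl; have /andP[_ ffl'] := ffl.
have xF := pm_gt M xl; have FF := pm_gt M fl.
have [psi dpsi] := field_antiderivative gx0 (lt_trans gx (lt_trans xF FF)) ffl'.
have dpsi' u : x <= u <= F x -> is_derive u 1 psi (Y u)^-1.
  by move=> /andP[xu uF]; apply: dpsi; rewrite (lt_le_trans gx xu) (le_lt_trans uF FF).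
have [c [cx e]] := mean_value_derive xF dpsi'.
exists c; split => //.
have cl : 0 < c < l.
  by case/andP: xl cx => x0 _ /andP[xc cF]; rewrite (lt_trans x0 xc) (lt_trans cF) //; case/andP: fl.
have Yc := field_gt0 cl.
by move: e; rewrite field_time // => /(congr1 (fun a => Y c * a)); rewrite mulr1 mulVKf ?gt_eqF.
Qed.

Lemma pm_small e : 0 < e -> exists2 d, 0 < d & forall x, 0 < x < l -> x < d -> F x < e.
Proof.
move=> e0; have /continuousP_eps /(_ e e0) [d [d0 Hd]] := pm_cont M 0.
exists d => // x /andP[x0 _] xd; have := Hd x.
rewrite subr0 gtr0_norm // (pm_fix M) subr0 => /(_ xd).
by rewrite ltr_norml => /andP[_].
Qed.

Lemma pm_point d : 0 < d -> exists2 x, 0 < x < l & x < d.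
Proof.
move=> d0; have l0 := pc_l H.
exists (Num.min d l / 2); last first.
  by rewrite ltr_pdivrMr // (@le_lt_trans _ _ d) ?ge_min ?lexx // ltr_pMr ?ltr1n.
rewrite divr_gt0 ?lt_min ?d0 //= ltr_pdivrMr // (@le_lt_trans _ _ l) ?ge_min ?lexx ?orbT //.
by rewrite ltr_pMr ?ltr1n.
Qed.

Lemma field_at0 : Y 0 = 0.
Proof.
have l0 := pc_l H; have := field_ge0 field_gt0.
rewrite le_eqVlt => /predU1P[//|Y0].
have Y2 : 0 < Y 0 / 2 by rewrite divr_gt0.
have /continuousP_eps /(_ _ Y2) [d [d0 Hd]] := cY l0.
have [|s s0 Hs] := @pm_small (Num.min d (Y 0 / 2)); first by rewrite lt_min d0.
have [x xl xs] := pm_point s0.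
have := Hs x xl xs; rewrite lt_min => /andP[Fd FY].
have [z [/andP[xz zF] Yz]] := field_mean_value xl.
have /andP[x0 _] := xl; have z0 := lt_trans x0 xz.
have := Hd z; rewrite subr0 gtr0_norm // => /(_ (lt_trans zF Fd)).
by rewrite Yz ltr_norml => /andP[? _]; lra.
Qed.

(** If Y z = F x - x with x < z, then Y1 z' * z = (F1 c - 1) * x for some z' and c near 0, so |Y1
    z'| <= |F1 c - 1|, which tends to 0 as F is parabolic. *)
Lemma field_slope_at0 : Y1 0 = 0.
Proof.
have l0 := pc_l H; apply/eqP; rewrite -normr_le0 leNgt; apply/negP => Y10.
set a := `|Y1 0| in Y10; have a2 : 0 < a / 2 by rewrite divr_gt0.
have /continuousP_eps /(_ _ a2) [d [d0 Hd]] := cY1 l0.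
have /continuousP_eps /(_ _ a2) [d' [d'0 Hd']] := pm_cont1 M 0.
have [|s s0 Hs] := @pm_small (Num.min d d'); first by rewrite lt_min d0.
have [x xl xs] := pm_point s0.
have := Hs x xl xs; rewrite lt_min => /andP[Fd Fd'].
have [z [/andP[xz zF] Yz]] := field_mean_value xl.
have /andP[x0 xl'] := xl; have z0 := lt_trans x0 xz; have fl := pm_range M xl.
have zl : z < l by rewrite (lt_trans zF) //; case/andP: fl.
have [t /andP[t0 tz]|t /andP[_ tz]|z' [/andP[z'0 z'z] e]] := @mean_value _ Y Y1 0 z z0.
- by apply: dY; rewrite t0 (lt_trans tz zl).
- exact/cY/(le_lt_trans tz zl).
have [t /andP[t0 tx]|t _|c [/andP[c0 cx] e']] := @mean_value _ F F1 0 x x0.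
- by apply: (pm_derive M); rewrite t0 (lt_trans tx xl').
- exact: (pm_cont M).
move: e e'; rewrite field_at0 (pm_fix M) !subr0 Yz => e e'.
have E : Y1 z' * z = (F1 c - 1) * x by rewrite -e e'; ring.
have := Hd z'; rewrite subr0 gtr0_norm // => /(_ (lt_trans z'z (lt_trans zF Fd))) h1.
have := Hd' c; rewrite subr0 gtr0_norm // (pm_parabolic M).
move=> /(_ (lt_trans cx (lt_trans (lt_trans xz zF) Fd'))) h2.
have h3 : `|Y1 z'| <= `|F1 c - 1|.
  rewrite -(@ler_pM2r _ z) // -{1}(gtr0_norm z0) -normrM E normrM (gtr0_norm x0).
  by rewrite ler_wpM2l // ltW.
have h4 : a <= `|Y1 z' - Y1 0| + `|Y1 z'|.
  by have := ler_normB (Y1 z') (Y1 z' - Y1 0); rewrite subKr addrC.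
by move: h1 h2 h3 h4; lra.
Qed.

(** Y x differs from Y z = F x - x by Y1 c * (z - x), where z - x <= F x - x and Y1 c is small
    because Y1 0 = 0. *)
Lemma field_equiv e : 0 < e -> exists2 d, 0 < d &
  forall x, 0 < x < l -> x < d -> `|Y x - (F x - x)| <= e * (F x - x).
Proof.
move=> e0; have l0 := pc_l H.
have /continuousP_eps /(_ _ e0) [d [d0 Hd]] := cY1 l0.
have [s s0 Hs] := pm_small d0; exists s => // x xl xs.
have Fd := Hs x xl xs; have fl := pm_range M xl.
have [z [/andP[xz zF] Yz]] := field_mean_value xl.
have /andP[x0 xl'] := xl; have z0 := lt_trans x0 xz.
have zl : z < l by rewrite (lt_trans zF) //; case/andP: fl.
have [t /andP[xt tz]|c [/andP[xc cz] E]] := @mean_value_derive _ Y Y1 x z xz.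
  by apply: dY; rewrite (lt_le_trans x0 xt) (le_lt_trans tz zl).
have := Hd c; have c0 := lt_trans x0 xc.
rewrite field_slope_at0 !subr0 gtr0_norm // => /(_ (lt_trans cz (lt_trans zF Fd))) h.
rewrite -{1}Yz distrC E normrM (gtr0_norm (_ : 0 < z - x)) ?subr_gt0 //.
apply: ler_pM; rewrite ?normr_ge0 ?subr_ge0 ?(ltW xz) ?(ltW h) //.
by rewrite lerD2r ltW.
Qed.

Lemma displacement_expand x : 0 < x < l -> displacement G (F x) = F x - x.
Proof. by move=> xl; rewrite /displacement (pm_GK M). Qed.

Lemma szekeres_equiv (w : nat -> R) : (forall n, 0 < w n < l) -> (w n @[n --> \oo] --> 0) ->
  displacement G (w n) / szekeres H (w n) @[n --> \oo] --> (1 : R).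
Proof.
move=> wl w0.
have cCw : (K / m * w n @[n --> \oo] --> K / m * 0) by exact: cvgMr.
have cE : (expR (K / m * w n) @[n --> \oo] --> (1 : R)).
  by rewrite -expR0 -[X in expR X](mulr0 (K / m)); exact: continuous_seq (@continuous_expR _ _) cCw.
have cE' : (expR (- (K / m * w n)) @[n --> \oo] --> (1 : R)).
  rewrite -expR0 -[X in expR X]oppr0 -[X in expR (- X)](mulr0 (K / m)).
  by apply: continuous_seq (@continuous_expR _ _) _; exact: cvgN.
apply: (squeeze_cvgr _ cE' cE); apply: nearW => n.
have X0 := szekeres_gt0 H (wl n).
rewrite ler_pdivlMr // ler_pdivrMr // expRN ler_pdivrMl ?expR_gt0 //.
rewrite szekeres_le //= -ler_pdivrMl ?expR_gt0 // -expRN.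
exact: szekeres_ge.
Qed.

(** The quotient q is the same at all points of the backward orbit, both fields being multiplied by
    F1 under F; near 0 both are equivalent to the displacement, so q = 1. *)
Theorem field_szekeres x : 0 < x < l -> Y x = szekeres H x.
Proof.
move=> xl; have X0 := szekeres_gt0 H xl.
pose w n := iter n G x; pose q := Y x / szekeres H x.
have wl n : 0 < w n < l by exact: (pc_iter_in H).
have w0 : (w n @[n --> \oo] --> 0) by exact: (pc_iter_cvg0 H).
have w0' : (w n.+1 @[n --> \oo] --> 0).
  apply/cvg_nearP => e e0; have /cvg_nearP /(_ e e0)[N HN] := w0.
  by exists N => n Nn; exact: HN (leqW Nn).
have FwS n : F (w n.+1) = w n by rewrite /w iterS (pm_FK M) //; exact: wl.
have qw n : Y (w n) = q * szekeres H (w n).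
  elim: n => [|n IH]; first by rewrite /w /= /q divfK // gt_eqF.
  move: IH; rewrite -FwS field_expand // szekeres_expand // mulrCA.
  by apply: mulfI; rewrite gt_eqF // (pm_F1_gt0 M).
have c1 : (F1 (w n.+1) @[n --> \oo] --> (1 : R)).
  by rewrite -(pm_parabolic M); exact: continuous_seq (pm_cont1 M 0) w0'.
have c2 : (Y (w n.+1) / displacement G (w n) @[n --> \oo] --> (1 : R)).
  apply/cvg_nearP => e e0; have e2 : 0 < e / 2 by rewrite divr_gt0.
  have [d d0 Hd] := field_equiv e2.
  have /cvg_nearP /(_ d d0)[N HN] := w0'; exists N => n Nn.
  have dn : displacement G (w n) = F (w n.+1) - w n.+1.
    by rewrite -{1}FwS displacement_expand.
  have D0 := displacement_gt0 H (wl n); rewrite dn in D0 *.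
  have -> : Y (w n.+1) / (F (w n.+1) - w n.+1) - 1 =
    (Y (w n.+1) - (F (w n.+1) - w n.+1)) / (F (w n.+1) - w n.+1).
    by rewrite mulrBl divff // gt_eqF.
  rewrite normrM normfV [in X in _ / X < _](gtr0_norm D0) ltr_pdivrMr //.
  apply: (@le_lt_trans _ _ (e / 2 * (F (w n.+1) - w n.+1))).
    apply: Hd => //; have := HN n Nn; rewrite subr0 gtr0_norm //.
    by case/andP: (wl n.+1).
  by rewrite ltr_pM2r // ltr_pdivrMr // ltr_pMr ?ltr1n.
have c3 := szekeres_equiv wl w0.
have c : (F1 (w n.+1) * (Y (w n.+1) / displacement G (w n)) *
    (displacement G (w n) / szekeres H (w n)) @[n --> \oo] --> (1 * 1 * 1 : R)).
  by apply: cvgM => //; exact: cvgM.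
have cq : ((fun n => q) n @[n --> \oo] --> (1 : R)).
  rewrite [X in X @ _ --> _](_ : _ = fun n => F1 (w n.+1) *
    (Y (w n.+1) / displacement G (w n)) * (displacement G (w n) / szekeres H (w n))).
    by rewrite !mulr1 in c.
  apply/funext => n; have D0 := displacement_gt0 H (wl n); have Xn := szekeres_gt0 H (wl n).
  have := field_expand (wl n.+1); rewrite FwS qw => e.
  rewrite -[LHS](mulfK (lt0r_neq0 Xn)) e /=.
  by field; rewrite !gt_eqF.
have q1 : q = 1 by apply: cvg_unique cq => //; exact: cvg_cst.
by have := qw 0%N; rewrite q1 mul1r.
Qed.

End Uniqueness.

(** * Growth of the derivatives of the iterates *)

Section Growth.
Context {R : realType} {l K m : R} {F F1 F2 G G1 G2 : R -> R}.
Hypothesis M : parabolic_model l K m F F1 F2 G G1 G2.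
Implicit Types x y z u v w t om e T : R.

Local Notation H := (pm_contraction M).
Local Notation X := (szekeres H).
Local Notation C := (K / m).

Lemma pm_iter_range n x : 0 < x < l -> 0 < iter n F x < l.
Proof. by move=> xl; elim: n => [//|n IH]; exact: (pm_range M). Qed.

Lemma pm_iter_GK n x : 0 < x < l -> iter n G (iter n F x) = x.
Proof.
by elim: n x => [//|n IH] x xl; rewrite iterS iterSr IH ?(pm_range M) // (pm_GK M).
Qed.

Lemma pm_iter_FK n x : 0 < x < l -> iter n F (iter n G x) = x.
Proof.
by elim: n x => [//|n IH] x xl; rewrite iterS iterSr IH ?(pm_FK M) // (pc_iter_in H 1).
Qed.

Lemma szekeres_iter_expand n x : 0 < x < l ->
  X (iter n F x) = iter_derivative F F1 n x * X x.
Proof.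
move=> xl; elim: n => [|n IH]; first by rewrite /iter_derivative big_ord0 mul1r.
rewrite iterS szekeres_expand ?pm_iter_range // IH /iter_derivative big_ord_recr /=.
by ring.
Qed.

(* Taylor's formula at u, evaluated at u - (F1 u - 1) / om, where the displacement is still
   nonnegative. *)
Lemma slope_square_le om u : 0 < u < l -> 0 < om ->
  (forall v, 0 < v < u -> `|F2 v| <= om) -> 1 <= F1 u ->
  (F1 u - 1) ^+ 2 <= 2 * om * (F u - u).
Proof.
move=> ul om0 Hom F1u; have /andP[u0 ul'] := ul.
have inl v : 0 < v < u -> 0 < v < l.
  by move=> /andP[v0 vu]; rewrite v0 (lt_trans vu ul').
set a := F1 u - 1; have a0 : 0 <= a by rewrite subr_ge0.
have slope t : 0 <= t -> t < u -> F1 u - F1 t <= om * (u - t).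
  move=> t0 tu.
  have [z /andP[tz zu]|z _|c [/andP[tc cu] ->]] := @mean_value _ F1 F2 t u tu.
  - by apply: (pm_derive1 M); apply: inl; rewrite (le_lt_trans t0 tz).
  - exact: (pm_cont1 M).
  rewrite ler_wpM2r ?subr_ge0 ?(ltW tu) // (le_trans (ler_norm _)) // Hom //.
  by rewrite (le_lt_trans t0 tc).
have su : a / om <= u.
  rewrite ler_pdivrMr // mulrC; have := slope 0 (lexx 0) u0.
  by rewrite (pm_parabolic M) subr0.
set s := a / om in su; have s0 : 0 <= s by rewrite divr_ge0 // ltW.
pose h t := F t - t - a * (t - u) - om / 2 * (t - u) ^+ 2.
have hle : h (u - s) <= h u.
  apply: (@ge0_derive_nondecreasing _ h (fun t => F1 t - 1 - a - om * (t - u))).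
  - by rewrite gerBl.
  - move=> t /andP[ts tu]; have t0 : 0 < t by rewrite (le_lt_trans _ ts) // subr_ge0.
    have d1 : is_derive t 1 (fun t => F t - t) (F1 t - 1).
      by apply: is_deriveB; apply: (pm_derive M); apply: inl; rewrite t0.
    have d2 : is_derive t 1 (fun t => a * (t - u)) a.
      rewrite (_ : (fun t => _) = (fun t => - (a * u) + a * t)); first exact: is_derive_affine.
      by apply/funext => z; ring.
    have d3 : is_derive t 1 (fun t => t - u) 1.
      rewrite (_ : (fun t => _) = (fun t => - u + 1 * t)); first exact: is_derive_affine.
      by apply/funext => z; ring.
    have d4 : is_derive t 1 (fun t => om / 2 * (t - u) ^+ 2) (om * (t - u)).
      have := is_derive_mul (is_derive_cst (om / 2) t 1) (is_derive_mul d3 d3).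
      rewrite (_ : 0 * _ + _ = om * (t - u)) //=; by field.
    exact: (is_deriveB (is_deriveB d1 d2) d4).
  - move=> t _; have ct : {for t, continuous (fun t => t - u)}.
      by apply: continuousB; [exact: cvg_id|exact: cst_continuous].
    apply: continuousB.
      apply: continuousB; first by apply: continuousB; [exact: (pm_cont M)|exact: cvg_id].
      by apply: continuousM => //; exact: cst_continuous.
    by apply: continuousM; [exact: cst_continuous|exact: (continuousM ct ct)].
  - move=> t /andP[ts tu]; have t0 : 0 <= t by rewrite (le_trans _ (ltW ts)) // subr_ge0.
    by have := slope t t0 tu; rewrite /a; lra.
have Fs : 0 <= F (u - s) - (u - s).
  have : 0 <= u - s by rewrite subr_ge0.
  rewrite le_eqVlt => /predU1P[<-|us0]; first by rewrite (pm_fix M) subrr.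
  by rewrite subr_ge0 ltW //; apply: (pm_gt M); rewrite us0 (le_lt_trans _ ul') // gerBl.
move: hle; rewrite /h; set D0 := F (u - s) - (u - s) in Fs *.
have -> : u - s - u = - s by ring.
rewrite subrr expr0n /= !mulr0 !subr0 sqrrN mulrN opprK => hle.
have e1 : a * s = a ^+ 2 / om by rewrite /s; field; rewrite gt_eqF.
have e2 : om / 2 * s ^+ 2 = a ^+ 2 / om / 2 by rewrite /s; field; rewrite gt_eqF.
rewrite e1 e2 in hle; rewrite [2 * om]mulrC -mulrA mulrC -ler_pdivrMr //.
by move: hle Fs; lra.
Qed.

Definition inv_sqrt_field x : R := (Num.sqrt (X x))^-1.

Local Notation beta := inv_sqrt_field.

Lemma inv_sqrt_field_gt0 x : 0 < x < l -> 0 < beta x.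
Proof. by move=> xl; rewrite invr_gt0 sqrtr_gt0 szekeres_gt0. Qed.

Lemma iter_derivative_field n x : 0 < x < l ->
  iter_derivative F F1 n x = (Num.sqrt (X (iter n F x)) * beta x) ^+ 2.
Proof.
move=> xl; have X0 := szekeres_gt0 H xl; have Xn := szekeres_gt0 H (pm_iter_range n xl).
rewrite exprMn exprVn !sqr_sqrtr ?(ltW X0) ?(ltW Xn) //.
by rewrite szekeres_iter_expand // mulfK // gt_eqF.
Qed.

(* With [a = sqrt (X u)] and [b = sqrt (X (F u))], [b^2 - a^2 = (F1 u - 1) a^2]. *)
Lemma inv_sqrt_step u : 0 < u < l ->
  let a := Num.sqrt (X u) in let b := Num.sqrt (X (F u)) in
  beta u - beta (F u) = (F1 u - 1) * a / ((a + b) * b).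
Proof.
move=> ul a b; have X0 := szekeres_gt0 H ul.
have XF := szekeres_gt0 H (pm_range M ul).
have a0 : 0 < a by rewrite sqrtr_gt0.
have b0 : 0 < b by rewrite sqrtr_gt0.
have e : b ^+ 2 = F1 u * a ^+ 2.
  by rewrite !sqr_sqrtr ?(ltW X0) ?(ltW XF) // szekeres_expand.
rewrite /inv_sqrt_field -/a -/b.
have -> : (F1 u - 1) * a = (b ^+ 2 - a ^+ 2) / a by rewrite e; field; rewrite gt_eqF.
by field; rewrite !gt_eqF // addr_gt0.
Qed.

(** The core is F1 u - 1 <= 2 T b. Its square follows from [slope_square_le] and F u - u <= exp(C *
    F u) X (F u), which explains the condition on T. Then 2 a <= a + b concludes. *)
Lemma inv_sqrt_step_le om T u : 0 < u < l -> 0 < om ->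
  (forall v, 0 < v < u -> `|F2 v| <= om) -> 0 <= T ->
  om / 2 * expR (C * F u) <= T ^+ 2 -> beta u - beta (F u) <= T.
Proof.
move=> ul om0 Hom T0 HT; have fl := pm_range M ul.
have X0 := szekeres_gt0 H ul; have XF := szekeres_gt0 H fl.
rewrite inv_sqrt_step //=; set a := Num.sqrt (X u); set b := Num.sqrt (X (F u)).
have a0 : 0 < a by rewrite sqrtr_gt0.
have b0 : 0 < b by rewrite sqrtr_gt0.
have ab0 : 0 < (a + b) * b by rewrite mulr_gt0 // addr_gt0.
(* If F1 u < 1 the increment is nonpositive, and T >= 0 is enough. *)
have [F1u|F1u] := leP 1 (F1 u); last first.
  apply: le_trans T0; rewrite pmulr_lle0 ?invr_gt0 // pmulr_lle0 //.
  by rewrite subr_le0 ltW.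
have sq := slope_square_le ul om0 Hom F1u.
have ab : a <= b.
  by rewrite ler_wsqrtr // szekeres_expand // ler_peMl // ltW.
have b2 : b ^+ 2 = X (F u) by rewrite sqr_sqrtr // ltW.
have le1 : F1 u - 1 <= T * (2 * b).
  rewrite -ler_sqr ?nnegrE ?subr_ge0 //; last by rewrite mulr_ge0 // mulr_ge0 // ltW.
  apply: (le_trans sq); rewrite !exprMn b2.
  have := szekeres_ge H fl; rewrite (displacement_expand M ul) expRN.
  rewrite ler_pdivrMl ?expR_gt0 // => h.
  apply: (@le_trans _ _ (2 * om * (expR (C * F u) * X (F u)))).
    by rewrite ler_wpM2l // mulr_ge0 // ltW.
  rewrite (_ : 2 * om * _ = om / 2 * expR (C * F u) * (2 ^+ 2 * X (F u))); last by field.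
  by rewrite ler_wpM2r // mulr_ge0 ?(ltW XF) // sqr_ge0.
rewrite ler_pdivrMr //; apply: (@le_trans _ _ (T * (2 * b) * a)).
  by rewrite ler_wpM2r // ltW.
rewrite -!mulrA ler_wpM2l // [b * a]mulrC mulrA ler_wpM2r ?(ltW b0) //.
by move: ab; lra.
Qed.

Lemma inv_sqrt_le T n x : 0 < x < l -> 0 <= T -> (K + 1) / 2 * expR (C * l) <= T ^+ 2 ->
  beta x <= beta (iter n F x) + T * n%:R.
Proof.
move=> xl T0 HT; elim: n => [|n IH]; first by rewrite mulr0 addr0.
have yl := pm_iter_range n xl; have fl := pm_range M yl.
have K0 := pc_K H.
(* K + 1 rather than K, since [om] has to be positive. *)
have := @inv_sqrt_step_le (K + 1) T (iter n F x) yl.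
rewrite ltr_wpDl // => /(_ isT); have /andP[y0 yl'] := yl.
have Hv v : 0 < v < iter n F x -> `|F2 v| <= K + 1.
  move=> /andP[v0 vy]; apply: (@le_trans _ _ K); last by rewrite lerDl.
  by apply: (pm_upper2 M); rewrite v0 (lt_trans vy yl').
move=> /(_ Hv T0).
have le : (K + 1) / 2 * expR (C * F (iter n F x)) <= T ^+ 2.
  apply: le_trans HT; rewrite ler_wpM2l ?divr_ge0 ?addr_ge0 // ler_expR.
  by rewrite (pc_bound H).
move=> /(_ le); rewrite -natr1 mulrDr mulr1 /=; move: IH; lra.
Qed.

Local Notation A := (`|F2 0| / 2).

Lemma expR_small k : 1 < k -> exists2 d, 0 < d &
  forall u, 0 < u < d -> expR (C * F u) <= k.
Proof.
move=> k1; have c0 : {for 0, continuous (fun u => expR (C * F u))}.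
  apply: continuous_comp; last exact: continuous_expR.
  by apply: continuousM; [exact: cst_continuous|exact: (pm_cont M)].
have /continuousP_eps /(_ (k - 1)) [|d [d0 Hd]] := c0; first by rewrite subr_gt0.
exists d => // u /andP[u0 ud]; have := Hd u.
rewrite subr0 gtr0_norm // (pm_fix M) mulr0 expR0 => /(_ ud).
by rewrite ltr_norml => /andP[_]; rewrite ltrD2r => /ltW.
Qed.

Lemma inv_sqrt_step_le_near T : 0 <= T -> A < T ^+ 2 -> exists2 d, 0 < d &
  forall u, 0 < u < l -> u < d -> beta u - beta (F u) <= T.
Proof.
move=> T0 AT; set e := T ^+ 2 - A; have e0 : 0 < e by rewrite subr_gt0.
(* om / 2 is the midpoint of A and T^2: above A in order to bound |F2| / 2 near 0, below T^2 to
   leave room for the factor exp(C * F u). *)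
set om := `|F2 0| + e; have om0 : 0 < om by rewrite ltr_wpDl.
have /continuousP_eps /(_ _ e0) [d1 [d10 Hd1]] := pm_cont2 M 0.
have r1 : 1 < T ^+ 2 / (om / 2).
  rewrite ltr_pdivlMr ?divr_gt0 // mul1r /om; move: e0 AT; rewrite /e; lra.
have [d2 d20 Hd2] := expR_small r1.
exists (Num.min d1 d2); first by rewrite lt_min d10.
move=> u ul; rewrite lt_min => /andP[u1 u2]; have /andP[u0 _] := ul.
apply: (@inv_sqrt_step_le om) => //.
  move=> v /andP[v0 vu]; have := Hd1 v; rewrite subr0 gtr0_norm // => /(_ (lt_trans vu u1)) h.
  by rewrite -(subrK (F2 0) (F2 v)) (le_trans (ler_normD _ _)) // addrC lerD2l ltW.
rewrite mulrC -ler_pdivlMr ?divr_gt0 //; apply: Hd2.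
by rewrite u0.
Qed.

Lemma field_const_ex : exists2 T, 1 <= T & (K + 1) / 2 * expR (C * l) <= T ^+ 2.
Proof.
set B := (K + 1) / 2 * expR (C * l).
have B0 : 0 <= B by rewrite mulr_ge0 ?expR_ge0 // divr_ge0 ?addr_ge0 // (pc_K H).
exists (1 + B); first by rewrite lerDl.
by rewrite sqrrD expr1n; have := sqr_ge0 B; rewrite mul1r -mulr_natl; lra.
Qed.

(** Take k with G^k y1 < d. As G^k is monotone, an orbit ending below y1 is still below d when k
    steps remain. Those k steps cost at most T1 * k, which is the constant c, whatever n and x
    are. *)
Lemma inv_sqrt_le_far T y1 : 0 < y1 < l -> 0 <= T -> A < T ^+ 2 -> exists2 c, 0 <= c &
  forall n x, 0 < x < l -> iter n F x <= y1 ->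
    beta x <= beta (iter n F x) + T * n%:R + c.
Proof.
move=> y1l T0 AT; have [d d0 Hd] := inv_sqrt_step_le_near T0 AT.
have [T1 T11 HT1] := field_const_ex; have T10 : 0 <= T1 by rewrite (le_trans ler01).
have near n x : 0 < x < l -> iter n F x < d -> beta x <= beta (iter n F x) + T * n%:R.
  move=> xl; elim: n => [|n IH Fd]; first by rewrite mulr0 addr0.
  have yl := pm_iter_range n xl; have yd : iter n F x < d.
    by apply: lt_trans Fd; exact: (pm_gt M).
  have := IH yd; have := Hd _ yl yd; rewrite -natr1 mulrDr mulr1 /=; lra.
have /cvg_nearP /(_ d d0) [k /(_ k (leqnn k))] := pc_iter_cvg0 H y1l.
rewrite subr0 gtr0_norm => [kd|]; last by case/andP: (pc_iter_in H k y1l).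
exists (T1 * k%:R) => [|n x xl nx]; first by rewrite mulr_ge0.
have [nk|kn] := leqP n k.
  apply: (le_trans (inv_sqrt_le n xl T10 HT1)); rewrite -addrA lerD2l.
  by rewrite ler_wpDl ?mulr_ge0 // ler_wpM2l // ler_nat.
set j := (n - k)%N; have ejk : n = (k + j)%N by rewrite /j subnKC // ltnW.
have jl := pm_iter_range j xl; have nl := pm_iter_range n xl.
have jd : iter j F x < d.
  apply: le_lt_trans kd; rewrite -(pm_iter_GK k jl) -iterD -ejk.
  by apply: (pc_iter_le H) => //; [case/andP: nl|case/andP: y1l].
apply: (le_trans (near j x xl jd)).
have := inv_sqrt_le k jl T10 HT1; rewrite -iterD -ejk => h.
have : T * j%:R <= T * n%:R by rewrite ler_wpM2l // ler_nat leq_subr.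
by move: h; lra.
Qed.

Lemma sqrt_field_near_end e : 0 < e -> exists2 y1, 0 < y1 < l &
  forall y, 0 < y < l -> y1 < y -> Num.sqrt (X y) <= e.
Proof.
move=> e0; have l0 := pc_l H.
set B := expR (C * l); have B0 : 0 < B by exact: expR_gt0.
have cD : {for l, continuous (displacement G)}.
  by apply: continuousB; [exact: cvg_id|exact: (pc_cont H)].
have /continuousP_eps /(_ (e ^+ 2 / B)) [|d [d0 Hd]] := cD.
  by rewrite divr_gt0 // exprn_gt0.
have [z zl zd] := pm_point M d0; have /andP[z0 zl'] := zl.
exists (l - z); first by rewrite subr_gt0 zl' gtrBl.
move=> y yl zy; have /andP[y0 yl'] := yl; have yd : `|y - l| < d by rewrite ltr0_norm ?subr_lt0 // opprB; lra.
have := Hd y yd; rewrite /displacement (pm_end M) subrr subr0 => h.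
rewrite -(ger0_norm (ltW e0)) -sqrtr_sqr ler_wsqrtr //.
apply: (le_trans (szekeres_le H yl)).
have Dy := displacement_gt0 H yl.
apply: (@le_trans _ _ (B * displacement G y)).
  by rewrite ler_wpM2r ?(ltW Dy) // ler_expR (pc_bound H).
by rewrite mulrC -ler_pdivlMr // (le_trans (ler_norm _)) // ltW.
Qed.

Lemma sqrt_iter_derivative_le n x b : 0 < x < l -> beta x <= beta (iter n F x) + b ->
  Num.sqrt (X (iter n F x)) * beta x <= 1 + Num.sqrt (X (iter n F x)) * b.
Proof.
move=> xl hb; have s0 : 0 < Num.sqrt (X (iter n F x)).
  by rewrite sqrtr_gt0 szekeres_gt0 // pm_iter_range.
apply: (le_trans (ler_wpM2l (ltW s0) hb)).
by rewrite mulrDr /inv_sqrt_field mulfV ?gt_eqF.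
Qed.

Lemma iter_derivative_le_of n x S : 0 < x < l -> 0 <= S ->
  Num.sqrt (X (iter n F x)) * beta x <= S -> iter_derivative F F1 n x <= S ^+ 2.
Proof.
move=> xl S0 h; rewrite iter_derivative_field // ler_sqr ?nnegrE //.
by rewrite mulr_ge0 ?sqrtr_ge0 // ltW // inv_sqrt_field_gt0.
Qed.

(** For a fixed T the coefficient of n tends to 0 with [l]: short components contribute little, from
    a rank independent of the component. *)
Lemma iter_derivative_uniform T n x : 0 < x < l -> 0 <= T ->
  (K + 1) / 2 * expR (C * l) <= T ^+ 2 ->
  iter_derivative F F1 n x <= (1 + Num.sqrt (expR (C * l) * l) * (T * n%:R)) ^+ 2.
Proof.
move=> xl T0 HT; have yl := pm_iter_range n xl.
apply: iter_derivative_le_of => //.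
  by rewrite addr_ge0 // mulr_ge0 ?sqrtr_ge0 // mulr_ge0.
apply: (le_trans (sqrt_iter_derivative_le xl (inv_sqrt_le n xl T0 HT))).
rewrite lerD2l ler_wpM2r ?mulr_ge0 // ler_wsqrtr //.
apply: (le_trans (szekeres_le H yl)); apply: ler_pM; rewrite ?expR_ge0 //.
- exact/ltW/(displacement_gt0 H).
- by rewrite ler_expR (pc_bound H).
- by rewrite ltW // (lt_trans (displacement_lt H yl)) //; case/andP: yl.
Qed.

Lemma nat_large (a b : R) : 0 < b -> exists N : nat, forall n, (N <= n)%N -> a <= b * n%:R.
Proof.
move=> b0; exists (Num.truncn (`|a| / b)).+1 => n Nn.
rewrite mulrC -ler_pdivrMr //; apply: (@le_trans _ _ (`|a| / b)).
  by rewrite ler_wpM2r ?invr_ge0 ?(ltW b0) // ler_norm.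
apply/ltW/(lt_le_trans (truncnS_gt _)); by rewrite ler_nat.
Qed.

Theorem growth_upper M0 e : 0 < e -> (forall y, 0 < y < l -> X y <= M0) ->
  exists N : nat, forall n x, (N <= n)%N -> 0 < x < l ->
    iter_derivative F F1 n x <= (A * M0 + e) * n%:R ^+ 2.
Proof.
move=> e0 HM; have l0 := pc_l H.
have [z zl _] := pm_point M ltr01.
have M00 : 0 < M0 by apply: lt_le_trans (HM z zl); exact: szekeres_gt0.
have A0 : 0 <= A by rewrite divr_ge0.
have S20 : 0 < A * M0 + e by rewrite ltr_wpDl // mulr_ge0 // ltW.
set S := Num.sqrt (A * M0 + e); have S0 : 0 < S by rewrite sqrtr_gt0.
have S2 : S ^+ 2 = A * M0 + e by rewrite sqr_sqrtr // ltW.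
set s0 := Num.sqrt M0; have s00 : 0 < s0 by rewrite sqrtr_gt0.
set sA := Num.sqrt A; have sA0 : 0 <= sA by rewrite sqrtr_ge0.
have sS : s0 * sA < S.
  rewrite -ltr_sqr ?nnegrE ?mulr_ge0 // ?(ltW s00) ?(ltW S0) //.
  by rewrite S2 exprMn !sqr_sqrtr // ?(ltW M00) // mulrC ltrDl.
have g0 : 0 < S - s0 * sA by rewrite subr_gt0.
(* T must exceed sqrt A to bound the steps near 0, and s0 * T must stay below S. The margin e makes
   room for both; the denominator 2 * (s0 + 1) works for every size of s0. *)
have [T TA sT] : exists2 T, sA < T & s0 * T < S.
  have den : 0 < 2 * (s0 + 1) by rewrite mulr_gt0 // addr_gt0.
  exists (sA + (S - s0 * sA) / (2 * (s0 + 1))); first by rewrite ltrDl divr_gt0.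
  rewrite mulrDr -ltrBrDl mulrCA gtr_pMr // ltr_pdivrMr // mul1r.
  by move: s00; lra.
have T0 : 0 <= T by rewrite (le_trans sA0) // ltW.
have AT : A < T ^+ 2 by rewrite -(sqr_sqrtr A0) ltr_sqr ?nnegrE.
have [T1 T11 HT1] := field_const_ex; have T10 : 0 < T1 by rewrite (lt_le_trans ltr01).
(* Beyond y1 the crude step bound T1 is enough: sqrt X * T1 <= S / 2, and the other half of S * n
   absorbs the term 1. *)
have [|y1 y1l Hy1] := @sqrt_field_near_end (S / 2 / T1); first by rewrite !divr_gt0.
have [c c0 Hc] := inv_sqrt_le_far y1l T0 AT.
have sT' : 0 < S - s0 * T by rewrite subr_gt0.
have [N1 HN1] := @nat_large (1 + s0 * c) (S - s0 * T) sT'.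
have S20' : 0 < S / 2 by rewrite divr_gt0.
have [N2 HN2] := @nat_large 1 (S / 2) S20'.
exists (maxn N1 N2) => n x; rewrite geq_max => /andP[n1 n2] xl.
have yl := pm_iter_range n xl.
rewrite -S2 -exprMn; apply: iter_derivative_le_of => //.
  by rewrite mulr_ge0 // ltW.
have [yy1|yy1] := leP (iter n F x) y1.
  have hb := Hc n x xl yy1; rewrite -addrA in hb.
  apply: (le_trans (sqrt_iter_derivative_le xl hb)).
  have ss : Num.sqrt (X (iter n F x)) <= s0 by rewrite ler_wsqrtr // HM.
  apply: (@le_trans _ _ (1 + s0 * (T * n%:R + c))).
    by rewrite lerD2l ler_wpM2r // addr_ge0 // mulr_ge0.
  by have := HN1 n n1; rewrite mulrBl lerBrDr mulrDr mulrA [s0 * T * _ + _]addrC addrA.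
have hb := inv_sqrt_le n xl (ltW T10) HT1.
apply: (le_trans (sqrt_iter_derivative_le xl hb)).
have ss := Hy1 _ yl yy1; rewrite ler_pdivlMr // in ss.
have : Num.sqrt (X (iter n F x)) * T1 * n%:R <= S / 2 * n%:R by rewrite ler_wpM2r.
by have := HN2 n n2; rewrite mulrA; lra.
Qed.

(** * Lower bound for the growth *)

Lemma F2_0_ge0 : 0 <= F2 0.
Proof.
rewrite leNgt; apply/negP => F20; have l0 := pc_l H.
have /continuousP_eps /(_ (- F2 0)) [|d [d0 Hd]] := pm_cont2 M 0; first by rewrite oppr_gt0.
have [x xl xd] := pm_point M d0; have /andP[x0 xl'] := xl.
have neg v : 0 < v < x -> F2 v <= 0.
  move=> /andP[v0 vx]; have := Hd v; rewrite subr0 gtr0_norm // => /(_ (lt_trans vx xd)).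
  by rewrite ltr_norml => /andP[_]; rewrite ltrBlDr addNr => /ltW.
have neg1 t : 0 < t < x -> F1 t <= 1.
  move=> /andP[t0 tx].
  have [z /andP[z0 zt]|z _|c [/andP[c0 ct]]] := @mean_value _ F1 F2 0 t t0.
  - by apply: (pm_derive1 M); rewrite z0 (lt_trans zt (lt_trans tx xl')).
  - exact: (pm_cont1 M).
  rewrite (pm_parabolic M) subr0 => e; rewrite -subr_le0 e pmulr_lle0 //.
  by apply: neg; rewrite c0 (lt_trans ct tx).
have [t /andP[t0 tx]|t _|c [/andP[c0 cx]]] := @mean_value _ F F1 0 x x0.
- by apply: (pm_derive M); rewrite t0 (lt_trans tx xl').
- exact: (pm_cont M).
rewrite (pm_fix M) !subr0 => e; have := pm_gt M xl; rewrite e.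
rewrite ltNge => /negP; apply; rewrite -[leRHS]mul1r ler_wpM2r ?(ltW x0) //.
by apply: neg1; rewrite c0 cx.
Qed.

Lemma inv_sqrt_step_ge_near T : 0 <= T -> T ^+ 2 < A -> exists2 d, 0 < d &
  forall u, 0 < u < l -> u < d -> T <= beta u - beta (F u).
Proof.
move=> T0 TA; have A0 : 0 < A by apply: le_lt_trans TA; exact: sqr_ge0.
have EA : F2 0 = 2 * A by rewrite ger0_norm ?F2_0_ge0 //; field.
move: A TA A0 EA => a TA A0 EA.
(* A single s < 1 measures all losses near 0: F2 / 2 lies in [a * s, a / s], and F1 u * F1 u * exp(C
   * F u) is at most 1 / s. In the end T^2 <= a * s^4 is required; with r = T^2 / a, Bernoulli's
   inequality gives s^4 >= r for s = 1 - (1 - r) / 4. *)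
have [s [s0 s1 s4]] : exists s : R, [/\ 0 < s, s < 1 & T ^+ 2 / a <= s ^+ 4].
  have r0 : 0 <= T ^+ 2 / a by rewrite divr_ge0 ?sqr_ge0 // ltW.
  have r1 : T ^+ 2 / a < 1 by rewrite ltr_pdivrMr // mul1r.
  move: (T ^+ 2 / a) r0 r1 => r r0 r1.
  exists (1 - (1 - r) / 4); split; [lra|lra|].
  rewrite -subr_ge0.
  have -> : (1 - (1 - r) / 4) ^+ 4 - r =
    ((1 - r) / 4) ^+ 2 * (2 + (2 - (1 - r) / 4) ^+ 2) by field.
  by rewrite mulr_ge0 ?sqr_ge0 // addr_ge0 ?sqr_ge0.
have e0 : 0 < 2 * a * (1 - s) by rewrite mulr_gt0 ?mulr_gt0 // subr_gt0.
have /continuousP_eps /(_ _ e0) [d1 [d10 Hd1]] := pm_cont2 M 0.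
have cE : {for 0, continuous (fun u => F1 u * F1 u * expR (C * F u))}.
  apply: continuousM; first by apply: continuousM; exact: (pm_cont1 M).
  apply: continuous_comp; last exact: continuous_expR.
  by apply: continuousM; [exact: cst_continuous|exact: (pm_cont M)].
have k1 : 0 < s^-1 - 1 by rewrite subr_gt0 invf_gt1.
have /continuousP_eps /(_ _ k1) [d2 [d20 Hd2]] := cE.
exists (Num.min d1 d2); first by rewrite lt_min d10.
move=> u ul; rewrite lt_min => /andP[u1 u2]; have /andP[u0 ul'] := ul.
have low v : 0 < v -> v < d1 -> 2 * (a * s) <= F2 v <= 2 * (a / s).
  move=> v0 vd; have := Hd1 v; rewrite subr0 gtr0_norm // => /(_ vd).
  rewrite EA ltr_norml => /andP[h1 h2]; apply/andP; split; first by move: h1; lra.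
  have : a * (2 - s) <= a / s.
    rewrite ler_pM2l // -(@ler_pM2r _ s) // mulVf ?gt_eqF //.
    by rewrite -subr_ge0 (_ : _ - _ = (1 - s) ^+ 2) ?sqr_ge0 //; ring.
  by move: h2; lra.
have slope t : 0 < t -> t <= u -> 2 * (a * s) * t <= F1 t - 1 <= 2 * (a / s) * t.
  move=> t0 tu.
  have [z /andP[z0 zt]|z _|c [/andP[c0 ct]]] := @mean_value _ F1 F2 0 t t0.
  - by apply: (pm_derive1 M); rewrite z0 (lt_trans zt (le_lt_trans tu ul')).
  - exact: (pm_cont1 M).
  rewrite (pm_parabolic M) subr0 => ->.
  have /andP[h1 h2] := low c c0 (lt_trans ct (le_lt_trans tu u1)).
  by rewrite !ler_wpM2r // ltW.
have disp : F u - u <= a / s * u ^+ 2.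
  suff : a / s * 0 ^+ 2 - (F 0 - 0) <= a / s * u ^+ 2 - (F u - u).
    by rewrite (pm_fix M) expr0n /= mulr0 !subr0 subr_ge0.
  apply: (@ge0_derive_nondecreasing _ (fun t => a / s * t ^+ 2 - (F t - t))
    (fun t => 2 * (a / s) * t - (F1 t - 1)) 0 u (ltW u0)) => t.
  - move=> /andP[t0 tu]; apply: is_deriveB.
      have := is_derive_mul (is_derive_cst (a / s) t 1) (is_derive_mul (is_derive_id t 1) (is_derive_id t 1)).
      by rewrite (_ : 0 * _ + _ = 2 * (a / s) * t) //=; ring.
    by apply: is_deriveB; apply: (pm_derive M); rewrite t0 (lt_trans tu ul').
  - move=> _; apply: continuousB.
      apply: continuousM; first exact: cst_continuous.
      by apply: (@continuousM _ _ id id); exact: cvg_id.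
    by apply: continuousB; [exact: (pm_cont M)|exact: cvg_id].
  - by move=> /andP[t0 tu]; rewrite subr_ge0; case/andP: (slope t t0 (ltW tu)).
have fl := pm_range M ul.
have X0 := szekeres_gt0 H ul; have XF := szekeres_gt0 H fl.
rewrite inv_sqrt_step //=; set p := Num.sqrt (X u); set q := Num.sqrt (X (F u)).
have p0 : 0 < p by rewrite sqrtr_gt0.
have q0 : 0 < q by rewrite sqrtr_gt0.
have /andP[sl _] := slope u u0 (lexx u).
have as0 : 0 < 2 * (a * s) * u by rewrite !mulr_gt0.
have F1u : 1 <= F1 u by rewrite -subr_ge0 (le_trans (ltW as0)).
have F1u0 : 0 < F1 u by rewrite (lt_le_trans ltr01).
have q2 : q ^+ 2 = X (F u) by rewrite sqr_sqrtr // ltW.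
have p2 : p ^+ 2 = X u by rewrite sqr_sqrtr // ltW.
have qp : q <= F1 u * p.
  rewrite -ler_sqr ?nnegrE ?(ltW q0) ?mulr_ge0 ?(ltW p0) ?(ltW F1u0) //.
  rewrite exprMn q2 p2 szekeres_expand // ler_wpM2r ?(ltW X0) //.
  by rewrite expr2 ler_peMl // ltW.
have qq : F1 u * F1 u * X (F u) <= s^-1 * (a / s * u ^+ 2).
  have := szekeres_le H fl; rewrite (displacement_expand M ul) => h.
  apply: (@le_trans _ _ (F1 u * F1 u * (expR (C * F u) * (F u - u)))).
    by rewrite ler_wpM2l // mulr_ge0 ?(ltW F1u0).
  rewrite mulrA; apply: ler_pM => //.
  - by rewrite !mulr_ge0 ?expR_ge0 ?(ltW F1u0).
  - by rewrite subr_ge0 ltW // (pm_gt M).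
  - have := Hd2 u; rewrite subr0 gtr0_norm // => /(_ u2).
    rewrite (pm_parabolic M) (pm_fix M) mulr0 expR0 !mulr1 ltr_norml => /andP[_].
    by rewrite ltrD2r => /ltW.
(* As p + q <= 2 * F1 u * p, this bound makes the increment (F1 u - 1) * p / ((p + q) * q) at least
   T. *)
have key : T * (2 * F1 u * q) <= F1 u - 1.
  rewrite -ler_sqr ?nnegrE ?subr_ge0 //; last by rewrite !mulr_ge0 ?(ltW q0) ?(ltW F1u0).
  apply: (@le_trans _ _ ((2 * (a * s) * u) ^+ 2)); last first.
    by rewrite ler_sqr ?nnegrE ?subr_ge0 ?(ltW as0).
  have -> : (T * (2 * F1 u * q)) ^+ 2 = 4 * T ^+ 2 * (F1 u * F1 u * X (F u)).
    by rewrite -q2; ring.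
  apply: (@le_trans _ _ (4 * T ^+ 2 * (s^-1 * (a / s * u ^+ 2)))).
    by rewrite ler_wpM2l // mulr_ge0 ?sqr_ge0.
  have -> : 4 * T ^+ 2 * (s^-1 * (a / s * u ^+ 2)) =
    T ^+ 2 / a * (4 * a ^+ 2 * u ^+ 2 / s ^+ 2) by field; rewrite !gt_eqF.
  have -> : (2 * (a * s) * u) ^+ 2 = s ^+ 4 * (4 * a ^+ 2 * u ^+ 2 / s ^+ 2).
    by field; rewrite gt_eqF.
  by rewrite ler_wpM2r // divr_ge0 ?sqr_ge0 // mulr_ge0 ?sqr_ge0 // mulr_ge0 ?sqr_ge0.
rewrite ler_pdivlMr ?mulr_gt0 ?addr_gt0 //.
apply: (@le_trans _ _ (T * (2 * F1 u * q) * p)); last by rewrite ler_wpM2r // ltW.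
have -> : T * ((p + q) * q) = T * q * (p + q) by ring.
have -> : T * (2 * F1 u * q) * p = T * q * (F1 u * p + F1 u * p) by ring.
rewrite ler_wpM2l ?mulr_ge0 ?(ltW q0) // lerD //.
by rewrite ler_peMl // ltW.
Qed.

(** Each backward step gains T once the orbit is within d of 0; c = T * N makes the bound trivial
    during the first N steps. *)
Lemma inv_sqrt_ge T y : 0 < y < l -> 0 <= T -> T ^+ 2 < A -> exists2 c, 0 <= c &
  forall n, T * n%:R - c <= beta (iter n G y).
Proof.
move=> yl T0 TA; have [d d0 Hd] := inv_sqrt_step_ge_near T0 TA.
have /cvg_nearP /(_ d d0) [N HN] := pc_iter_cvg0 H yl.
exists (T * N%:R); first by rewrite mulr_ge0.
elim => [|n IH].
  rewrite mulr0 sub0r (le_trans (_ : _ <= 0)) ?oppr_le0 ?mulr_ge0 //.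
  exact/ltW/inv_sqrt_field_gt0.
have nl := pc_iter_in H n.+1 yl.
have [nN|Nn] := leqP N n.+1; last first.
  apply: (@le_trans _ _ 0); last exact/ltW/inv_sqrt_field_gt0.
  by rewrite subr_le0 ler_wpM2l // ler_nat ltnW.
have := HN n.+1 nN; rewrite subr0 gtr0_norm; last by case/andP: nl.
move=> /(Hd _ nl); rewrite {2}iterS (pm_FK M) ?(pc_iter_in H) //.
by move: IH; rewrite -natr1 mulrDr mulr1; lra.
Qed.

(** The points are x = G^n y: their orbits end at y, so the square root of the derivative is sqrt (X
    y) * beta (G^n y). *)
Theorem growth_lower y e : 0 < y < l -> 0 < e ->
  exists N : nat, forall n, (N <= n)%N -> exists2 x, 0 < x < l &
    (A * X y - e) * n%:R ^+ 2 <= iter_derivative F F1 n x.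
Proof.
move=> yl e0; have X0 := szekeres_gt0 H yl.
have [neg|pos] := leP (A * X y) e.
  exists 0%N => n _; exists y => //; rewrite iter_derivative_field //.
  apply: (@le_trans _ _ 0); last exact: sqr_ge0.
  by rewrite mulr_le0_ge0 ?sqr_ge0 // subr_le0.
have t0 : 0 < A - e / (2 * X y).
  rewrite subr_gt0 ltr_pdivrMr ?mulr_gt0 //; move: e0 pos; lra.
(* Then X y * T^2 = A * X y - e / 2: half of e keeps T^2 below A, the other half absorbs the term
   linear in n. *)
set T := Num.sqrt (A - e / (2 * X y)).
have T2 : T ^+ 2 = A - e / (2 * X y) by rewrite sqr_sqrtr // ltW.
have T0 : 0 <= T by exact: sqrtr_ge0.
have TA : T ^+ 2 < A by rewrite T2 gtrBl divr_gt0 // mulr_gt0.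
have [c c0 Hc] := inv_sqrt_ge yl T0 TA.
move: T T2 T0 TA Hc => T T2 T0 TA Hc.
have Tp : 0 < T by rewrite lt_def T0 andbT -sqrf_eq0 T2 gt_eqF.
have e20 : 0 < e / 2 by rewrite divr_gt0.
have [N1 HN1] := @nat_large c T Tp.
have [N2 HN2] := @nat_large (2 * X y * T * c) (e / 2) e20.
exists (maxn N1 N2) => n; rewrite geq_max => /andP[n1 n2].
exists (iter n G y); first exact: (pc_iter_in H).
rewrite iter_derivative_field ?(pc_iter_in H) // pm_iter_FK // exprMn sqr_sqrtr ?(ltW X0) //.
have Tc : 0 <= T * n%:R - c by rewrite subr_ge0 HN1.
apply: (@le_trans _ _ (X y * (T * n%:R - c) ^+ 2)); last first.
  rewrite ler_wpM2l ?(ltW X0) // ler_sqr ?nnegrE //.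
  exact/ltW/inv_sqrt_field_gt0/(pc_iter_in H).
have -> : X y * (T * n%:R - c) ^+ 2 =
  X y * T ^+ 2 * n%:R ^+ 2 - 2 * X y * T * c * n%:R + X y * c ^+ 2 by ring.
have -> : X y * T ^+ 2 = A * X y - e / 2 by rewrite T2; field; rewrite gt_eqF.
have h1 : 2 * X y * T * c * n%:R <= e / 2 * n%:R ^+ 2.
  by rewrite expr2 mulrA ler_wpM2r // HN2.
have h2 : 0 <= X y * c ^+ 2 by rewrite mulr_ge0 ?sqr_ge0 // ltW.
have -> : A * X y - e = A * X y - e / 2 - e / 2 by field.
by rewrite [leLHS]mulrBl -addrA lerD2l; move: h1 h2; lra.
Qed.

End Growth.

(** * Derivatives within a set *)

Section DerivativeWithinTheory.
Context {R : realType}.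
Implicit Types (A : set R) (f g h : R -> R) (x y l : R).

(** The condition making [within A x^'] a proper filter, so that the [lim] in [derive_within] is
    determined by convergence. *)
Definition is_limit_point A x := forall d : R, 0 < d -> exists y, [/\ A y, y != x & `|y - x| < d].

Lemma derive_withinE A f x l : is_limit_point A x -> has_derivative_within A f x l ->
  derive_within A f x = l.
Proof.
move=> acc H; apply: cvg_lim => //.
apply: Build_ProperFilter => /nbhs_ballP[d d0 Hd].
have [y [Ay yx yd]] := acc d d0.
by apply: (Hd y) => //; rewrite /ball /= distrC.
Qed.

Lemma derivable_withinE A f x : is_limit_point A x -> derivable_within A f x ->
  has_derivative_within A f x (derive_within A f x).
Proof. by move=> acc [l Hl]; rewrite (derive_withinE acc Hl). Qed.

Lemma has_derivative_withinS (A B : set R) (h : R -> R) (x k : R) : B `<=` A ->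
  has_derivative_within A h x k -> has_derivative_within B h x k.
Proof.
move=> BA /has_derivative_withinP D; apply/has_derivative_withinP => e /D[t [t0 Ht]].
by exists t; split => // y By; apply: Ht; exact: BA.
Qed.

Lemma has_derivative_within_continuous A f x l : has_derivative_within A f x l ->
  forall e : R, 0 < e -> exists d : R, 0 < d /\
    forall y, A y -> `|y - x| < d -> `|f y - f x| < e.
Proof.
move=> /has_derivative_withinP H e e0; have [d [d0 Hd]] := H 1 ltr01.
have B0 : 0 < `|l| + 1 by rewrite ltr_wpDl.
exists (Num.min d (e / (`|l| + 1))); split; first by rewrite lt_min d0 divr_gt0.
move=> y Ay; rewrite lt_min => /andP[yd ye].
have [->|yx] := eqVneq y x; first by rewrite subrr normr0.
have yx0 : y - x != 0 by rewrite subr_eq0.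
have -> : f y - f x = diff_quotient f x y * (y - x) by rewrite divfK.
rewrite normrM; apply: (@le_lt_trans _ _ ((`|l| + 1) * `|y - x|)); last first.
  by rewrite mulrC -ltr_pdivlMr.
rewrite ler_wpM2r // -(subrK l (diff_quotient _ _ _)) (le_trans (ler_normD _ _)) //.
by rewrite addrC lerD2l ltW // Hd.
Qed.

(** Since f y != f x for y != x, the quotient of [g \o f] factors into two quotients with nonzero
    denominators. *)
Lemma has_derivative_within_comp A f g x l l' : A x ->
  (forall y, A y -> A (f y)) -> (forall y, A y -> y != x -> f y != f x) ->
  has_derivative_within A f x l -> has_derivative_within A g (f x) l' ->
  has_derivative_within A (g \o f) x (l' * l).
Proof.
move=> Ax Af inj Hf Hg.
have Hgf : (diff_quotient g (f x) (f y) @[y --> within A x^'] --> l').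
  apply/cvg_within_dnbhsP => e e0; have /has_derivative_withinP /(_ e e0) [d [d0 Hd]] := Hg.
  have [s [s0 Hs]] := has_derivative_within_continuous Hf d0.
  by exists s; split => // y Ay yx ys; apply: Hd; [exact: Af|exact: inj|exact: Hs].
have Hp : (diff_quotient g (f x) (f y) * diff_quotient f x y @[y --> within A x^'] --> l' * l).
  exact: cvgM Hgf Hf.
move/cvg_within_dnbhsP: Hp => H.
apply/has_derivative_withinP => e /H[d [d0 Hd]]; exists d; split => // y Ay yx yd.
have fyx : f y - f x != 0 by rewrite subr_eq0 inj.
have := Hd y Ay yx yd; rewrite /= /diff_quotient /= mulrA divfK //.
Qed.

Lemma segment_limit_point (p q x : R) : p < q -> p <= x <= q -> is_limit_point `[p, q] x.
Proof.
move=> pq /andP[px xq] d d0.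
have [xq'|qx] := ltP x q.
  have m0 : 0 < Num.min d (q - x) by rewrite lt_min d0 subr_gt0.
  have md : Num.min d (q - x) / 2 < Num.min d (q - x).
    by rewrite ltr_pdivrMr // ltr_pMr ?ltr1n.
  have := md; rewrite lt_min => /andP[m1 m2].
  exists (x + Num.min d (q - x) / 2); split.
  - rewrite /= in_itv /= (le_trans px) /= ?lerDl ?divr_ge0 ?(ltW m0) //.
    by rewrite addrC -lerBrDr ltW.
  - by rewrite -subr_eq0 addrAC subrr add0r gt_eqF // divr_gt0.
  - by rewrite addrAC subrr add0r gtr0_norm // divr_gt0.
have px' : p < x by rewrite (lt_le_trans pq).
have m0 : 0 < Num.min d (x - p) by rewrite lt_min d0 subr_gt0.
have md : Num.min d (x - p) / 2 < Num.min d (x - p).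
  by rewrite ltr_pdivrMr // ltr_pMr ?ltr1n.
have := md; rewrite lt_min => /andP[m1 m2].
exists (x - Num.min d (x - p) / 2); split.
- rewrite /= in_itv /= lerBrDr addrC -lerBrDr (ltW m2) /=.
  by rewrite (le_trans _ xq) // gerBl divr_ge0 ?(ltW m0).
- by rewrite -subr_eq0 addrAC subrr add0r oppr_eq0 gt_eqF // divr_gt0.
- by rewrite addrAC subrr add0r normrN gtr0_norm // divr_gt0.
Qed.

(** Composing with this 1-Lipschitz retraction turns a map continuous within [p, q] into one
    continuous on the line, with the same derivative in ]p, q[. *)
Definition clamp (p q x : R) : R := Num.max p (Num.min q x).

Lemma clamp_in (p q x : R) : p <= q -> p <= clamp p q x <= q.
Proof. by move=> pq; rewrite /clamp le_max lexx /= ge_max pq ge_min lexx. Qed.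

Lemma clamp_id (p q x : R) : p <= x <= q -> clamp p q x = x.
Proof. by move=> /andP[px xq]; rewrite /clamp (min_idPr xq) (max_idPr px). Qed.

Lemma clamp_lipschitz (p q x y : R) : `|clamp p q y - clamp p q x| <= `|y - x|.
Proof.
rewrite /clamp /Num.max /Num.min ler_norml; have := ler_norm (y - x); have := ler_norm (- (y - x)).
by rewrite normrN => h1 h2; do 4 case: ifP => /=; move=> *; apply/andP; split; lra.
Qed.

Lemma max0_dist (v w : R) : `|Num.max 0 w - Num.max 0 v| <= `|w - v|.
Proof.
rewrite /Num.max ler_norml; have := ler_norm (w - v); have := ler_norm (- (w - v)).
by rewrite normrN => h1 h2; do 2 case: ifP => /=; move=> *; apply/andP; split; lra.
Qed.

Lemma continuous_clamp f (p q : R) : p <= q -> {within `[p, q], continuous f} ->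
  forall x, {for x, continuous (f \o clamp p q)}.
Proof.
move=> pq /within_continuousP_eps cf x; apply/continuousP_eps => e e0.
have [|d [d0 Hd]] := cf (clamp p q x) _ e e0; first by rewrite /= in_itv /= clamp_in.
exists d; split => // y yd; apply: Hd; first by rewrite /= in_itv /= clamp_in.
exact: le_lt_trans (clamp_lipschitz _ _ _ _) yd.
Qed.

Lemma is_derive_clamp f (p q x l : R) : p < x < q -> is_derive x 1 f l ->
  is_derive x 1 (f \o clamp p q) l.
Proof.
move=> /andP[px xq]; apply: (@eq_is_derive _ _ _ _ _ (Num.min (x - p) (q - x))).
  by rewrite lt_min !subr_gt0 px.
move=> y; rewrite lt_min !ltr_norml => /andP[/andP[h1 _] /andP[_ h2]].
rewrite /= clamp_id //; apply/andP; split; apply/ltW.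
  by move: h1; rewrite opprB ltrD2r.
by move: h2; rewrite ltrD2r.
Qed.

Lemma eq_continuous_closure f g (p q : R) : p < q ->
  (forall x, {for x, continuous f}) -> (forall x, {for x, continuous g}) ->
  (forall x, p < x < q -> f x = g x) -> forall x, p <= x <= q -> f x = g x.
Proof.
move=> pq cf cg fg x xpq; apply/eqP; rewrite -subr_eq0 -normr_le0 leNgt; apply/negP => e0.
have /continuousP_eps /(_ _ e0) [d [d0 Hd]] : {for x, continuous (fun z => f z - g z)}.
  by apply: continuousB; [exact: cf|exact: cg].
have [y [ypq yd]] : exists y, p < y < q /\ `|y - x| < d.
  move/andP: xpq => [px xq].
  have [px'|] := ltP p x; last first.
    move=> xp; have exp : x = p by apply/le_anti/andP.
    have m0 : 0 < Num.min d (q - x) by rewrite lt_min d0 subr_gt0 exp.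
    have md : Num.min d (q - x) / 2 < Num.min d (q - x).
      by rewrite ltr_pdivrMr // ltr_pMr ?ltr1n.
    have := md; rewrite lt_min => /andP[m1 m2].
    exists (x + Num.min d (q - x) / 2); split.
      by rewrite (le_lt_trans px) /= ?ltrDl ?divr_gt0 // addrC -ltrBrDr.
    by rewrite addrAC subrr add0r gtr0_norm // divr_gt0.
  have m0 : 0 < Num.min d (x - p) by rewrite lt_min d0 subr_gt0.
  have md : Num.min d (x - p) / 2 < Num.min d (x - p).
    by rewrite ltr_pdivrMr // ltr_pMr ?ltr1n.
  have := md; rewrite lt_min => /andP[m1 m2].
  exists (x - Num.min d (x - p) / 2); split.
    by rewrite ltrBrDr addrC -ltrBrDr m2 (lt_le_trans _ xq) // gtrBl divr_gt0.
  by rewrite addrAC subrr add0r normrN gtr0_norm // divr_gt0.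
have := Hd y yd; rewrite (fg y ypq) subrr sub0r normrN ltxx.
by [].
Qed.

End DerivativeWithinTheory.

(** The passage from derivatives within the segment to two-sided ones. Clamped maps need not be
    differentiable at [a] and [b], where only their continuity is recorded. *)
Lemma C2_within_clamp (R : realType) (a b : R) (h : R -> R) : a < b ->
  C_within 2 `[a, b]%classic h ->
  let h1 := derive_within `[a, b]%classic h in
  let h2 := derive_within `[a, b]%classic h1 in
  [/\ forall x : R, a <= x <= b -> has_derivative_within `[a, b] h x (h1 x),
      [/\ forall x : R, {for x, continuous (h \o clamp a b)},
          forall x : R, {for x, continuous (h1 \o clamp a b)} &
          forall x : R, {for x, continuous (h2 \o clamp a b)}],
      forall x : R, a < x < b -> is_derive x 1 (h \o clamp a b) (h1 x) &
      forall x : R, a < x < b -> is_derive x 1 (h1 \o clamp a b) (h2 x)].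
Proof.
move=> ab [dh [dh1 ch2]] h1 h2; have abw := ltW ab.
have D x : a <= x <= b -> has_derivative_within `[a, b] h x (h1 x).
  move=> xab; apply: derivable_withinE; first exact: segment_limit_point.
  by apply: dh; rewrite /= in_itv.
have D1 x : a <= x <= b -> has_derivative_within `[a, b] h1 x (h2 x).
  move=> xab; apply: derivable_withinE; first exact: segment_limit_point.
  by apply: dh1; rewrite /= in_itv.
have W x : a < x < b -> a <= x <= b by move=> /andP[/ltW -> /ltW ->].
split; first exact: D.
- split; [apply: continuous_clamp|apply: continuous_clamp|exact: continuous_clamp] => //.
    apply/within_continuousP_eps => x; rewrite /= in_itv /= => /D.
    exact: has_derivative_within_continuous.
  apply/within_continuousP_eps => x; rewrite /= in_itv /= => /D1.
  exact: has_derivative_within_continuous.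
- move=> x xab; apply: is_derive_clamp => //; apply: within_is_derive (xab) _.
  exact/D/W.
- move=> x xab; apply: is_derive_clamp => //; apply: within_is_derive (xab) _.
  exact/D1/W.
Qed.

(** * Diffeomorphisms of an interval and their components *)

Section IntervalDiffeomorphism.
Context {R : realType} {a b : R} {f : R -> R}.
Hypothesis hab : a < b.
Hypothesis hf : Ck_diffeomorphism 2 `[a, b]%classic f.
Hypothesis hor : orientation_preserving `[a, b]%classic f.
Hypothesis hpar : forall p : R, `[a, b]%classic p -> f p = p -> parabolic `[a, b]%classic f p.
Implicit Types x y z u v : R.

Local Notation L := (`[a, b]%classic : set R).
Local Notation g := (pinv L f).
Local Notation f1 := (derive_within L f).
Local Notation f2 := (derive_within L f1).
Local Notation g1 := (derive_within L g).
Local Notation g2 := (derive_within L g1).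
Local Notation cl := (clamp a b).

Lemma segmentP x : L x <-> a <= x <= b.
Proof. by rewrite /= in_itv. Qed.

Lemma diffeo_in x : a <= x <= b -> a <= f x <= b.
Proof.
by have [[Hf _ _] _ _] := hf; move=> /segmentP xL; apply/segmentP; exact: Hf.
Qed.

Lemma diffeo_inv_in x : a <= x <= b -> a <= g x <= b.
Proof.
have [Hf _ _] := hf; have [Hg _ _] := bijpinv_bij (fun=> point) Hf.
by move=> /segmentP xL; apply/segmentP; exact: Hg.
Qed.

Lemma diffeo_invK x : a <= x <= b -> f (g x) = x.
Proof.
have [Hf _ _] := hf; have [_ _ sf] := Hf; move=> xL; apply: (surjpK _ sf).
by rewrite inE; exact/segmentP.
Qed.

Lemma diffeo_K x : a <= x <= b -> g (f x) = x.
Proof.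
have [Hf _ _] := hf; have [_ jf _] := Hf; move=> xL; apply: (pinvKV _ jf).
by rewrite inE; exact/segmentP.
Qed.

Lemma diffeo_lt x y : a <= x <= b -> a <= y <= b -> x < y -> f x < f y.
Proof. by move=> /segmentP xL /segmentP yL; exact: hor. Qed.

Lemma diffeo_le x y : a <= x <= b -> a <= y <= b -> x <= y -> f x <= f y.
Proof.
by move=> xL yL; rewrite le_eqVlt => /predU1P[->//|xy]; rewrite ltW // diffeo_lt.
Qed.

Lemma diffeo_inv_lt x y : a <= x <= b -> a <= y <= b -> x < y -> g x < g y.
Proof.
move=> xL yL xy; rewrite ltNge; apply/negP => gg.
have := diffeo_le (diffeo_inv_in yL) (diffeo_inv_in xL) gg.
by rewrite !diffeo_invK // leNgt xy.
Qed.

Lemma left_in : a <= a <= b. Proof. by rewrite lexx ltW. Qed.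
Lemma right_in : a <= b <= b. Proof. by rewrite lexx ltW. Qed.

Lemma diffeo_left : f a = a.
Proof.
apply/le_anti/andP; split; last by case/andP: (diffeo_in left_in).
have [h _] := andP (diffeo_inv_in left_in).
by have := diffeo_le left_in (diffeo_inv_in left_in) h; rewrite diffeo_invK // left_in.
Qed.

Lemma diffeo_right : f b = b.
Proof.
apply/le_anti/andP; split; first by case/andP: (diffeo_in right_in).
have [_ h] := andP (diffeo_inv_in right_in).
by have := diffeo_le (diffeo_inv_in right_in) right_in h; rewrite diffeo_invK // right_in.
Qed.

Lemma diffeo_C2 : C_within 2 L f. Proof. by case: hf. Qed.
Lemma diffeo_inv_C2 : C_within 2 L g. Proof. by case: hf. Qed.

Lemma interior_in x : a < x < b -> a <= x <= b.
Proof. by move=> /andP[/ltW -> /ltW ->]. Qed.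

Lemma diffeo_interior x : a < x < b -> a < f x < b.
Proof.
move=> xab; have xL := interior_in xab; case/andP: xab => ax xb.
have := diffeo_lt left_in xL ax; have := diffeo_lt xL right_in xb.
by rewrite diffeo_left diffeo_right => -> ->.
Qed.

(** The two-sided chain rule gives the identity in ]a, b[, and continuity carries it to the end
    points. *)
Lemma diffeo_chain x : a <= x <= b -> g1 (f x) * f1 x = 1.
Proof.
have [Df [cf cf1 _] df _] := C2_within_clamp hab diffeo_C2.
have [Dg [cg cg1 _] dg _] := C2_within_clamp hab diffeo_inv_C2.
have cE z : a <= z <= b -> cl z = z by exact: clamp_id.
have H z : a <= z <= b ->
    (g1 \o cl) ((f \o cl) z) * (f1 \o cl) z = 1.
  move: z; apply: (@eq_continuous_closure _ (fun x => (g1 \o cl) ((f \o cl) x) * (f1 \o cl) x) (cst 1)) => //.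
  - move=> z; apply: continuousM; last exact: cf1.
    apply: (@continuous_comp _ _ _ (f \o cl) (g1 \o cl)); [exact: cf|exact: cg1].
  - by move=> z; exact: cst_continuous.
  - move=> z zab; have zL := interior_in zab; have fz := diffeo_interior zab.
    rewrite /= cE // cE ?interior_in //.
    have d1 : is_derive z 1 ((g \o cl) \o (f \o cl)) (g1 (f z) * f1 z).
      apply: is_derive1_comp; last exact: df.
      by rewrite /= cE //; exact: dg.
    apply: is_derive_unique d1 _.
    have := is_derive_clamp zab (is_derive_id z 1).
    apply: (@eq_is_derive _ _ _ _ _ 1) => // y _ /=.
    have yL := clamp_in y (ltW hab).
    by rewrite [cl (f _)]cE ?diffeo_in // diffeo_K.
move=> xL; have := H x xL; rewrite /= cE // cE //; exact: diffeo_in.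
Qed.

Lemma diffeo_derive_gt0 x : a <= x <= b -> 0 < f1 x.
Proof.
move=> xL; have [Df _ _ _] := C2_within_clamp hab diffeo_C2.
have n0 : f1 x != 0.
  by apply: contra_eq_neq (diffeo_chain xL) => ->; rewrite mulr0 eq_sym oner_neq0.
rewrite lt_def n0 /= leNgt; apply/negP => neg.
have /has_derivative_withinP /(_ (- f1 x)) [|d [d0 Hd]] := Df x xL; first by rewrite oppr_gt0.
have [y [yL yx yd]] := segment_limit_point hab xL d0.
have := Hd y yL yx yd; rewrite ltr_norml => /andP[_].
rewrite ltrBlDr addNr ltNge => /negP; apply.
move/segmentP: yL => yL; rewrite /diff_quotient.
case: (ltgtP x y) => xy; last by rewrite xy eqxx in yx.
  by rewrite divr_ge0 // subr_ge0 ltW // diffeo_lt.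
by rewrite -mulrNN -invrN !opprB divr_ge0 // subr_ge0 ltW // diffeo_lt.
Qed.

Lemma diffeo_inv_derive_gt0 x : a <= x <= b -> 0 < g1 x.
Proof.
move=> xL; have yL := diffeo_inv_in xL; have := diffeo_chain yL.
rewrite diffeo_invK // => e; have f0 := diffeo_derive_gt0 yL.
by rewrite -(pmulr_lgt0 _ f0) e.
Qed.

(** The constants are taken over the whole of [a, b], so that all components share them. *)
Lemma diffeo_bounds : exists K m : R, [/\ 0 <= K, 0 < m,
  forall x, a <= x <= b -> `|f2 x| <= K, forall x, a <= x <= b -> `|g2 x| <= K &
  forall x, a <= x <= b -> m <= g1 x].
Proof.
have [_ [_ _ cf2] _ _] := C2_within_clamp hab diffeo_C2.
have [_ [_ cg1 cg2] _ _] := C2_within_clamp hab diffeo_inv_C2.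
have cE z : a <= z <= b -> cl z = z by exact: clamp_id.
have [z _|p [pL Hp]] := @continuous_segment_max _ (fun x => `|(f2 \o cl) x|) a b (ltW hab).
  by apply: continuous_comp; [exact: cf2|exact: norm_continuous].
have [z _|q [qL Hq]] := @continuous_segment_max _ (fun x => `|(g2 \o cl) x|) a b (ltW hab).
  by apply: continuous_comp; [exact: cg2|exact: norm_continuous].
have [z _|r [rL Hr]] := @continuous_segment_min _ (g1 \o cl) a b (ltW hab).
  exact: cg1.
exists (`|f2 (cl p)| + `|g2 (cl q)|), (g1 (cl r)); split.
- by rewrite addr_ge0.
- by rewrite diffeo_inv_derive_gt0 // clamp_in // ltW.
- by move=> x xL; have := Hp x xL; rewrite /= cE // => h; rewrite ler_wpDr.
- by move=> x xL; have := Hq x xL; rewrite /= cE // => h; rewrite ler_wpDl.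
- by move=> x xL; have := Hr x xL; rewrite /= (cE x xL).
Qed.

Lemma fixed_derive x : a <= x <= b -> f x = x -> f1 x = 1.
Proof. by move=> /segmentP xL fx; have [] := hpar xL fx. Qed.

Lemma fixed_inv x : a <= x <= b -> f x = x -> g x = x.
Proof. by move=> xL fx; rewrite -{1}fx diffeo_K. Qed.

Lemma fixed_inv_derive x : a <= x <= b -> f x = x -> g1 x = 1.
Proof.
by move=> xL fx; have := diffeo_chain xL; rewrite fixed_derive // mulr1 fx.
Qed.

Lemma iter_diffeo_in n x : a <= x <= b -> a <= iter n f x <= b.
Proof. by move=> xL; elim: n => [//|n IH]; exact: diffeo_in. Qed.

Lemma derive_within_iter n x : a <= x <= b ->
  derive_within L (iter n f) x = iter_derivative f f1 n x.
Proof.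
move=> xL; apply: derive_withinE; first exact: segment_limit_point.
have [Df _ _ _] := C2_within_clamp hab diffeo_C2.
elim: n => [|n IH].
  rewrite /iter_derivative big_ord0; apply: is_derive_within; exact: is_derive_id.
rewrite iter_derivativeS mulrC.
apply: (has_derivative_within_comp _ _ _ IH).
- exact/segmentP.
- by move=> y /segmentP yL; apply/segmentP; exact: iter_diffeo_in.
- move=> y /segmentP yL; apply: contraNneq => /eqP; elim: (n) => [//|k IHk] /= /eqP e.
  apply: IHk; rewrite -(diffeo_K (iter_diffeo_in k yL)) e diffeo_K //.
  exact: iter_diffeo_in.
- exact/Df/iter_diffeo_in.
Qed.

End IntervalDiffeomorphism.

(** * Reduction of a component to the model on [0, l] *)

Section ComponentModel.
Context {R : realType} {a b : R} {f : R -> R}.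
Hypothesis hab : a < b.
Hypothesis hf : Ck_diffeomorphism 2 `[a, b]%classic f.
Hypothesis hor : orientation_preserving `[a, b]%classic f.
Hypothesis hpar : forall p : R, `[a, b]%classic p -> f p = p -> parabolic `[a, b]%classic f p.
Implicit Types x y z u v : R.

Local Notation L := (`[a, b]%classic : set R).
Local Notation g := (pinv L f).
Local Notation f1 := (derive_within L f).
Local Notation f2 := (derive_within L f1).
Local Notation g1 := (derive_within L g).
Local Notation g2 := (derive_within L g1).
Local Notation cl := (clamp a b).

Variables c d r s : R.
Hypothesis hac : a <= c.
Hypothesis hcd : c < d.
Hypothesis hdb : d <= b.
Hypothesis hfc : f c = c.
Hypothesis hfd : f d = d.
(* [r] is the repelling endpoint and [s] the direction in which [f] moves the points of ]c, d[. *)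
Hypothesis hrs : [/\ s = 1, r = c & forall x, c < x < d -> x < f x] \/
                 [/\ s = -1, r = d & forall x, c < x < d -> f x < x].

Local Notation l := (d - c).
Local Notation phi v := (r + s * v).

Lemma comp_sq : s * s = 1.
Proof. by case: hrs => -[-> _ _]; ring. Qed.

Lemma comp_phiK v : s * (phi v - r) = v.
Proof. by rewrite addrAC subrr add0r mulrA comp_sq mul1r. Qed.

Lemma comp_phi_invK u : phi (s * (u - r)) = u.
Proof. by rewrite mulrA comp_sq mul1r addrC subrK. Qed.

Lemma comp_range v : (0 < v < l) = (c < phi v < d).
Proof.
case: hrs => -[-> -> _].
  by rewrite mul1r ltrDl ltrBrDr [v + c]addrC.
by rewrite mulN1r gtrBl ltrBrDr -ltrBrDl andbC.
Qed.

Lemma comp_range_inv u : (0 < s * (u - r) < l) = (c < u < d).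
Proof. by rewrite comp_range comp_phi_invK. Qed.

Lemma comp_interior u : c < u < d -> a < u < b.
Proof. by move=> /andP[cu ud]; rewrite (le_lt_trans hac cu) (lt_le_trans ud hdb). Qed.

Lemma comp_in u : c < u < d -> a <= u <= b.
Proof. by move=> /comp_interior/andP[/ltW -> /ltW ->]. Qed.

Lemma comp_left : a <= c <= b.
Proof. by rewrite hac (le_trans (ltW hcd)). Qed.

Lemma comp_right : a <= d <= b.
Proof. by rewrite hdb (le_trans hac (ltW hcd)). Qed.

Lemma comp_repelling : a <= r <= b /\ f r = r.
Proof.
by case: hrs => -[_ -> _]; split=> //; [exact: comp_left|exact: comp_right].
Qed.

Lemma comp_f u : c < u < d -> c < f u < d.
Proof.
move=> ucd; have uL := comp_in ucd; case/andP: ucd => cu ud.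
have := diffeo_lt hor comp_left uL cu; have := diffeo_lt hor uL comp_right ud.
by rewrite hfc hfd => -> ->.
Qed.

Lemma comp_g u : c < u < d -> c < g u < d.
Proof.
move=> ucd; have uL := comp_in ucd; case/andP: ucd => cu ud.
have := diffeo_inv_lt hf hor comp_left uL cu.
have := diffeo_inv_lt hf hor uL comp_right ud.
by rewrite (fixed_inv hf comp_left hfc) (fixed_inv hf comp_right hfd) => -> ->.
Qed.

(** [h] read in the coordinate v, the distance to r inside the component. The clamp is to [a, b] and
    not to [c, d], so the regularity known on [a, b] applies directly. *)
Definition conj_map (h : R -> R) v := s * ((h \o cl) (phi v) - r).

Lemma conj_mapE h v : 0 < v < l -> conj_map h v = s * (h (phi v) - r).
Proof. by move=> vl; rewrite /conj_map /= clamp_id // comp_in // -comp_range. Qed.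

Lemma phi_continuous v : {for v, continuous (fun v => phi v)}.
Proof. exact: derive_continuous (is_derive_affine r s v). Qed.

Lemma phi_conj_map h v : phi (conj_map h v) = (h \o cl) (phi v).
Proof. exact: comp_phi_invK. Qed.

Lemma conj_continuous (h : R -> R) v : (forall x, {for x, continuous h}) ->
  {for v, continuous (fun v => h (phi v))}.
Proof.
by move=> ch; apply: (@continuous_comp _ _ _ (fun v => phi v)); [exact: phi_continuous|exact: ch].
Qed.

Lemma conj_map_continuous (h : R -> R) v : (forall x, {for x, continuous (h \o cl)}) ->
  {for v, continuous (conj_map h)}.
Proof.
move=> ch; apply: continuousM; first exact: cst_continuous.
by apply: continuousB; [exact: conj_continuous|exact: cst_continuous].
Qed.

Lemma conj_derive (h : R -> R) v k : is_derive (phi v) 1 h k ->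
  is_derive v 1 (fun v => h (phi v)) (s * k).
Proof.
move=> dh; rewrite mulrC; apply: (@is_derive1_comp _ h (fun v => phi v)) => //.
exact: is_derive_affine.
Qed.

Lemma conj_map_derive (h : R -> R) v k : is_derive (phi v) 1 (h \o cl) k ->
  is_derive v 1 (conj_map h) k.
Proof.
move=> /conj_derive dh.
have := is_derive_mul (is_derive_cst s v 1) (is_deriveB dh (is_derive_cst r v 1)).
by rewrite mul0r add0r subr0 mulrA comp_sq mul1r.
Qed.

Local Notation F := (conj_map f).
Local Notation F1 := (fun v => (f1 \o cl) (phi v)).
Local Notation F2 := (fun v => s * (f2 \o cl) (phi v)).
Local Notation G := (conj_map g).
Local Notation G1 := (fun v => (g1 \o cl) (phi v)).
Local Notation G2 := (fun v => s * (g2 \o cl) (phi v)).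

Lemma comp_g_toward v : 0 < v < l -> 0 < G v < v.
Proof.
move=> vl; have ucd := vl; rewrite comp_range in ucd.
have gcd := comp_g ucd; have uL := comp_in ucd.
have : 0 < G v < l by rewrite conj_mapE // comp_range_inv.
case/andP => -> _ /=; rewrite conj_mapE // -[ltRHS]comp_phiK.
case: hrs => -[es er H]; have := H _ gcd; rewrite (diffeo_invK hf) // es er.
  by rewrite !mul1r ltrD2r.
by rewrite !mulN1r ltrN2 ltrD2r.
Qed.

Lemma normr_dir u : `|s * u| = `|u|.
Proof. by case: hrs => -[-> _ _]; rewrite ?mul1r // mulN1r normrN. Qed.

(** As s * s = 1, conjugation leaves first derivatives unchanged and multiplies second ones by s, so
    the bounds K and m carry over in both directions of motion. *)
Lemma comp_model K m : 0 <= K -> 0 < m ->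
  (forall x, a <= x <= b -> `|f2 x| <= K) -> (forall x, a <= x <= b -> `|g2 x| <= K) ->
  (forall x, a <= x <= b -> m <= g1 x) ->
  parabolic_model l K m F F1 F2 G G1 G2.
Proof.
move=> K0 m0 Kf Kg mg.
have [_ [cf cf1 cf2] df df1] := C2_within_clamp hab (diffeo_C2 hf).
have [_ [cg cg1 cg2] dg dg1] := C2_within_clamp hab (diffeo_inv_C2 hf).
have [rL fr] := comp_repelling.
have phi0 : phi 0 = r by rewrite mulr0 addr0.
have clr : cl r = r by exact: clamp_id.
have inu v : 0 < v < l -> c < phi v < d by rewrite comp_range.
have clu v : 0 < v < l -> cl (phi v) = phi v by move=> /inu/comp_in; exact: clamp_id.
split; first split.
- by rewrite subr_gt0.
- exact: K0.
- exact: m0.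
- exact: comp_g_toward.
- by move=> v; exact: conj_map_continuous.
- by move=> v; apply: conj_continuous.
- by move=> v; apply: continuousM; [exact: cst_continuous|exact: conj_continuous].
- move=> v vl; rewrite /= clu //; apply: conj_map_derive; exact/dg/comp_interior/inu.
- move=> v vl; rewrite /= clu //; apply: (@conj_derive (g1 \o cl)).
  exact/dg1/comp_interior/inu.
- by rewrite /conj_map /= phi0 clr (fixed_inv hf rL fr) subrr mulr0.
- by rewrite /= phi0 clr (fixed_inv_derive hab hf hor hpar rL fr).
- by move=> v vl; rewrite /= clu // mg // comp_in // inu.
- by move=> v vl; rewrite normr_dir /= clu // Kg // comp_in // inu.
- by move=> v vl; rewrite conj_mapE // comp_range_inv comp_f // inu.
- move=> v vl; have Fl : 0 < F v < l by rewrite conj_mapE // comp_range_inv comp_f // inu.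
  rewrite conj_mapE // phi_conj_map /= clu // (diffeo_K hf) ?comp_phiK //.
  exact/comp_in/inu.
- move=> v vl; have Gl : 0 < G v < l by rewrite conj_mapE // comp_range_inv comp_g // inu.
  rewrite conj_mapE // phi_conj_map /= clu // (diffeo_invK hf) ?comp_phiK //.
  exact/comp_in/inu.
- by move=> v; exact: conj_map_continuous.
- by move=> v; apply: conj_continuous.
- by move=> v; apply: continuousM; [exact: cst_continuous|exact: conj_continuous].
- move=> v vl; rewrite /= clu //; apply: conj_map_derive; exact/df/comp_interior/inu.
- move=> v vl; rewrite /= clu //; apply: (@conj_derive (f1 \o cl)).
  exact/df1/comp_interior/inu.
- by rewrite /conj_map /= phi0 clr fr subrr mulr0.
- by rewrite /= phi0 clr (fixed_derive hpar rL fr).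
- rewrite /conj_map /=; case: hrs => -[-> -> _].
    rewrite (_ : c + 1 * l = d); last by ring.
    rewrite clamp_id ?comp_right // (fixed_inv hf comp_right hfd).
    by rewrite mul1r.
  rewrite (_ : d + -1 * l = c); last by ring.
  rewrite clamp_id ?comp_left // (fixed_inv hf comp_left hfc).
  by rewrite mulN1r opprB.
- by move=> v vl; rewrite normr_dir /= clu // Kf // comp_in // inu.
Qed.

Lemma comp_iter_in n u : c < u < d -> c < iter n f u < d.
Proof. by move=> ucd; elim: n => [//|n IH]; exact: comp_f. Qed.

Lemma comp_iter n v : 0 < v < l -> iter n F v = s * (iter n f (phi v) - r).
Proof.
move=> vl; have ucd := vl; rewrite comp_range in ucd.
elim: n => [|n IH]; first by rewrite comp_phiK.
rewrite !iterS IH conj_mapE ?comp_phi_invK //.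
by rewrite comp_range_inv comp_iter_in.
Qed.

Lemma comp_iter_derivative n v : 0 < v < l ->
  iter_derivative F F1 n v = iter_derivative f f1 n (phi v).
Proof.
move=> vl; have ucd := vl; rewrite comp_range in ucd.
apply: eq_bigr => k _; rewrite comp_iter // comp_phi_invK /= clamp_id //.
exact/comp_in/comp_iter_in.
Qed.

(** * The Szekeres field of a component *)

Variables K m : R.
Hypothesis M : parabolic_model l K m F F1 F2 G G1 G2.

Local Notation H := (pm_contraction M).
Local Notation X := (szekeres H).
Local Notation I := (`[c, d]%classic : set R).
Local Notation J := (Iplus L f I).

Lemma comp_interiorE : I° = (`]c, d[%classic : set R).
Proof. exact: interior_itv_bnd. Qed.

Lemma comp_iter_g n u : c < u < d -> c < iter n g u < d.
Proof. by move=> ucd; elim: n => [//|n IH]; exact: comp_g. Qed.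

Lemma comp_iter_G n v : 0 < v < l -> iter n G v = s * (iter n g (phi v) - r).
Proof.
move=> vl; have ucd := vl; rewrite comp_range in ucd.
elim: n => [|n IH]; first by rewrite comp_phiK.
rewrite !iterS IH conj_mapE ?comp_phi_invK //.
by rewrite comp_range_inv comp_iter_g.
Qed.

Lemma comp_iter_g_cvg u : c < u < d -> iter n g u @[n --> \oo] --> r.
Proof.
move=> ucd; have vl : 0 < s * (u - r) < l by rewrite comp_range_inv.
have c0 : {for 0, continuous (fun v => phi v)} by exact: phi_continuous.
have := continuous_seq c0 (pc_iter_cvg0 H vl); rewrite mulr0 addr0.
rewrite [X in X @ _ --> _ -> _](_ : _ = fun n => iter n g u) //.
by apply/funext => n; rewrite comp_iter_G // !comp_phi_invK.
Qed.

Lemma comp_point : exists u, c < u < d.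
Proof. by exists ((c + d) / 2); rewrite !midf_lt. Qed.

(** Backward orbits of interior points converge to r, and uniqueness of limits excludes any other
    repelling end point. *)
Lemma comp_repelling_endpoint : repelling_endpoint L f I = r.
Proof.
apply: xget_unique => [|y [_ Hy]]; last first.
  have [u ucd] := comp_point.
  apply: cvg_unique (comp_iter_g_cvg ucd) => //.
  by apply: Hy; rewrite comp_interiorE /= in_itv.
split.
  rewrite /endpoints comp_interiorE; split => /=; rewrite in_itv /=.
    by case: hrs => -[_ -> _]; rewrite lexx ltW.
  by case: hrs => -[_ -> _]; rewrite ltxx ?andbF.
by move=> u; rewrite comp_interiorE /= in_itv /=; exact: comp_iter_g_cvg.
Qed.

Lemma IplusP u : J u <-> 0 <= s * (u - r) < l.
Proof.
rewrite /Iplus comp_repelling_endpoint comp_interiorE; split.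
  move=> [/=|->]; last by rewrite subrr mulr0 lexx subr_gt0.
  by rewrite in_itv /= -comp_range_inv => /andP[/ltW -> ->].
rewrite le_eqVlt => /andP[/predU1P[e _|v0 vl]].
  by right; rewrite /= -[LHS]comp_phi_invK -e mulr0 addr0.
by left; rewrite /= in_itv /= -comp_range_inv v0 vl.
Qed.

Lemma Iplus_phi v : 0 <= v < l -> J (phi v).
Proof. by move=> vl; apply/IplusP; rewrite comp_phiK. Qed.

Lemma dist_phi v w : `|phi w - phi v| = `|w - v|.
Proof. by rewrite (_ : _ - _ = s * (w - v)) ?normr_dir //; ring. Qed.

Lemma dist_phi_inv u w : `|s * (w - r) - s * (u - r)| = `|w - u|.
Proof. by rewrite (_ : s * (w - r) - s * (u - r) = s * (w - u)) ?normr_dir //; ring. Qed.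

Lemma Iplus_limit_point u : J u -> is_limit_point J u.
Proof.
move=> /IplusP; set v := s * (u - r) => /andP[v0 vl] e e0.
have m0 : 0 < Num.min e (l - v) by rewrite lt_min e0 subr_gt0.
have md : Num.min e (l - v) / 2 < Num.min e (l - v).
  by rewrite ltr_pdivrMr // ltr_pMr ?ltr1n.
have := md; rewrite lt_min => /andP[m1 m2].
have h0 : 0 < Num.min e (l - v) / 2 by rewrite divr_gt0.
exists (phi (v + Num.min e (l - v) / 2)).
have dst : `|phi (v + Num.min e (l - v) / 2) - u| = Num.min e (l - v) / 2.
  rewrite -[X in _ - X]comp_phi_invK dist_phi -/v addrAC subrr add0r.
  by rewrite gtr0_norm.
split; last by rewrite dst.
- by apply: Iplus_phi; rewrite addr_ge0 ?(ltW h0) //= addrC -ltrBrDr.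
- by rewrite -subr_eq0 -normr_eq0 dst gt_eqF.
Qed.

(** Provides the derivative 0 of the field at the repelling end point. *)
Lemma szekeres_le_square v : 0 < v < l -> X v <= expR (K / m * l) * K * v ^+ 2.
Proof.
move=> vl; apply: (le_trans (szekeres_le H vl)); rewrite -[leRHS]mulrA.
have D0 := displacement_gt0 H vl; have /andP[v0 vl'] := vl.
apply: ler_pM; rewrite ?expR_ge0 ?(ltW D0) //; first by rewrite ler_expR (pc_bound H).
have [z /andP[z0 zv]|z _|z [/andP[z0 zv]]] :=
    @mean_value _ (displacement G) (fun x => 1 - G1 x) 0 v v0.
- by apply: (is_derive_displacement H); rewrite z0 (lt_trans zv).
- by apply: continuousB; [exact: cvg_id|exact: (pc_cont H)].
rewrite {2}/displacement (pc_fix H) !subr0 => ->.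
rewrite expr2 mulrA ler_wpM2r ?(ltW v0) // (le_trans (ler_norm _)) //.
apply: (@le_trans _ _ (K * z)); last by rewrite ler_wpM2l ?(pc_K H) // ltW.
by apply: (one_sub_G1_le H); rewrite z0 (lt_trans zv).
Qed.

(** The push-forward of the model field: s is the derivative of the coordinate change. *)
Definition comp_field u := s * X (s * (u - r)).

Definition comp_field_slope u :=
  if 0 < s * (u - r) < l then szekeres_slope H (s * (u - r)) else 0.

Lemma comp_field_at : comp_field r = 0.
Proof. by rewrite /comp_field subrr mulr0 /szekeres ltxx mulr0. Qed.

Lemma comp_field_derive u : J u -> has_derivative_within J comp_field u (comp_field_slope u).
Proof.
move=> /IplusP Ju; rewrite /comp_field_slope; case: ifPn => [vl|vl].
  apply: is_derive_within.
  have daff : is_derive u 1 (fun u => s * (u - r)) s.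
    rewrite (_ : (fun u => _) = (fun u => - (s * r) + s * u)).
      exact: is_derive_affine.
    by apply/funext => w; ring.
  have dX := is_derive1_comp (is_derive_szekeres H vl : is_derive ((fun u => s * (u - r)) u) 1 _ _) daff.
  have := is_derive_mul (is_derive_cst s u 1) dX.
  by rewrite mul0r add0r mulrCA comp_sq mulr1.
have v0 : s * (u - r) = 0.
  by move: Ju vl => /andP[v0 ->]; rewrite andbT -leNgt => v0'; apply/le_anti/andP.
have er : u = r by rewrite -[u]comp_phi_invK v0 mulr0 addr0.
rewrite er; apply/has_derivative_withinP => e e0.
set B := expR (K / m * l) * K; have B0 : 0 <= B by rewrite mulr_ge0 ?expR_ge0 // (pc_K H).
have B1 : 0 < B + 1 by rewrite ltr_wpDl.
exists (e / (B + 1)); split; first by rewrite divr_gt0.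
move=> y /IplusP /andP[y0 yl] yr yd.
have w0 : 0 < s * (y - r).
  rewrite lt_def y0 andbT; apply: contra_neq yr => w0.
  by rewrite -[y]comp_phi_invK w0 mulr0 addr0.
have wl : 0 < s * (y - r) < l by rewrite w0.
rewrite subr0 /diff_quotient comp_field_at subr0 normrM normr_dir.
rewrite normfV -(normr_dir (y - r)) (gtr0_norm w0) (gtr0_norm (szekeres_gt0 H wl)).
rewrite ltr_pdivrMr //; apply: (le_lt_trans (szekeres_le_square wl)).
rewrite expr2 mulrA ltr_pM2r //.
move: yd; rewrite -normr_dir (gtr0_norm w0) ltr_pdivlMr // mulrC => yd.
by apply: le_lt_trans yd; rewrite ler_wpM2r ?(ltW w0) // lerDl.
Qed.

Lemma comp_field_slopeE u : J u -> derive_within J comp_field u = comp_field_slope u.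
Proof.
by move=> Ju; apply: derive_withinE (comp_field_derive Ju); exact: Iplus_limit_point.
Qed.

Lemma comp_field_C1 : C_within 1 J comp_field.
Proof.
split; first by move=> u Ju; exists (comp_field_slope u); exact: comp_field_derive.
apply/within_continuousP_eps => u Ju e e0.
have [B [B0 HB]] := szekeres_slope_le H; have B1 : 0 < B + 1 by rewrite ltr_wpDl.
rewrite comp_field_slopeE //; have [vl|vl] := boolP (0 < s * (u - r) < l).
  have /continuousP_eps /(_ e e0) [t [t0 Ht]] := continuous_szekeres_slope (H := H) vl.
  have /andP[v0 _] := vl.
  exists (Num.min t (s * (u - r))); split; first by rewrite lt_min t0.
  move=> y Jy; rewrite lt_min -dist_phi_inv => /andP[yt yv].
  have yl : 0 < s * (y - r) < l.
    have /IplusP/andP[_ ->] := Jy; rewrite andbT.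
    by move: yv; rewrite ltr_norml => /andP[+ _]; rewrite ltrBrDr addNr.
  by rewrite comp_field_slopeE // /comp_field_slope vl yl; exact: Ht.
have v0 : s * (u - r) = 0.
  have /IplusP/andP[v0 v1] := Ju; move: vl; rewrite v1 andbT -leNgt => v0'.
  exact/le_anti/andP.
exists (e / (B + 1)); split; first by rewrite divr_gt0.
move=> y Jy yd; rewrite comp_field_slopeE // /comp_field_slope (negbTE vl) subr0.
case: ifPn => [yl|_]; last by rewrite normr0.
apply: (le_lt_trans (HB _ yl)); have /andP[y0 _] := yl.
move: yd; rewrite -dist_phi_inv v0 subr0 (gtr0_norm y0) ltr_pdivlMr // mulrC => yd.
by apply: le_lt_trans yd; rewrite ler_wpM2r ?(ltW y0) // lerDl.
Qed.

Lemma comp_field_time : time_one_map J comp_field f.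
Proof.
move=> x Jx; have /IplusP/andP[x0 xl] := Jx.
move: x0; rewrite le_eqVlt => /predU1P[x0|x0].
  have er : x = r by rewrite -[x]comp_phi_invK -x0 mulr0 addr0.
  have [_ fr] := comp_repelling.
  exists (cst r); split; rewrite /cst ?er ?fr // => t _; split; first by rewrite -er.
  by rewrite comp_field_at; apply: is_derive_within; exact: is_derive_cst.
have vl : 0 < s * (x - r) < l by rewrite x0.
have [gamma [g0 g1 dg]] := szekeres_flow M vl.
exists (fun t => phi (gamma t)); split.
- by rewrite g0 comp_phi_invK.
- by rewrite g1 conj_mapE // !comp_phi_invK.
move=> t; rewrite /= in_itv /= => /dg [/andP[gt0 gtl] dgt]; split.
  by apply: Iplus_phi; rewrite ltW.
apply: is_derive_within; rewrite /comp_field comp_phiK.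
by apply: (@is_derive1_comp _ (fun v => phi v) gamma) => //; exact: is_derive_affine.
Qed.

Lemma comp_is_szekeres_field : is_szekeres_field L f I comp_field.
Proof. by split; [exact: comp_field_C1|exact: comp_field_time]. Qed.

(** * Uniqueness of the field of a component *)

Section OtherField.
Variable Z : R -> R.
Hypothesis hZ : is_szekeres_field L f I Z.

Local Notation Z1 := (derive_within J Z).
Local Notation Y := (fun v => s * Z (phi (Num.max 0 v))).
Local Notation Y1 := (fun v => Z1 (phi (Num.max 0 v))).

Lemma max0_range (v : R) : v < l -> 0 <= Num.max 0 v < l.
Proof. by move=> vl; rewrite le_max lexx /= gt_max subr_gt0 hcd. Qed.

Lemma continuous_max0_phi (h : R -> R) v : v < l ->
  (forall e : R, 0 < e -> exists t : R, 0 < t /\ forall y, J y ->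
     `|y - phi (Num.max 0 v)| < t -> `|h y - h (phi (Num.max 0 v))| < e) ->
  {for v, continuous (fun v => h (phi (Num.max 0 v)))}.
Proof.
move=> vl D; apply/continuousP_eps => e /D[t [t0 Ht]].
exists (Num.min t (l - v)); split; first by rewrite lt_min t0 subr_gt0.
move=> w; rewrite lt_min => /andP[wt wl]; apply: Ht.
  apply/Iplus_phi/max0_range; move: wl; rewrite ltr_norml => /andP[_].
  by rewrite ltrD2r.
by rewrite dist_phi; apply: le_lt_trans wt; exact: max0_dist.
Qed.

Lemma other_derive u : J u -> has_derivative_within J Z u (Z1 u).
Proof.
move=> Ju; apply: derivable_withinE; first exact: Iplus_limit_point.
by have [[D _] _] := hZ; exact: D.
Qed.

Lemma other_continuous v : v < l -> {for v, continuous Y}.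
Proof.
move=> vl; apply: continuousM; first exact: cst_continuous.
apply: continuous_max0_phi => //; apply: has_derivative_within_continuous.
exact/other_derive/Iplus_phi/max0_range.
Qed.

Lemma other_slope_continuous v : v < l -> {for v, continuous Y1}.
Proof.
move=> vl; apply: continuous_max0_phi => //.
have [[_ /within_continuousP_eps D] _] := hZ.
exact/D/Iplus_phi/max0_range.
Qed.

Lemma other_is_derive u : c < u < d -> is_derive u 1 Z (Z1 u).
Proof.
move=> ucd; have /andP[cu ud] := ucd.
apply: (@within_is_derive _ Z ((c + u) / 2) ((u + d) / 2)).
  by rewrite !midf_lt.
apply: has_derivative_withinS (other_derive _).
  move=> y; rewrite /= in_itv /= => /andP[y1 y2]; apply/IplusP.
  have : 0 < s * (y - r) < l; last by move=> /andP[/ltW -> ->].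
  by rewrite comp_range_inv (lt_le_trans _ y1) ?(le_lt_trans y2) // midf_lt.
by apply/IplusP; move: ucd; rewrite -comp_range_inv => /andP[/ltW -> ->].
Qed.

Lemma other_Y_derive v : 0 < v < l -> is_derive v 1 Y (Y1 v).
Proof.
move=> vl; have /andP[v0 _] := vl; rewrite (max_idPr (ltW v0)).
apply: (@eq_is_derive _ (fun v => s * Z (phi v)) _ _ _ v) => //.
  move=> w; rewrite ltr_norml => /andP[+ _]; rewrite ltrBrDr addNr => w0.
  by rewrite (max_idPr (ltW w0)).
have ucd := vl; rewrite comp_range in ucd.
have := is_derive_mul (is_derive_cst s v 1) (conj_derive (other_is_derive ucd)).
by rewrite mul0r add0r mulrA comp_sq mul1r.
Qed.

Lemma other_time x : 0 <= x < l -> exists gamma : R -> R,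
  [/\ gamma 0 = x, gamma 1 = F x, forall t : R, {for t, continuous gamma},
      forall t : R, 0 <= t <= 1 -> 0 <= gamma t < l &
      forall t : R, 0 < t < 1 -> is_derive t 1 gamma (Y (gamma t))].
Proof.
move=> xl; have [_ T] := hZ; have [gamma [g0 g1 dg]] := T _ (Iplus_phi xl).
have dg' t : 0 <= t <= 1 -> J (gamma t) /\ has_derivative_within `[0, 1] gamma t (Z (gamma t)).
  by move=> t01; apply: dg; rewrite /= in_itv.
have i0 : (0 : R) <= 0 <= (1 : R) by apply/andP; split; [exact: lexx|exact: ler01].
have i1 : (0 : R) <= 1 <= (1 : R) by apply/andP; split; [exact: ler01|exact: lexx].
have cg : forall t, {for t, continuous (gamma \o clamp 0 1)}.
  apply: continuous_clamp; first exact: ler01.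
  apply/within_continuousP_eps => t; rewrite /= in_itv /= => /dg'[_].
  exact: has_derivative_within_continuous.
have phiL : cl (phi x) = phi x.
  apply: clamp_id; case/andP: xl => x0 xl.
  case: hrs => -[-> -> _].
    by rewrite mul1r (le_trans hac) ?lerDl // (le_trans _ hdb) // -lerBrDl ltW.
  rewrite mulN1r (le_trans hac) ?(le_trans _ hdb) ?gerBl //.
  by rewrite lerBrDr -lerBrDl ltW.
exists (fun t => s * ((gamma \o clamp 0 1) t - r)); split.
- by rewrite /= clamp_id // g0 comp_phiK.
- by rewrite /= clamp_id // g1 /conj_map /= phiL.
- move=> t; apply: continuousM; first exact: cst_continuous.
  by apply: continuousB; [exact: cg|exact: cst_continuous].
- by move=> t t01; rewrite /= clamp_id //; have [/IplusP] := dg' t t01.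
move=> t t01; have t01' : 0 <= t <= 1 by case/andP: t01 => /ltW -> /ltW ->.
have [/IplusP /andP[Jt _] dt] := dg' t t01'.
rewrite /= clamp_id // (max_idPr Jt) comp_phi_invK.
have dc := is_derive_clamp t01 (within_is_derive t01 dt).
have := is_derive_mul (is_derive_cst s t 1) (is_deriveB dc (is_derive_cst r t 1)).
by rewrite mul0r add0r subr0.
Qed.

Lemma other_field_eq u : J u -> Z u = comp_field u.
Proof.
move=> /IplusP; rewrite /comp_field; set v := s * (u - r) => /andP[v0 vl].
have -> : Z u = s * Y v.
  by rewrite /v (max_idPr v0) comp_phi_invK mulrA comp_sq mul1r.
congr (s * _); move: v0; rewrite le_eqVlt => /predU1P[<-|v0].
  rewrite (field_at0 M other_continuous other_slope_continuous other_Y_derive other_time).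
  by rewrite /szekeres ltxx.
have vl' : 0 < v < l by rewrite v0.
exact: (field_szekeres M other_continuous other_slope_continuous
  other_Y_derive other_time vl').
Qed.

End OtherField.

(** [szekeres_field] comes from a choice: existence makes the chosen map a Szekeres field, and
    uniqueness identifies it with [comp_field] on I^+. Elsewhere both sides are 0. *)
Lemma szekeres_field_norm u : `|szekeres_field L f I u| = X (s * (u - r)).
Proof.
have X0 v : 0 <= X v.
  by have [vl|vl] := boolP (0 < v < l); [rewrite ltW // szekeres_gt0|rewrite /szekeres (negbTE vl)].
rewrite /szekeres_field /patch; case: ifPn => [|/negP Ju].
  rewrite inE => Ju; rewrite (other_field_eq _ Ju); last first.
    by apply: xgetPex; exists comp_field; exact: comp_is_szekeres_field.
  by rewrite /comp_field normr_dir ger0_norm.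
rewrite normr0 /szekeres ifF //; apply/negP => /andP[v0 vl]; apply: Ju.
by rewrite inE; apply/IplusP; rewrite ltW.
Qed.

Lemma comp_field_sup :
  let S := sup [set `|szekeres_field L f I y| | y in I] in
  [/\ forall v, 0 < v < l -> X v <= S,
      forall e : R, 0 < e -> exists v, 0 < v < l /\ S - e < X v &
      0 <= S <= expR (K / m * l) * l].
Proof.
move=> S; rewrite /S {S}; set A := [set _ | y in I].
have l0 : 0 < l by rewrite subr_gt0.
have ub v : X v <= expR (K / m * l) * l.
  have [vl|vl] := boolP (0 < v < l); last first.
    by rewrite /szekeres (negbTE vl) mulr_ge0 ?expR_ge0 // ltW.
  apply: (le_trans (szekeres_le H vl)); have D0 := displacement_gt0 H vl.
  apply: ler_pM; rewrite ?expR_ge0 ?(ltW D0) //; first by rewrite ler_expR (pc_bound H).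
  by rewrite ltW // (lt_trans (displacement_lt H vl)) //; case/andP: vl.
have hub : ubound A (expR (K / m * l) * l).
  by move=> _ [y _ <-]; rewrite szekeres_field_norm.
have mem v : 0 < v < l -> A (X v).
  move=> vl; exists (phi v); last by rewrite szekeres_field_norm comp_phiK.
  by rewrite /= in_itv /=; move: vl; rewrite comp_range => /andP[/ltW -> /ltW ->].
have [w wcd] := comp_point; have wl : 0 < s * (w - r) < l by rewrite comp_range_inv.
have hs : has_sup A.
  by split; [exists (X (s * (w - r))); exact: mem|exists (expR (K / m * l) * l)].
split.
- by move=> v vl; apply: ub_le_sup; [case: hs|exact: mem].
- move=> e e0.
  (* Lowering the supremum by at most itself keeps the threshold nonnegative, so that a value above
     it is positive and hence attained inside the component. *)
  have [v vl hv] : exists2 v, 0 < v < l & sup A - Num.min e (sup A) < X v.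
    have S0 : 0 < sup A.
      by apply: lt_le_trans (ub_le_sup hs.2 (mem _ wl)); exact: szekeres_gt0.
    have m0 : 0 < Num.min e (sup A) by rewrite lt_min e0.
    have [_ [y yI <-]] := sup_adherent m0 hs.
    rewrite szekeres_field_norm => hy.
    have [vl|vl] := boolP (0 < s * (y - r) < l); first by exists (s * (y - r)).
    move: hy; rewrite /szekeres (negbTE vl) ltNge subr_ge0 ge_min lexx orbT.
    by [].
  by exists v; split => //; apply: le_lt_trans hv; rewrite lerD2l lerN2 ge_min lexx.
- apply/andP; split; last by apply: ge_sup => //; case: hs.
  apply: le_trans (ub_le_sup hs.2 (mem _ wl)).
  by rewrite ltW // szekeres_gt0.
Qed.

End ComponentModel.

(** * The family of all components *)

Section Components.
Context {R : realType} {a b : R} {f : R -> R}.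
Hypothesis hab : a < b.
Hypothesis hf : Ck_diffeomorphism 2 `[a, b]%classic f.
Hypothesis hor : orientation_preserving `[a, b]%classic f.
Hypothesis hpar : forall p : R, `[a, b]%classic p -> f p = p -> parabolic `[a, b]%classic f p.
Implicit Types x y z u v c d : R.

Local Notation L := (`[a, b]%classic : set R).
Local Notation f1 := (derive_within L f).
Local Notation f2 := (derive_within L f1).
Local Notation g1 := (derive_within L (pinv L f)).
Local Notation g2 := (derive_within L g1).

Definition component_interval c d :=
  [/\ a <= c, c < d & d <= b] /\ [/\ f c = c, f d = d & forall x, c < x < d -> f x <> x].

Lemma component_direction c d : component_interval c d -> exists r s : R,
  [/\ s = 1, r = c & forall x, c < x < d -> x < f x] \/
  [/\ s = -1, r = d & forall x, c < x < d -> f x < x].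
Proof.
move=> [[ac cd db] [_ _ nofix]].
have [_ [cf _ _] _ _] := C2_within_clamp hab (diffeo_C2 hf).
have inL x : c < x < d -> a <= x <= b by exact: comp_in.
have nosign x y : c < x < d -> c < y < d -> x < f x -> f y < y -> False.
  have cfi z : {for z, continuous (fun z => (f \o clamp a b) z - z)}.
    by apply: continuousB; [exact: cf|exact: cvg_id].
  have fixpt z : c < z < d -> (f \o clamp a b) z - z <> 0.
    by move=> zcd /eqP; rewrite subr_eq0 /= clamp_id ?inL // => /eqP; exact: nofix.
  move=> xcd ycd xf yf; case: (ltgtP x y) => xy; last by move: xf; rewrite xy ltNge ltW.
    have [||z [zxy]] := @intermediate_value _ (fun z => - ((f \o clamp a b) z - z)) x y 0 (ltW xy).
    - by move=> z _; apply: continuousN; exact: cfi.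
    - by rewrite /= !clamp_id ?inL // oppr_le0 oppr_ge0 subr_ge0 subr_le0 !ltW.
    move=> /eqP; rewrite oppr_eq0 => /eqP; apply: fixpt; exact: itv_oo_convex xcd ycd zxy.
  have [||z [zxy]] := @intermediate_value _ (fun z => (f \o clamp a b) z - z) y x 0 (ltW xy).
  - by move=> z _; exact: cfi.
  - by rewrite /= !clamp_id ?inL // subr_ge0 subr_le0 !ltW.
  by apply: fixpt; exact: itv_oo_convex ycd xcd zxy.
have [u ucd] := @comp_point _ _ _ cd.
case: (ltgtP u (f u)) => uf; last by case: (nofix u ucd).
- exists c, 1; left; split => // x xcd.
  by case: (ltgtP x (f x)) => // xf; [case: (nosign u x)|case: (nofix x xcd)].
- exists d, (-1); right; split => // x xcd.
  by case: (ltgtP x (f x)) => // xf; [case: (nosign x u)|case: (nofix x xcd)].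
Qed.

Variables K m : R.
Hypothesis hK : 0 <= K.
Hypothesis hm : 0 < m.
Hypothesis hKf : forall x, a <= x <= b -> `|f2 x| <= K.
Hypothesis hKg : forall x, a <= x <= b -> `|g2 x| <= K.
Hypothesis hmg : forall x, a <= x <= b -> m <= g1 x.

Local Notation C := (K / m).
Local Notation W c d := (component_growth L f `[c, d]%classic).

(** The estimates of the model carried back to ]c, d[. In the last two bounds the component enters
    only through d - c, which makes them uniform. *)
Lemma component_facts c d : component_interval c d ->
  [/\ forall e : R, 0 < e -> exists N : nat, forall n x, (N <= n)%N -> c < x < d ->
        iter_derivative f f1 n x <= (W c d + e) * n%:R ^+ 2,
      forall e : R, 0 < e -> exists N : nat, forall n, (N <= n)%N -> exists x, c < x < d /\
        (W c d - e) * n%:R ^+ 2 <= iter_derivative f f1 n x,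
      forall (T : R) n x, c < x < d -> 0 <= T -> (K + 1) / 2 * expR (C * (d - c)) <= T ^+ 2 ->
        iter_derivative f f1 n x <=
          (1 + Num.sqrt (expR (C * (d - c)) * (d - c)) * (T * n%:R)) ^+ 2 &
      0 <= W c d <= K / 2 * (expR (C * (d - c)) * (d - c))].
Proof.
move=> cd0; have [r [s hrs]] := component_direction cd0.
move: cd0 => [[ac cd db] [fc fd nofix]].
have M := comp_model hab hf hor hpar ac cd db fc fd hrs hK hm hKf hKg hmg.
have [rL fr] := comp_repelling ac cd db fc fd hrs.
have [Wup Wsup /andP[S0 Sle]] := comp_field_sup hf hor ac cd db fc fd hrs M.
set S := sup _ in Wup Wsup S0 Sle.
have EW : W c d = `|s * (f2 \o clamp a b) (r + s * 0)| / 2 * S.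
  rewrite /component_growth (comp_repelling_endpoint hf hor ac cd db fc fd hrs M).
  by rewrite (normr_dir hrs) /= mulr0 addr0 clamp_id // [2^-1 * _]mulrC.
have A0 : 0 <= `|s * (f2 \o clamp a b) (r + s * 0)| / 2 by rewrite divr_ge0.
have AK : `|s * (f2 \o clamp a b) (r + s * 0)| / 2 <= K / 2.
  by rewrite ler_pM2r ?invr_gt0 // (normr_dir hrs) /= mulr0 addr0 clamp_id // hKf.
have toV x : c < x < d -> 0 < s * (x - r) < d - c by rewrite (comp_range_inv hrs).
have derV n x : c < x < d -> iter_derivative f f1 n x =
    iter_derivative (conj_map (a := a) (b := b) r s f)
      (fun v => (f1 \o clamp a b) (r + s * v)) n (s * (x - r)).
  move=> xcd; rewrite (comp_iter_derivative hor ac cd db fc fd hrs) ?toV //.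
  by rewrite (comp_phi_invK hrs).
split.
- move=> e e0; have [N HN] := growth_upper e0 Wup.
  by exists N => n x Nn xcd; rewrite derV // EW HN // toV.
- move=> e e0.
  have e20 : 0 < e / 2 by rewrite divr_gt0.
  have B0 : 0 < K / 2 + 1 by rewrite ltr_wpDl // divr_ge0.
  (* The coefficient of S is at most K / 2, so replacing S by X v costs at most e / 2; the added 1
     avoids a division by 0 when K = 0. *)
  have [|v [vl hv]] := Wsup (e / 2 / (K / 2 + 1)); first by rewrite divr_gt0.
  have [N HN] := growth_lower M vl e20.
  exists N => n /HN[x xl hx]; exists (r + s * x).
  have xcd : c < r + s * x < d by rewrite -(comp_range hrs).
  split => //; rewrite derV // (comp_phiK hrs); apply: le_trans hx.
  rewrite ler_wpM2r ?sqr_ge0 // EW.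
  set A := _ / 2 in A0 AK *; set Xv := szekeres _ _ in hv *.
  have : A * (S - Xv) <= e / 2.
    apply: (@le_trans _ _ ((K / 2 + 1) * (e / 2 / (K / 2 + 1)))).
      have [S1|S1] := leP 0 (S - Xv); last first.
        apply: (@le_trans _ _ 0); first by rewrite mulr_ge0_le0 // ltW.
        by rewrite mulr_ge0 ?divr_ge0 ?(ltW B0) ?(ltW e0).
      apply: ler_pM => //; first by rewrite (le_trans AK) // lerDl.
      by move: hv; rewrite ltrBlDr => hv; rewrite lerBlDr ltW // addrC.
    by rewrite mulrC divfK // gt_eqF.
  by rewrite mulrBr; lra.
- by move=> T n x xcd T0 HT; rewrite derV //; exact: (iter_derivative_uniform M n (toV x xcd) T0 HT).
- rewrite EW mulr_ge0 //=; exact: ler_pM.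
Qed.

(** As f is increasing, f I = I forces the end points to be fixed; conversely, when they are fixed,
    the increasing inverse keeps preimages in [c, d]. *)
Lemma component_intervalP I : components L f I <->
  exists c d, component_interval c d /\ I = `[c, d]%classic.
Proof.
split.
- move=> [[c [d [cd ->]]] [IL fI nofix]].
  have cdin x : c <= x <= d -> a <= x <= b.
    by move=> xcd; apply/segmentP; apply: IL; rewrite /= in_itv.
  have cc : c <= c <= d by rewrite lexx ltW.
  have dd : c <= d <= d by rewrite lexx ltW.
  have fin x : c <= x <= d -> c <= f x <= d.
    move=> xcd; suff : [set` `[c, d]] (f x) by rewrite /= in_itv.
    by rewrite -fI; exists x => //; rewrite /= in_itv.
  have sur y : c <= y <= d -> exists x, c <= x <= d /\ f x = y.
    move=> ycd; suff : (f @` [set` `[c, d]]) y.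
      by move=> [x]; rewrite /= in_itv /= => xcd e; exists x.
    by rewrite fI /= in_itv.
  exists c, d; split => //; split.
    by have /andP[? _] := cdin c cc; have /andP[_ ?] := cdin d dd.
  split.
  + apply/le_anti/andP; split; last by case/andP: (fin c cc).
    have [x [xcd e]] := sur c cc; rewrite -{2}e; apply: (diffeo_le hor); rewrite ?cdin //.
    by case/andP: xcd.
  + apply/le_anti/andP; split; first by case/andP: (fin d dd).
    have [x [xcd e]] := sur d dd; rewrite -{1}e; apply: (diffeo_le hor); rewrite ?cdin //.
    by case/andP: xcd.
  + by move=> x xcd; apply: nofix; rewrite interior_itv_bnd /= in_itv.
- move=> [c [d [[[ac cd db] [fc fd nofix]] ->]]].
  have cdin x : c <= x <= d -> a <= x <= b.
    by move=> /andP[cx xd]; rewrite (le_trans ac cx) (le_trans xd db).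
  have cc : c <= c <= d by rewrite lexx ltW.
  have dd : c <= d <= d by rewrite lexx ltW.
  split; first by exists c, d.
  split.
  + by move=> x; rewrite /= !in_itv /=; exact: cdin.
  + apply/seteqP; split => y.
      move=> [x]; rewrite /= !in_itv /= => xcd <-; have /andP[cx xd] := xcd.
      have := diffeo_le hor (cdin c cc) (cdin x xcd) cx.
      have := diffeo_le hor (cdin x xcd) (cdin d dd) xd.
      by rewrite fc fd => -> ->.
    rewrite /= in_itv /= => ycd; have /andP[cy yd] := ycd; have yL := cdin y ycd.
    exists (pinv L f y); last exact: (diffeo_invK hf).
    rewrite /= in_itv /=.
    have le x z : a <= x <= b -> a <= z <= b -> x <= z -> pinv L f x <= pinv L f z.
      by move=> xL zL; rewrite le_eqVlt => /predU1P[->//|xz]; rewrite ltW // (diffeo_inv_lt hf hor).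
    have := le c y (cdin c cc) yL cy; have := le y d yL (cdin d dd) yd.
    by rewrite (fixed_inv hf (cdin c cc) fc) (fixed_inv hf (cdin d dd) fd) => -> ->.
  + by move=> x; rewrite interior_itv_bnd /= in_itv /=; exact: nofix.
Qed.

(** The end points are the last fixed point before x and the first one after it. They exist because
    a and b are fixed and the set of fixed points is closed, which is [limfix]. *)
Lemma component_interval_ex x : a <= x <= b -> f x <> x ->
  exists c d, component_interval c d /\ c < x < d.
Proof.
move=> xL fx; have /andP[ax xb] := xL.
have [_ [cf _ _] _ _] := C2_within_clamp hab (diffeo_C2 hf).
have fa := diffeo_left hab hf hor; have fb := diffeo_right hab hf hor.
have limfix p : a <= p <= b -> (forall e : R, 0 < e -> exists q, [/\ a <= q <= b, f q = q & `|q - p| < e]) -> f p = p.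
  move=> pL Hp; apply/eqP; rewrite -subr_eq0 -normr_le0 leNgt; apply/negP => e0.
  have cfi : {for p, continuous (fun z => (f \o clamp a b) z - z)}.
    by apply: continuousB; [exact: cf|exact: cvg_id].
  have /continuousP_eps /(_ _ e0) [t [t0 Ht]] := cfi.
  have [q [qL fq qp]] := Hp t t0.
  by have := Ht q qp; rewrite /= !clamp_id // fq subrr sub0r normrN ltxx.
pose A := [set p | [/\ a <= p, p <= x & f p = p]].
pose B := [set p | [/\ x <= p, p <= b & f p = p]].
have hA : has_sup A by split; [exists a; split|exists x => p [_ ? _]].
have hB : has_inf B by split; [exists b; split|exists x => p [? _ _]].
have cx : sup A <= x by apply: ge_sup; [case: hA|move=> p [_ ? _]].
have xd : x <= inf B by apply: lb_le_inf; [case: hB|move=> p [? _ _]].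
have ac : a <= sup A by apply: ub_le_sup; [case: hA|split].
have db : inf B <= b by apply: ge_inf; [case: hB|split].
have fc : f (sup A) = sup A.
  apply: limfix; first by rewrite ac (le_trans cx xb).
  move=> e e0; have [p [ap px fp] hp] := sup_adherent e0 hA.
  exists p; split => //; first by rewrite ap (le_trans px xb).
  have ps : p <= sup A by apply: ub_le_sup; [case: hA|split].
  by rewrite distrC ger0_norm ?subr_ge0 // ltrBlDr -ltrBlDl.
have fd : f (inf B) = inf B.
  apply: limfix; first by rewrite db (le_trans ax xd).
  move=> e e0; have [p [xp pb fp] hp] := inf_adherent e0 hB.
  exists p; split => //; first by rewrite pb (le_trans ax xp).
  have ps : inf B <= p by apply: ge_inf; [case: hB|split].
  by rewrite ger0_norm ?subr_ge0 // ltrBlDr addrC.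
have cx' : sup A < x.
  by rewrite lt_neqAle cx andbT; apply/eqP => e; apply: fx; rewrite -e fc.
have xd' : x < inf B.
  by rewrite lt_neqAle xd andbT; apply/eqP => e; apply: fx; rewrite e fd.
exists (sup A), (inf B); split; last by rewrite cx'.
split; first by split => //; exact: lt_trans cx' xd'.
split => // z /andP[cz zd] fz.
have [zx|xz] := leP z x.
  have : z <= sup A.
    by apply: ub_le_sup; [case: hA|split => //; rewrite (le_trans ac) // ltW].
  by rewrite leNgt cz.
have : inf B <= z.
  by apply: ge_inf; [case: hB|split => //; rewrite ?(ltW xz) // (le_trans _ db) // ltW].
by rewrite leNgt zd.
Qed.

Lemma component_interval_unique c d c' d' x : component_interval c d ->
  component_interval c' d' -> c < x < d -> c' < x < d' -> c = c' /\ d = d'.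
Proof.
move=> [_ [fc fd nf]] [_ [fc' fd' nf']] /andP[cx xd] /andP[cx' xd']; split.
  case: (ltgtP c c') => // cc.
    by case: (nf c') => //; rewrite cc (lt_trans cx' xd).
  by case: (nf' c) => //; rewrite cc (lt_trans cx xd').
case: (ltgtP d d') => // dd.
  by case: (nf' d) => //; rewrite dd (lt_trans cx' xd).
by case: (nf d') => //; rewrite dd (lt_trans cx xd').
Qed.

Lemma iter_derivative_fixed n x : a <= x <= b -> f x = x -> iter_derivative f f1 n x = 1.
Proof.
move=> xL fx; have it k : iter k f x = x by elim: k => [//|k /= ->].
by rewrite /iter_derivative big1 // => k _; rewrite it (fixed_derive hpar).
Qed.

(* Components longer than [t] contain one of the points [a + k t]; the others are covered by
   the bound of [component_facts] that is uniform in the component. *)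
Lemma iter_derivative_eventually_le (S e : R) : 0 <= S -> 0 < e ->
  (forall c d, component_interval c d -> W c d <= S) ->
  exists N : nat, forall n x, (N <= n)%N -> a <= x <= b ->
    iter_derivative f f1 n x <= (S + e) * n%:R ^+ 2.
Proof.
move=> S0 e0 HS; have ba0 : 0 < b - a by rewrite subr_gt0.
have C0 : 0 <= C by rewrite divr_ge0 // ltW.
set E0 := expR (C * (b - a)); have E00 : 0 < E0 by exact: expR_gt0.
set B := (K + 1) / 2 * E0.
have B0 : 0 <= B by rewrite mulr_ge0 ?(ltW E00) // divr_ge0 ?addr_ge0.
have [T T1 HT] : exists2 T, 1 <= T & B <= T ^+ 2.
  exists (1 + B); first by rewrite lerDl.
  by rewrite sqrrD expr1n; have := sqr_ge0 B; rewrite mul1r -mulr_natl; lra.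
have T0 : 0 < T by rewrite (lt_le_trans ltr01).
(* As soon as 1 <= q * n, one has (1 + q * n)^2 <= (2 * q * n)^2 = e * n^2. *)
have [q q0 e4] : exists2 q : R, 0 < q & e = (2 * q) ^+ 2.
  exists (Num.sqrt e / 2); first by rewrite divr_gt0 // sqrtr_gt0.
  by rewrite mulrCA divff // mulr1 sqr_sqrtr // ltW.
(* Components of length at most t have a uniform bound whose coefficient of n is at most q. *)
have [t t0 qt] : exists2 t : R, 0 < t & Num.sqrt (E0 * t) * T = q.
  exists ((q / T) ^+ 2 / E0); first by rewrite divr_gt0 // exprn_gt0 // divr_gt0.
  rewrite mulrCA divff ?gt_eqF // mulr1 sqrtr_sqr gtr0_norm ?divr_gt0 //.
  by rewrite divfK // gt_eqF.
have [N0 HN0] := nat_large 1 q0.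
have big n : (N0 <= n)%N -> (1 + q * n%:R) ^+ 2 <= (S + e) * n%:R ^+ 2.
  move=> nN; apply: (@le_trans _ _ (e * n%:R ^+ 2)); last first.
    by rewrite ler_wpM2r ?sqr_ge0 // lerDr.
  rewrite e4 -exprMn ler_sqr ?nnegrE ?addr_ge0 ?mulr_ge0 ?(ltW q0) //.
  by have := HN0 n nN; rewrite [2 * q * _]mulrC mulrA; lra.
have small c d n x : component_interval c d -> d - c <= t -> (N0 <= n)%N -> c < x < d ->
    iter_derivative f f1 n x <= (S + e) * n%:R ^+ 2.
  move=> cd dct nN xcd; have [_ _ U _] := component_facts cd.
  have [[ac cd' db] _] := cd; have dc0 : 0 < d - c by rewrite subr_gt0.
  have dcba : d - c <= b - a by rewrite lerB.
  have EE : expR (C * (d - c)) <= E0 by rewrite ler_expR ler_wpM2l.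
  apply: le_trans (big n nN); apply: (le_trans (U T n x xcd (ltW T0) _)).
    apply: le_trans HT; rewrite ler_wpM2l // divr_ge0 ?addr_ge0 //.
  rewrite ler_sqr ?nnegrE ?addr_ge0 ?mulr_ge0 ?sqrtr_ge0 ?(ltW q0) ?(ltW T0) //.
  rewrite lerD2l mulrA ler_wpM2r // -qt ler_wpM2r ?(ltW T0) // ler_wsqrtr //.
  by apply: ler_pM; rewrite ?expR_ge0 ?(ltW dc0).
(* At most one component contains a + k t in its interior, so a single rank exists for each k; then
   finitely many k are merged. *)
pose P k N := forall c d n x, component_interval c d -> c < a + k%:R * t < d ->
  (N <= n)%N -> c < x < d -> iter_derivative f f1 n x <= (S + e) * n%:R ^+ 2.
have exP (k : nat) : exists N, P k N.
  have [[c [d [cd pcd]]]|no] := pselect (exists c d, component_interval c d /\ c < a + k%:R * t < d).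
    have [U _ _ _] := component_facts cd; have [N HN] := U e e0.
    exists N => c' d' n x cd' pcd' nN xcd.
    have [ec ed] := component_interval_unique cd cd' pcd pcd'.
    rewrite -ec -ed in xcd; apply: (le_trans (HN n x nN xcd)).
    by rewrite ler_wpM2r ?sqr_ge0 // lerD2r HS.
  by exists 0%N => c d n x cd pcd; case: no; exists c, d.
have exPm (k : nat) : exists N, forall j, (j < k)%N -> P j N.
  elim: k => [|k [N HN]]; first by exists 0%N.
  have [N' HN'] := exP k; exists (maxn N N') => j.
  rewrite ltnS leq_eqVlt => /predU1P[->|jk] c d n x cd pcd; rewrite geq_max => /andP[n1 n2].
    exact: HN'.
  exact: (HN j jk).
have [k0 Hk0] := nat_large (b - a) t0; have {}Hk0 := Hk0 k0 (leqnn _).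
have [N1 HN1] := exPm k0.
exists (maxn N0 N1) => n x; rewrite geq_max => /andP[n0 n1] xL.
have [fx|/eqP fx] := eqVneq (f x) x.
  rewrite iter_derivative_fixed //; apply: le_trans (big n n0).
  by rewrite expr_ge1 // ?addr_ge0 ?lerDl ?mulr_ge0 ?(ltW q0).
have [c [d [cd xcd]]] := component_interval_ex xL fx.
have [dct|tdc] := leP (d - c) t; first exact: small cd dct n0 xcd.
have [[ac cd' db] _] := cd.
have r0 : 0 <= (c - a) / t by rewrite divr_ge0 ?subr_ge0 // ltW.
(* The successor of the truncation puts a + k t in ]c, c + t], hence in ]c, d[. *)
set k := (Num.truncn ((c - a) / t)).+1.
have k1 : c - a < k%:R * t by rewrite -ltr_pdivrMr // truncnS_gt.
have k2 : k%:R * t <= c - a + t.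
  rewrite /k -natr1 mulrDl mul1r lerD2r -ler_pdivlMr //.
  by rewrite truncn_le.
apply: (HN1 k _ c d) => //.
  rewrite -(ltr_nat R) -(ltr_pM2r t0); apply: (le_lt_trans k2).
  by rewrite [k0%:R * t]mulrC; apply: lt_le_trans Hk0; move: tdc db; lra.
by move: k1 k2 tdc; move: (k%:R * t) => z; lra.
Qed.

End Components.

Arguments component_interval {R} a b f c d.

Theorem mainTheorem1 (R : realType) (a b : R) (f : R -> R) (hab : a < b)
    (hf : Ck_diffeomorphism 2 `[a, b]%classic f)
    (hor : orientation_preserving `[a, b]%classic f)
    (hid : exists x : R, `[a, b]%classic x /\ f x <> x)
    (hpar : forall p : R, `[a, b]%classic p -> f p = p -> parabolic `[a, b]%classic f p) :
  exists l : R,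
    (Gamma_plus `[a, b]%classic f n / n%:R ^+ 2 @[n --> \oo] --> l) /\
    l%:E = ereal_sup [set (component_growth `[a, b]%classic f I)%:E
                     | I in components `[a, b]%classic f].

Proof.
have [K [m [K0 m0 Kf Kg mg]]] := diffeo_bounds hab hf hor.
set f1 := derive_within `[a, b]%classic f.
have facts c d := @component_facts R a b f hab hf hor hpar K m K0 m0 Kf Kg mg c d.
have C0 : 0 <= K / m by rewrite divr_ge0 // ltW.
set A := [set component_growth `[a, b]%classic f I | I in components `[a, b]%classic f].
(* Here f != id enters: without any component the extended supremum would be -oo. *)
have A0 : A !=set0.
  have [x [xL fx]] := hid; move/segmentP: xL => xL.
  have [c [d [cd _]]] := component_interval_ex hab hf hor xL fx.
  exists (component_growth `[a, b]%classic f `[c, d]%classic); exists `[c, d]%classic => //.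
  by apply/(component_intervalP hf hor); exists c, d.
have inA c d : component_interval a b f c d ->
    A (component_growth `[a, b]%classic f `[c, d]%classic).
  move=> cd; exists `[c, d]%classic => //.
  by apply/(component_intervalP hf hor); exists c, d.
have Aub : has_ubound A.
  exists (K / 2 * (expR (K / m * (b - a)) * (b - a))) => _ [I HI <-].
  move/(component_intervalP hf hor): HI => [c [d [cd ->]]].
  have [_ _ _ /andP[_ h]] := facts c d cd; apply: (le_trans h).
  have [[ac cd' db] _] := cd.
  have dcba : d - c <= b - a by rewrite lerB.
  rewrite ler_wpM2l ?divr_ge0 //; apply: ler_pM; rewrite ?expR_ge0 ?subr_ge0 ?(ltW cd') //.
  by rewrite ler_expR ler_wpM2l.
have hA : has_sup A by [].
have S0 : 0 <= sup A.
  have [_ [I HI _]] := A0; move/(component_intervalP hf hor): HI => [c [d [cd _]]].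
  have [_ _ _ /andP[h _]] := facts c d cd.
  exact: le_trans h (ub_le_sup Aub (inA c d cd)).
exists (sup A); split; last first.
  rewrite -(ereal_sup_EFin Aub A0); congr ereal_sup.
  by rewrite /A image_comp.
apply/cvg_nearP => e e0.
have e20 : 0 < e / 2 by rewrite divr_gt0.
have HS c d : component_interval a b f c d ->
    component_growth `[a, b]%classic f `[c, d]%classic <= sup A.
  by move=> cd; apply: ub_le_sup => //; exact: inA.
have [N1 HN1] := iter_derivative_eventually_le hab hf hor hpar K0 m0 Kf Kg mg S0 e20 HS.
(* One quarter of e goes to the choice of a nearly optimal component, another to its lower growth
   bound. *)
have e40 : 0 < e / 2 / 2 by rewrite divr_gt0.
have [_ [I HI <-] hI] := sup_adherent e40 hA.
move/(component_intervalP hf hor): HI hI => [c [d [cd ->]]] hI.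
have [_ lower _ _] := facts c d cd; have [N2 HN2] := lower _ e40.
(* The 1 keeps n positive, so that n^2 can be divided out. *)
exists (maxn 1 (maxn N1 N2)) => n; rewrite !geq_max => /and3P[n0 n1 n2].
have n20 : 0 < n%:R ^+ 2 :> R by rewrite exprn_gt0 // ltr0n.
have up y : [set derive_within `[a, b]%classic (iter n f) x | x in `[a, b]%classic] y -> y <= (sup A + e / 2) * n%:R ^+ 2.
  move=> [x /segmentP xL <-]; rewrite (derive_within_iter hab hf) //.
  exact: HN1.
have [x [xcd hx]] := HN2 n n2.
have xL : a <= x <= b.
  by have [[ac _ db] _] := cd; exact: (comp_in ac db xcd).
have memx : [set derive_within `[a, b]%classic (iter n f) x | x in `[a, b]%classic] (iter_derivative f f1 n x).
  by exists x; [exact/segmentP|rewrite (derive_within_iter hab hf)].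
have G1 : Gamma_plus `[a, b]%classic f n <= (sup A + e / 2) * n%:R ^+ 2.
  by apply: ge_sup; [eexists; exact: memx|exact: up].
have G2 : (sup A - e / 2) * n%:R ^+ 2 <= Gamma_plus `[a, b]%classic f n.
  apply: (@le_trans _ _ (iter_derivative f f1 n x)); last first.
    by apply: ub_le_sup memx; exists ((sup A + e / 2) * n%:R ^+ 2).
  apply: le_trans hx; rewrite ler_pM2r //; move: hI; lra.
rewrite -ler_pdivrMr // in G1; rewrite -ler_pdivlMr // in G2.
by rewrite ltr_norml; apply/andP; split; move: G1 G2; lra.
Qed.
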